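(* Let $f$ be a function on $\mathbb{T}$ whose Fourier coefficients $\widehat f(k)=\int_{\mathbb{T}}e^{-ik\theta}f(\theta)\,d\theta$ satisfy $\sum_{k=-\infty}^{\infty}k^2|\widehat f(k)|^2<\infty$, and likewise for $g$. Consider the linear statistics $X(f)=\sum_{k=1}^N f(\arg z_k)$, $X(g)=\sum_{k=1}^N g(\arg z_k)$ under $P_N$. Then, as $N\uparrow\infty$, $$\mathrm{Cov}_N\bigl(X(f),X(g)\bigr)=\frac{\log N}{4}\int_{\mathbb{T}}f'(\theta)g'(\theta)\,d\theta+o(\log N).$$ If in addition one of the two test functions satisfies a stronger condition, namely $\sum_{k=-\infty}^{\infty}|k|^{2+\delta}|\widehat f(k)|^2<\infty$ for some $\delta>0$ (or the same condition with $g$ in place of $f$), then the $o(\log N)$ error may be replaced by $O(1)$.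
   Context: Ginibre's complex ensemble: $P_N$ is the probability measure on $\mathbb{C}^N$ given by $$dP_N(z_1,\dots,z_N)=\frac1{Z_N}\prod_{1\le \ell<k\le N}|z_\ell-z_k|^2\,\mu_N(dz_1)\cdots\mu_N(dz_N),\qquad \mu_N(dz)=e^{-N|z|^2}\,d\Re(z)\,d\Im(z),$$ with $Z_N$ the normalizing constant. Also $\mathrm{Cov}_N(X(f),X(g))=\int X(f)X(g)\,dP_N-\int X(f)\,dP_N\int X(g)\,dP_N$. $\mathbb{T}=[-\pi,\pi]$ is the circle, with Lebesgue measure $d\theta$ normalized so that $\int_{\mathbb{T}}d\theta=1$. Derivatives $f',g'$ are $L^2$ (weak) derivatives on the circle. *)

(* Defs.v *)
From HB Require Import structures.
From mathcomp Require Import all_boot all_order all_algebra.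
From mathcomp Require Import complex.
From mathcomp Require Import all_classical all_reals all_analysis.
From mathcomp Require Import measurable_realfun.

Set Implicit Arguments.
Unset Strict Implicit.
Unset Printing Implicit Defensive.

Import Order.TTheory GRing.Theory Num.Theory.
Import numFieldNormedType.Exports.
Import Normc.

Local Open Scope classical_set_scope.
Local Open Scope ring_scope.
Local Open Scope complex_scope.

Section complex_numbers.
Context {R : realType}.
Implicit Types z : R[i].

Definition expi (t : R) : R[i] := cos t +i* sin t.

(* The principal argument, in ]-pi, pi]; see Arg_bounds and Arg_polar.  The
   value at 0 is irrelevant: {z | z = 0} is Lebesgue-null. *)
Definition Arg z : R :=
  let t := acos (complex.Re z / normc z) in
  if 0 <= complex.Im z then t else - t.

Lemma cos_Arg_itv z : -1 <= complex.Re z / normc z <= 1.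
Proof.
case: z => x y /=; set r := Num.sqrt _.
have [->|r0] := eqVneq r 0; first by rewrite invr0 mulr0 oppr_le0 ler01.
have rgt0 : 0 < r by rewrite lt_neqAle eq_sym r0 sqrtr_ge0.
rewrite -ler_norml normrM normfV (gtr0_norm rgt0) ler_pdivrMr// mul1r.
by rewrite -sqrtr_sqr ler_wsqrtr// lerDl sqr_ge0.
Qed.

Lemma Arg_bounds z : - pi < Arg z <= pi.
Proof.
have zitv := cos_Arg_itv z; have /acos_def[/andP[t0 tpi] _] := zitv.
rewrite /Arg; case: ifPn => [_|].
  by rewrite tpi andbT (lt_le_trans _ t0)// oppr_lt0 pi_gt0.
rewrite -ltNge => y0; rewrite ltrN2 acos_ltpi ?(le_trans _ (pi_ge0 R)) ?oppr_le0//.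
case/andP: zitv => z1 ->; rewrite andbT lt_neqAle z1 andbT.
case: z y0 {t0 tpi z1} => x y /= y0; set r := Num.sqrt _.
have s0 : 0 < x ^+ 2 + y ^+ 2.
  by rewrite ltr_wpDl ?sqr_ge0// exprn_even_gt0//= lt_eqF.
have r0 : r != 0 by rewrite gt_eqF// sqrtr_gt0.
apply/eqP => /(congr1 (fun u => (u * r) ^+ 2)).
rewrite divfK// mulN1r sqrrN sqr_sqrtr ?ltW// => /eqP.
by rewrite -subr_eq0 addrAC subrr add0r sqrf_eq0 lt_eqF.
Qed.

Lemma Arg_polar z : z = (normc z)%:C * expi (Arg z).
Proof.
have [z0|r0] := eqVneq (normc z) 0; first by rewrite z0 mul0r (eq0_normc z0).
have zitv := cos_Arg_itv z; have /acos_def[_ ct] := zitv.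
have st := sin_acos zitv.
have rgt0 : 0 < normc z.
  by rewrite lt_neqAle eq_sym r0; case: (z) => ? ? /=; exact: sqrtr_ge0.
have {}st : sin (acos (complex.Re z / normc z)) = `|complex.Im z| / normc z.
  rewrite st -sqrtr_sqr -[in RHS](gtr0_norm rgt0) -sqrtr_sqr -sqrtrV ?sqr_ge0//.
  rewrite -sqrtrM ?sqr_ge0//; congr Num.sqrt; rewrite expr_div_n -exprVn.
  apply: (mulIf (expf_neq0 2 r0)); rewrite exprVn mulrBl !divfK ?expf_neq0// mul1r.
  case: (z) => x y /=; rewrite sqr_sqrtr ?addr_ge0 ?sqr_ge0//.
  by rewrite addrAC subrr add0r.
have nzE u : (normc z)%:C * (complex.Re z / normc z +i* (u / normc z)) =
    complex.Re z +i* u.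
  by simpc; rewrite ![normc z * _]mulrC !divfK.
rewrite /expi /Arg; case: ifPn => [y0|].
  by rewrite ct st ger0_norm// nzE; case: (z).
rewrite -ltNge => y0.
by rewrite cosN sinN ct st ltr0_norm// mulNr opprK nzE; case: (z).
Qed.

End complex_numbers.

(* Lebesgue integral of a complex-valued function, taken componentwise. *)
Section complex_integral.
Context d (T : measurableType d) (R : realType).
Implicit Types (mu : {measure set T -> \bar R}) (D : set T) (F : T -> R[i]).

Definition Cintegral mu D F : R[i] :=
  (\int[mu]_(x in D) complex.Re (F x))%R +i*
  (\int[mu]_(x in D) complex.Im (F x))%R.

Definition Cintegrable mu D F : Prop :=
  mu.-integrable D (EFin \o (@complex.Re R \o F)) /\
  mu.-integrable D (EFin \o (@complex.Im R \o F)).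

Definition Cmeasurable D F : Prop :=
  measurable_fun D (@complex.Re R \o F) /\
  measurable_fun D (@complex.Im R \o F).

End complex_integral.

(* Functions on the circle [-pi, pi] are functions on R of which only the
   restriction to [-pi, pi] is ever used. *)
Section circle.
Context {R : realType}.
Implicit Types (f g h : R -> R[i]) (phi : R -> R).

Definition circle : set R := `[- pi, pi].

Definition circle_integral f : R[i] :=
  ((2 * pi)^-1)%:C * Cintegral lebesgue_measure circle f.

Definition fourier f (k : int) : R[i] :=
  circle_integral (fun t => expi (- (k%:~R * t)) * f t).

Definition L2_circle f : Prop :=
  Cmeasurable circle f /\
  (\int[lebesgue_measure]_(t in circle) (normc (f t) ^+ 2)%:E < +oo)%E.

Definition circle_test_function phi : Prop :=
  (forall n t, derivable (phi^`(n)%classic) t 1) /\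
  (forall t, phi (t + 2 * pi) = phi t).

(* The boundary terms vanish by periodicity of phi, so h is the derivative of f
   as a distribution on the circle, not merely on the open interval. *)
Definition is_weak_derivative f h : Prop :=
  L2_circle h /\
  forall phi, circle_test_function phi ->
    circle_integral (fun t => f t * (phi^`()%classic t)%:C) =
    - circle_integral (fun t => h t * (phi t)%:C).

(* A chosen representative of the weak derivative, which is unique up to null
   sets; the zero function when f has no weak derivative in L^2. *)
Definition weak_derivative f : R -> R[i] :=
  xget (fun=> 0) [set h | is_weak_derivative f h].

End circle.

Section density.
Local Open Scope ereal_scope.
Context d (T : measurableType d) (R : realType).

Definition density (m : set T -> \bar R) (h : T -> R) (A : set T) : \bar R :=
  \int[m]_(x in A) (h x)%:E.

Variables (m : {measure set T -> \bar R}) (h : T -> R).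
Hypotheses (mh : measurable_fun setT h) (h0 : forall x, (0 <= h x)%R).

Lemma density0 : density m h set0 = 0.
Proof. by rewrite /density integral_set0. Qed.

Lemma density_ge0 A : 0 <= density m h A.
Proof. by apply: integral_ge0 => x _; rewrite lee_fin. Qed.

Lemma density_sigma_additive : semi_sigma_additive (density m h).
Proof.
move=> A mA tA mUA; rewrite /density ge0_integral_bigcup//=; last 2 first.
- by apply/measurable_EFinP; exact: measurable_funTS.
- by move=> x _; rewrite lee_fin.
apply: is_cvg_ereal_nneg_natsum_cond => n _ _.
by apply: integral_ge0 => x _; rewrite lee_fin.
Qed.

End density.

Lemma product_sigma_finite d1 d2 (T1 : measurableType d1)
    (T2 : measurableType d2) (R : realType)
    (m1 : {sigma_finite_measure set T1 -> \bar R})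
    (m2 : {sigma_finite_measure set T2 -> \bar R}) :
  sigma_finite setT (m1 \x m2)%E.
Proof.
have /sigma_finiteP[F [TF ndF Foo]] := sigma_finiteT m1.
have /sigma_finiteP[G [TG ndG Goo]] := sigma_finiteT m2.
exists (fun n => F n `*` G n).
  rewrite -setXTT TF TG predeqE => -[x y]; split.
    move=> [/= [n _ Fnx] [k _ Gky]]; exists (maxn n k) => //; split.
    - by move: x Fnx; exact/subsetPset/ndF/leq_maxl.
    - by move: y Gky; exact/subsetPset/ndG/leq_maxr.
  by move=> [n _ []/= ? ?]; split; exists n.
move=> k; have [? ?] := Foo k; have [? ?] := Goo k.
split; first exact: measurableX.
by rewrite product_measure1E// lte_mul_pinfty// ge0_fin_numE.
Qed.

Section tuple_measure.
Local Open Scope ereal_scope.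
Context d (T : measurableType d) (R : realType).

(* The n-fold product of mu. *)
Fixpoint tuple_measure (mu : set T -> \bar R) n : set (n.-tuple T) -> \bar R :=
  match n with
  | 0 => fun A => \d_([tuple] : 0.-tuple T) A
  | n'.+1 => pushforward (mu \x @tuple_measure mu n')
               (fun p => [tuple of p.1 :: p.2])
  end.

Variable mu : {sigma_finite_measure set T -> \bar R}.

Lemma tuple_measureP n :
  exists m : {sigma_finite_measure set (n.-tuple T) -> \bar R},
    m = @tuple_measure mu n :> (set _ -> _).
Proof.
elim: n => [|n [m mE]].
  by exists (\d_([tuple] : 0.-tuple T)).
pose f (p : T * n.-tuple T) := [tuple of p.1 :: p.2].
have mf : measurable_fun setT f by exact: measurable_cons.
pose q : {measure set _ -> \bar R} :=
  @measure_function_pushforward__canonical__measure_function_Measure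
    _ _ _ _ _ (mu \x m) f mf.
have qsf : sigma_finite setT q.
  have [F FT Foo] := product_sigma_finite mu m.
  pose g (t : n.+1.-tuple T) := (thead t, [tuple of behead t]).
  have mg : measurable_fun setT g.
    apply/measurable_fun_pairP; split.
      exact: (measurable_tnth ord0).
    exact: measurable_behead.
  have fK p : g (f p) = p.
    case: p => x t; rewrite /g /f /=; congr pair; exact: val_inj.
  have gK t : f (g t) = t by rewrite /f /g/= -tuple_eta.
  exists (fun k => g @^-1` F k).
    by rewrite -preimage_bigcup -FT preimage_setT.
  move=> k; have [mFk Fkoo] := Foo k; split.
    by rewrite -[X in measurable X]setTI; exact: mg.
  rewrite /q/= /pushforward -comp_preimage.
  by rewrite (_ : g \o f = id) ?preimage_id//; apply/funext.
pose Q := HB.pack_for {sigma_finite_measure set (n.+1.-tuple T) -> \bar R}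
  (q : set _ -> _) (Measure.class q) (Measure_isSigmaFinite.Build _ _ _ q qsf).
by exists Q; rewrite /= -mE.
Qed.

Lemma tuple_measure0 n : @tuple_measure mu n set0 = 0.
Proof. by have [m <-] := tuple_measureP n; exact: measure0. Qed.

Lemma tuple_measure_ge0 n A : 0 <= @tuple_measure mu n A.
Proof. by have [m <-] := tuple_measureP n; exact: measure_ge0. Qed.

Lemma tuple_measure_sigma_additive n : semi_sigma_additive (@tuple_measure mu n).
Proof.
by have [m <-] := tuple_measureP n; exact: measure_semi_sigma_additive.
Qed.

HB.instance Definition _ n := isMeasure.Build _ _ _ (@tuple_measure mu n)
  (tuple_measure0 n) (@tuple_measure_ge0 n) (@tuple_measure_sigma_additive n).

Lemma tuple_measure_sigma_finite n : sigma_finite setT (@tuple_measure mu n).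
Proof. by have [m <-] := tuple_measureP n; exact: sigma_finiteT. Qed.

HB.instance Definition _ n := Measure_isSigmaFinite.Build _ _ _
  (@tuple_measure mu n) (tuple_measure_sigma_finite n).

End tuple_measure.

(* The complex plane is R * R, so that it carries the product sigma-algebra
   and the Lebesgue measure dRe(z) dIm(z). *)
Section ginibre.
Context {R : realType}.
Implicit Types (N : nat) (f : R -> R[i]).

Definition toC (z : R * R) : R[i] := z.1 +i* z.2.

Definition gauss_weight N (z : R * R) : R :=
  expR (- (N%:R * normc (toC z) ^+ 2)).

Definition mu_gauss N : set (R * R) -> \bar R :=
  density (lebesgue_measure \x lebesgue_measure)%E (gauss_weight N).

Lemma normc_toC_sqr z : normc (toC z) ^+ 2 = z.1 ^+ 2 + z.2 ^+ 2.
Proof. by rewrite sqr_sqrtr// addr_ge0 ?sqr_ge0. Qed.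

Lemma measurable_gauss_weight N : measurable_fun setT (gauss_weight N).
Proof.
rewrite /gauss_weight; under eq_fun do rewrite normc_toC_sqr.
apply: measurableT_comp => //; apply: measurableT_comp => //.
apply: measurable_funM => //; apply: measurable_funD => //.
- by apply: measurable_funX; exact: measurable_fst.
- by apply: measurable_funX; exact: measurable_snd.
Qed.

Let gauss_weight_ge0 N z : 0 <= gauss_weight N z.
Proof. exact: expR_ge0. Qed.

Lemma mu_gauss0 N : mu_gauss N set0 = 0%E.
Proof. exact: density0. Qed.

Lemma mu_gauss_ge0 N A : (0 <= mu_gauss N A)%E.
Proof. exact: density_ge0. Qed.

Lemma mu_gauss_sigma_additive N : semi_sigma_additive (mu_gauss N).
Proof.
exact: (@density_sigma_additive _ _ _ (lebesgue_measure \x lebesgue_measure)%E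
  _ (measurable_gauss_weight N)).
Qed.

HB.instance Definition _ N := isMeasure.Build _ _ _ (mu_gauss N)
  (mu_gauss0 N) (@mu_gauss_ge0 N) (@mu_gauss_sigma_additive N).

Lemma mu_gauss_sigma_finite N : sigma_finite setT (mu_gauss N).
Proof.
have [F FT Foo] := product_sigma_finite (@lebesgue_measure R) (@lebesgue_measure R).
exists F => // k; have [mFk Fkoo] := Foo k; split => //.
apply: le_lt_trans Fkoo; rewrite -[leRHS]mul1e -integral_cst//.
apply: ge0_le_integral => //.
- by move=> z _; rewrite lee_fin expR_ge0.
- by apply/measurable_EFinP/measurable_funTS; exact: measurable_gauss_weight.
- move=> z _; rewrite lee_fin -expR0 ler_expR oppr_le0 mulr_ge0//.
  by rewrite sqr_ge0.
Qed.

HB.instance Definition _ N := Measure_isSigmaFinite.Build _ _ _ (mu_gauss N)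
  (mu_gauss_sigma_finite N).

Definition vandermonde2 N (z : N.-tuple (R * R)) : R :=
  \prod_(l < N) \prod_(k < N | (l < k)%N)
    normc (toC (tnth z l) - toC (tnth z k)) ^+ 2.

Lemma vandermonde2_ge0 N (z : N.-tuple (R * R)) : 0 <= vandermonde2 z.
Proof. by do 2![apply: prodr_ge0 => ? _]; rewrite sqr_ge0. Qed.

Lemma measurable_vandermonde2 N : measurable_fun setT (@vandermonde2 N).
Proof.
pose D (l k : 'I_N) (z : N.-tuple (R * R)) : R :=
  ((tnth z l).1 - (tnth z k).1) ^+ 2 + ((tnth z l).2 - (tnth z k).2) ^+ 2.
have mD l k : measurable_fun setT (D l k).
  apply: measurable_funD; apply: measurable_funX; apply: measurable_funB.
  - exact: (measurableT_comp measurable_fst (measurable_tnth l)).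
  - exact: (measurableT_comp measurable_fst (measurable_tnth k)).
  - exact: (measurableT_comp measurable_snd (measurable_tnth l)).
  - exact: (measurableT_comp measurable_snd (measurable_tnth k)).
rewrite (_ : @vandermonde2 N = fun z => \prod_(l < N) \prod_(k < N)
    (if (l < k)%N then D l k z else 1)).
  apply: measurable_prod => l _; apply: measurable_prod => k _.
  by case: (l < k)%N; [exact: mD|exact: measurable_cst].
apply/funext => z; apply: eq_bigr => l _; rewrite big_mkcond.
apply: eq_bigr => k _; case: ifP => // _.
by rewrite [LHS]sqr_sqrtr// addr_ge0 ?sqr_ge0.
Qed.

Definition ginibre_Z N : R :=
  (\int[tuple_measure (mu_gauss N) (n:=N)]_z vandermonde2 z)%R.

Definition ginibre N : set (N.-tuple (R * R)) -> \bar R :=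
  density (tuple_measure (mu_gauss N) (n:=N))
    (fun z => (ginibre_Z N)^-1 * vandermonde2 z).

Let ginibre_density_ge0 N (z : N.-tuple (R * R)) :
  0 <= (ginibre_Z N)^-1 * vandermonde2 z.
Proof.
rewrite mulr_ge0 ?vandermonde2_ge0// invr_ge0 Rintegral_ge0// => t _.
exact: vandermonde2_ge0.
Qed.

Let measurable_ginibre_density N :
  measurable_fun setT
    (fun z : N.-tuple (R * R) => (ginibre_Z N)^-1 * vandermonde2 z).
Proof. by apply: measurable_funM => //; exact: measurable_vandermonde2. Qed.

Lemma ginibre0 N : @ginibre N set0 = 0%E.
Proof. exact: (density0 (tuple_measure (mu_gauss N) (n:=N))). Qed.

Lemma ginibre_ge0 N A : (0 <= @ginibre N A)%E.
Proof. exact/density_ge0/ginibre_density_ge0. Qed.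

Lemma ginibre_sigma_additive N : semi_sigma_additive (@ginibre N).
Proof.
exact: (@density_sigma_additive _ _ _ (tuple_measure (mu_gauss N) (n:=N))
  _ (@measurable_ginibre_density N) (@ginibre_density_ge0 N)).
Qed.

HB.instance Definition _ N := isMeasure.Build _ _ _ (@ginibre N)
  (ginibre0 N) (@ginibre_ge0 N) (@ginibre_sigma_additive N).

Definition ginibre_mean N (X : N.-tuple (R * R) -> R[i]) : R[i] :=
  Cintegral (@ginibre N) setT X.

Definition ginibre_cov N (X Y : N.-tuple (R * R) -> R[i]) : R[i] :=
  ginibre_mean (fun z => X z * Y z) - ginibre_mean X * ginibre_mean Y.

Definition linear_statistic N f (z : N.-tuple (R * R)) : R[i] :=
  \sum_(k < N) f (Arg (toC (tnth z k))).

End ginibre.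

(* Main.v *)
Require Import Defs.
From HB Require Import structures.
From mathcomp Require Import all_boot all_order all_algebra fingroup perm.
From mathcomp Require Import complex.
From mathcomp Require Import all_classical all_reals all_analysis.
From mathcomp Require Import measurable_realfun.
From mathcomp Require Import zify ring lra.

(** The squared Vandermonde product is a double sum over permutations of products
of monomials z^i conj(z)^j in the single particles. The weight exp(-N |z|^2) is
rotation invariant, so distinct monomials are orthogonal, and inserting a function
of one particle alters only one row of the Gram matrix. Expanding everything gives the exact
determinantal formula ginibre_cov_linear: the covariance is the trace of the
multiplication operator by f g on the first N monomials, minus the trace of the
product of the truncated multiplication operators by f and by g.

For functions of the argument these operators are explicit. The argument is
uniform and independent of the modulus (circle_average_gauss), so the entry (i, j)
is a Fourier coefficient f^(j - i) times the absolute moment m(i + j), suitably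
normalised (Cintegral_polar). Collecting the pairs (i, j) with j - i = k yields
ginibre_cov_fourier:
[[
  Cov_N = sum over k of f^(k) g^(-k) w_N(|k|),
  w_N(k) = N - sum over i < N - k of m(2i + k)^2 / (m(2i) m(2i + 2k)).
]]

The theorem thus reduces to w_N(k) = (k^2 / 4) log N + O(k^2 (1 + log k)), uniformly
in N (cov_weight_log). The moments satisfy m(n + 2) = (n + 2) / (2 N) m(n) and are
log-convex. Writing rho_i for the i-th quotient in w_N(k), the recursion gives
rho_(i + 1) / rho_i = 1 + k^2 / (4 (i + 1) (i + 1 + k)), and log-convexity makes
rho_i increase to 1. Summation by parts (sum_moment_deficit) then turns the sum of
1 - rho_i into k^2 / 4 times a harmonic sum.

By Parseval, the integral of f' g' is the sum of k^2 f^(k) g^(-k)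
(weak_derivative_pairing), which is the main term. The error is dominated by the
sum of k^2 |f^(k) g^(-k)| min(1 + log k, 1 + log N). Cutting this sum at a large
fixed frequency makes it o(log N); if f or g satisfies the condition with exponent
2 + delta, the factor log k is absorbed (log_absorb) and the sum is O(1).

Parseval and the existence of the weak derivative rest on two classical facts about
the circle: the Riesz-Fischer theorem (riesz_fischer), and the uniqueness of the
Fourier coefficients of an integrable function (zero_fourier_ae), which identifies
f with the sum of its Fourier series. *)

Set Implicit Arguments.
Unset Strict Implicit.
Unset Printing Implicit Defensive.

Import Order.TTheory GRing.Theory Num.Theory.
Import numFieldNormedType.Exports.
Import Normc.

Local Open Scope classical_set_scope.
Local Open Scope ring_scope.
Local Open Scope complex_scope.

(** * The covariance weight of one frequency *)

Lemma cvg_to_eq (R : realType) (u : nat -> R) (a b : R) :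
  u @ \oo --> a -> a = b -> u @ \oo --> b.
Proof. by move=> + <-. Qed.

Section moment_ratio.
Context {R : realType} (m : nat -> R) (c : R).
Hypotheses (c0 : 0 < c) (m0 : forall n, 0 < m n)
  (mrec : forall n, m n.+2 = n.+2%:R / (2 * c) * m n)
  (mconv : forall n, m n.+1 ^+ 2 <= m n * m n.+2).

(** With m the absolute moments of a rotation-invariant weight, this is the
squared overlap of the normalised monomials of degrees i and i + k, taken in
absolute value; it is at most 1 by Cauchy-Schwarz. *)
Definition moment_ratio (i k : nat) : R :=
  m (i.*2 + k) ^+ 2 / (m i.*2 * m (i.*2 + k.*2)).

Local Notation rho := moment_ratio.

Lemma moment_ratio_gt0 i k : 0 < rho i k.
Proof. by rewrite divr_gt0 ?exprn_gt0 ?mulr_gt0. Qed.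

Lemma moment_ratio0 i : rho i 0 = 1.
Proof. by rewrite /rho double0 addn0 expr2 divff// mulf_neq0 ?gt_eqF. Qed.

(** All four moments move by the recursion, so only the quotient of the factors
survives. This closed form of the increment is what makes the partial sums over i
computable. *)
Lemma moment_ratioS i k : rho i.+1 k =
  rho i k * (1 + k%:R ^+ 2 / 4 / (i.+1%:R * (i + k).+1%:R)).
Proof.
rewrite /rho doubleS !addSn !mrec.
have := m0 (i.*2); have := m0 (i.*2 + k); have := m0 (i.*2 + k.*2).
move: (m _) (m _) (m _) => a b d a0 b0 d0.
rewrite -!addnn !mulrS !natrD; field.
have := ler0n R i; have := ler0n R k => k0 i0.
by repeat (apply/andP; split); rewrite gt_eqF//; lra.
Qed.

(* Log-convexity traps each squared quotient of consecutive moments between two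
consecutive factors of the recursion. *)
Let convl n : (m n.+2 / m n.+1) ^+ 2 >= n.+2%:R / (2 * c).
Proof.
rewrite expr_div_n ler_pdivlMr ?exprn_gt0//.
have -> : m n.+2 ^+ 2 = n.+2%:R / (2 * c) * (m n * m n.+2) by rewrite expr2 {1}mrec mulrA.
by rewrite ler_wpM2l// divr_ge0 ?mulr_ge0// ltW.
Qed.

Let convr n : (m n.+1 / m n) ^+ 2 <= n.+2%:R / (2 * c).
Proof.
rewrite expr_div_n ler_pdivrMr ?exprn_gt0//.
by rewrite (le_trans (mconv n))// mrec mulrCA expr2.
Qed.

Let ratio_step i k : rho i k.+1 = rho i k *
  ((m (i.*2 + k).+1 / m (i.*2 + k)) ^+ 2 / ((i + k).+1%:R / c)).
Proof.
rewrite /rho doubleS !addnS mrec.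
have := m0 (i.*2 + k); have := m0 (i.*2 + k).+1; have := m0 (i.*2 + k.*2); have := m0 i.*2.
move: (m _) (m _) (m _) (m _) => a b d e a0 b0 d0 e0.
rewrite -!addnn !mulrS !natrD; field.
have := ler0n R i; have := ler0n R k => k0 i0.
by repeat (apply/andP; split); rewrite gt_eqF//; lra.
Qed.

Lemma moment_ratio_le1 i k : rho i k <= 1.
Proof.
elim: k => [|k ih]; first by rewrite moment_ratio0.
rewrite ratio_step mulr_ile1//; first exact/ltW/moment_ratio_gt0.
  by rewrite divr_ge0 ?sqr_ge0// divr_ge0// ltW.
rewrite ler_pdivrMr ?divr_gt0// mul1r (le_trans (convr _))//.
rewrite invfM mulrA ler_pM2r ?invr_gt0// ler_pdivrMr// -natrM ler_nat.
by rewrite -addnn; lia.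
Qed.

(** The ratio of k + 1 to that of k is a squared quotient of consecutive moments
over its asymptotic value, and log-convexity squeezes this quotient. *)
Lemma cvg_moment_ratio k : rho i k @[i --> \oo] --> (1 : R).
Proof.
rewrite -(cvg_shiftS (rho ^~ k)).
elim: k => [|k ih].
  by rewrite (_ : [sequence _]_n = fun=> 1); [exact: cvg_cst|apply/funext => i; exact: moment_ratio0].
rewrite (_ : [sequence _]_n = fun i => rho i.+1 k *
    ((m (i.+1.*2 + k).+1 / m (i.+1.*2 + k)) ^+ 2 / ((i.+1 + k).+1%:R / c))); last first.
  by apply/funext => i; exact: ratio_step.
apply: cvg_to_eq (mulr1 1); apply: cvgM; first exact: ih.
apply: (@squeeze_cvgr _ _ _ _ (fun i => 1 - (k.+1%:R * i.+1%:R^-1)) (fun=> 1)).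
- near=> i; apply/andP; split; last first.
    rewrite ler_pdivrMr ?divr_gt0// mul1r (le_trans (convr _))//.
    rewrite invfM mulrA ler_pM2r ?invr_gt0// ler_pdivrMr// -natrM ler_nat.
    by rewrite -addnn; lia.
  rewrite ler_pdivlMr ?divr_gt0//.
  rewrite doubleS !addSn (le_trans _ (convl _))// invfM !mulrA ler_pM2r ?invr_gt0//.
  rewrite -!addnn !mulrS !natrD.
  have := ler0n R i; have := ler0n R k => k0 i0.
  rewrite -subr_ge0.
  rewrite [leRHS](_ : _ = (1 + k%:R)*(1+k%:R)/(1 + i%:R) + (1 + k%:R) / 2); last by field; lra.
  by rewrite addr_ge0// divr_ge0// ?mulr_ge0//; lra.
- apply: cvg_to_eq (subr0 1); apply: cvgB; first exact: cvg_cst.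
  by apply: cvg_to_eq (mulr0 k.+1%:R); apply: cvgMr; exact: cvg_harmonic.
- exact: cvg_cst.
Unshelve. all: by end_near. Qed.

(** The ratio increases to 1 with i, by steps of at most k^2/4 times the increment
of -1/(i + 1); adding k^2/(4(i + 1)) therefore makes a sequence that decreases to
1. *)
Lemma moment_ratio_ge i k : (0 < k)%N ->
  1 - k%:R ^+ 2 / (4 * i.+1%:R) <= rho i k.
Proof.
move=> k0; rewrite lerBlDr.
pose u i := rho i k + k%:R ^+ 2 / (4 * i.+1%:R).
have ucvg : u @ \oo --> (1 : R).
  apply: cvg_to_eq (addr0 1); apply: cvgD; first exact: cvg_moment_ratio.
  rewrite (_ : (fun _ => _) = fun i => k%:R ^+ 2 / 4 * i.+1%:R^-1); last first.
    by apply/funext => j; rewrite invfM mulrA.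
  by apply: cvg_to_eq (mulr0 (k%:R ^+ 2 / 4)); apply: cvgMr; exact: cvg_harmonic.
have udec : nonincreasing_seq u.
  apply/nonincreasing_seqP => {}i; rewrite /u moment_ratioS mulrDr mulr1 -addrA lerD2l.
  apply: (@le_trans _ _ (k%:R ^+ 2 / 4 / (i.+1%:R * i.+2%:R) + k%:R ^+ 2 / (4 * i.+2%:R))).
    rewrite lerD2r -[leRHS]mul1r; apply: ler_pM => //.
    - exact/ltW/moment_ratio_gt0.
    - exact: moment_ratio_le1.
    - rewrite ler_pM2l ?divr_gt0 ?exprn_gt0 ?ltr0n// lef_pV2 ?posrE ?mulr_gt0//.
      by rewrite ler_pM2l// ler_nat; lia.
  rewrite le_eqVlt; apply/orP; left; apply/eqP; rewrite !mulrS; field.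
  by have := ler0n R i => i0; apply/andP; split; rewrite gt_eqF//; lra.
have := nonincreasing_cvgn_ge udec (cvgP _ ucvg) i.
by rewrite (cvg_lim _ ucvg).
Qed.

End moment_ratio.

Section harmonic.
Context {R : realType}.

Lemma harmonic_ge_ln (a b : nat) : (a <= b)%N ->
  ln b.+1%:R - ln a.+1%:R <= \sum_(a <= j < b) j.+1%:R^-1 :> R.
Proof.
move=> ab; rewrite -(telescope_sumr (fun n => ln n.+1%:R : R))// ler_sum_nat// => j _.
rewrite -ln_div ?posrE//.
have -> : j.+2%:R / j.+1%:R = 1 + j.+1%:R^-1 :> R.
  by rewrite -[j.+2]addn1 natrD mulrDl divff// mul1r.
by rewrite le_ln1Dx// (@lt_le_trans _ _ 0)// ?oppr_lt0// invr_ge0.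
Qed.

Lemma harmonic_le_ln (a b : nat) : (0 < a)%N -> (a <= b)%N ->
  \sum_(a <= j < b) j.+1%:R^-1 <= ln b%:R - ln a%:R :> R.
Proof.
move=> a0 ab; rewrite -(telescope_sumr (fun n => ln n%:R : R))// ler_sum_nat// => j.
move=> /andP[aj _]; have j0 : (0 < j)%N by exact: leq_trans aj.
rewrite -lerN2 opprB -ln_div ?posrE ?ltr0n//.
have -> : j%:R / j.+1%:R = 1 + - j.+1%:R^-1 :> R.
  by rewrite mulrS; field; have := ler0n R j; lra.
by rewrite le_ln1Dx// ltrN2 invf_lt1// ltr1n ltnS.
Qed.

Lemma harmonic_le1ln (n : nat) :
  \sum_(0 <= j < n) j.+1%:R^-1 <= 1 + ln n%:R :> R.
Proof.
case: n => [|n]; first by rewrite big_nil ln0// addr0.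
rewrite big_nat_recl//= invr1 lerD2l.
have := @harmonic_le_ln 1 n.+1 isT isT.
by rewrite ln1 subr0 big_add1.
Qed.

End harmonic.

Section covariance_weight.
Context {R : realType} (m : nat -> R) (c : R).
Hypotheses (c0 : 0 < c) (m0 : forall n, 0 < m n)
  (mrec : forall n, m n.+2 = n.+2%:R / (2 * c) * m n)
  (mconv : forall n, m n.+1 ^+ 2 <= m n * m n.+2).

Local Notation rho := (moment_ratio m).

(** The coefficient with which frequency k enters the covariance at size N: of the
N diagonal terms, those with i < N - k lose their squared overlap with the monomial
of degree i + k. *)
Definition cov_weight (N k : nat) : R :=
  N%:R - \sum_(0 <= i < N - k) rho i k.

Lemma cov_weight0 N : cov_weight N 0 = 0.
Proof.
rewrite /cov_weight subn0 (eq_bigr (fun=> 1)) => [|i _].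
  by rewrite big_const_nat iter_addr addr0 subn0 subrr.
exact: moment_ratio0.
Qed.

(** Summation by parts, the increments being given by moment_ratioS. It replaces
the sum of the deficits 1 - rho by a harmonic sum weighted by rho, which is where
the logarithm comes from. *)
Lemma sum_moment_deficit k M : \sum_(0 <= i < M) (1 - rho i k) =
  M%:R * (1 - rho M k) + k%:R ^+ 2 / 4 * \sum_(0 <= i < M) rho i k / (i + k).+1%:R.
Proof.
elim: M => [|M ih]; first by rewrite !big_nil mul0r mulr0 addr0.
rewrite !big_nat_recr//= ih (moment_ratioS c0 m0 mrec).
move: (\sum_(_ <= _ < _) _) => S; move: (rho M k) => r.
have := ler0n R M; have := ler0n R k => k0 M0.
by rewrite !mulrS natrD; field; apply/andP; split; rewrite gt_eqF//; lra.
Qed.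

(* Replacing the weights rho in the harmonic sum by 1 costs at most a multiple of
1 + ln k: below k^2 the deficit is at most 1, above it decays like k^2/i. *)
Let deficit_sum k M : (0 < k)%N ->
  \sum_(0 <= i < M) (1 - rho i k) / (i + k).+1%:R <= 2 + 2 * ln k%:R.
Proof.
move=> k0; set K := (k ^ 2)%N; have K0 : (0 < K)%N by rewrite expn_gt0 k0.
have r0 i : 0 <= 1 - rho i k by rewrite subr_ge0 (moment_ratio_le1 c0).
have r1 i : 1 - rho i k <= 1 by rewrite lerBlDr lerDl ltW// moment_ratio_gt0.
have rK i : 1 - rho i k <= K%:R / (4 * i.+1%:R).
  by rewrite lerBlDr -lerBlDl natrX (moment_ratio_ge c0).
apply: (@le_trans _ _ (\sum_(0 <= i < M) (1 - rho i k) / i.+1%:R)).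
  apply: ler_sum => i _; apply: ler_wpM2l => //.
  by rewrite lef_pV2 ?posrE// ler_nat ltnS leq_addr.
have HK n : (n <= K)%N -> \sum_(0 <= i < n) (1 - rho i k) / i.+1%:R <= 1 + 2 * ln k%:R.
  move=> nK; apply: (@le_trans _ _ (\sum_(0 <= i < n) i.+1%:R^-1)).
    by apply: ler_sum => i _; rewrite ler_piMl// invr_ge0.
  rewrite (le_trans (harmonic_le1ln n))// lerD2l.
  have -> : 2 * ln k%:R = ln K%:R :> R by rewrite natrX lnXn ?ltr0n// mulr_natl.
  case: n nK => [|n] nK; first by rewrite ln0// ln_ge0// ler1n.
  by rewrite ler_ln ?posrE ?ltr0n// ler_nat.
have [MK|KM] := leqP M K; first by rewrite (le_trans (HK _ MK))// lerD2r; lra.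
rewrite (big_cat_nat (leq0n K) (ltnW KM)).
have -> : 2 + 2 * ln k%:R = 1 + 2 * ln k%:R + 1 :> R by ring.
apply: lerD; first exact: HK.
apply: (@le_trans _ _ (\sum_(K <= i < M) (- (K%:R / i.+1%:R) - - (K%:R / i%:R)))).
  apply: ler_sum_nat => i /andP[Ki _].
  have i0 : (0 < i)%N by exact: leq_trans Ki.
  have i0R : 0 < i%:R :> R by rewrite ltr0n.
  apply: (@le_trans _ _ (K%:R / (4 * i.+1%:R) / i.+1%:R)).
    by rewrite ler_pM2r ?invr_gt0.
  (* Here 1 / (4 (i + 1)^2) is compared with the telescoping 1 / i - 1 / (i + 1). *)
  rewrite -subr_ge0 [leRHS](_ : _ = K%:R * ((i%:R * 3 + 4) / (4 * (1 + i%:R) ^+ 2 * i%:R))).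
    by apply: mulr_ge0.
  by rewrite mulrS; field; apply/andP; split; rewrite gt_eqF//; lra.
rewrite (telescope_sumr (fun i => - (K%:R / i%:R)))//; last exact: ltnW.
rewrite opprK divff ?pnatr_eq0 -?lt0n// gerDr oppr_le0.
Qed.

Let cov_weightE N k : (k <= N)%N ->
  cov_weight N k = k%:R + \sum_(0 <= i < N - k) (1 - rho i k).
Proof.
move=> kN; rewrite /cov_weight big_split/= sumrN big_const_nat iter_addr addr0 subn0.
by rewrite natrB// addrA addrCA subrr addr0.
Qed.

Let cov_weight_itv N k : (0 < k)%N -> (k < N)%N ->
  k%:R ^+ 2 / 4 * (ln N%:R - 3 - 3 * ln k%:R) <= cov_weight N k <=
  k%:R ^+ 2 / 4 * ln N%:R + 2 * k%:R ^+ 2 /\ 0 <= cov_weight N k.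
Proof.
move=> k0 kN; rewrite cov_weightE ?(ltnW kN)// sum_moment_deficit.
set M := (N - k)%N.
have r0 i : 0 <= 1 - rho i k by rewrite subr_ge0 (moment_ratio_le1 c0).
have rM : M%:R * (1 - rho M k) <= k%:R ^+ 2 / 4.
  apply: (@le_trans _ _ (M%:R * (k%:R ^+ 2 / (4 * M.+1%:R)))).
    by apply: ler_wpM2l => //; rewrite lerBlDr -lerBlDl (moment_ratio_ge c0).
  have -> : M%:R * (k%:R ^+ 2 / (4 * M.+1%:R)) = k%:R ^+ 2 / 4 * (M%:R / M.+1%:R) :> R.
    by have M0 := ler0n R M; rewrite !mulrS; field; rewrite gt_eqF//; lra.
  apply: ler_piMr; first by rewrite divr_ge0 ?sqr_ge0.
  by rewrite ler_pdivrMr ?ltr0Sn// mul1r ler_nat.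
have rM0 : 0 <= M%:R * (1 - rho M k) by rewrite mulr_ge0.
have k1 : 1 <= k%:R :> R by rewrite ler1n.
have kk : k%:R <= k%:R ^+ 2 :> R by rewrite expr2 ler_peMr//; lra.
have S0 : 0 <= \sum_(0 <= i < M) rho i k / (i + k).+1%:R.
  by apply: sumr_ge0 => i _; rewrite divr_ge0// ltW// moment_ratio_gt0.
have HE : \sum_(0 <= i < M) (i + k).+1%:R^-1 = \sum_(k <= j < N) j.+1%:R^-1 :> R.
  by have := @big_addn R 0 +%R 0 N k xpredT (fun j => j.+1%:R^-1); rewrite add0n => ->.
split; last by rewrite !addr_ge0// mulr_ge0// divr_ge0// sqr_ge0.
apply/andP; split.
  rewrite (@le_trans _ _ (k%:R ^+ 2 / 4 * \sum_(0 <= i < M) rho i k / (i + k).+1%:R))//; last first.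
    by rewrite addrA lerDr addr_ge0.
  rewrite ler_wpM2l ?divr_ge0 ?sqr_ge0//.
  have -> : \sum_(0 <= i < M) rho i k / (i + k).+1%:R =
      \sum_(k <= j < N) j.+1%:R^-1 - \sum_(0 <= i < M) (1 - rho i k) / (i + k).+1%:R.
    rewrite -HE -sumrB; apply: eq_bigr => i _.
    by rewrite mulrBl mul1r opprB addrC subrK.
  have := @harmonic_ge_ln R k N (ltnW kN); have := deficit_sum M k0.
  have : ln N%:R <= ln N.+1%:R :> R by rewrite ler_ln ?posrE ?ltr0n ?ler_nat//; exact: leq_trans kN.
  have : ln k.+1%:R <= ln k%:R + 1 :> R.
    rewrite -lerBlDl -ln_div ?posrE ?ltr0n//.
    have -> : k.+1%:R / k%:R = 1 + k%:R^-1 :> R.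
      by rewrite mulrS mulrDl mul1r divff ?gt_eqF ?ltr0n// addrC.
    have kV : 0 < k%:R^-1 :> R by rewrite invr_gt0 ltr0n.
    rewrite (le_trans (le_ln1Dx _))//; first by lra.
    by rewrite invf_le1 ?ltr0n.
  by lra.
have : \sum_(0 <= i < M) rho i k / (i + k).+1%:R <= 1 + ln N%:R.
  apply: (@le_trans _ _ (\sum_(0 <= i < M) (i + k).+1%:R^-1)).
    by apply: ler_sum => i _; rewrite ler_piMl// ?invr_ge0// (moment_ratio_le1 c0).
  rewrite HE (le_trans _ (harmonic_le1ln N))//.
  rewrite [leRHS](big_cat_nat (n := k))//= ?(ltnW kN)// lerDr; apply: sumr_ge0 => i _.
  by rewrite invr_ge0.
move: (\sum_(_ <= _ < _) _) S0 => S S0 SN.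
have : k%:R ^+ 2 / 4 * S <= k%:R ^+ 2 / 4 * (1 + ln N%:R) by rewrite ler_wpM2l ?divr_ge0 ?sqr_ge0.
by move: rM; lra.
Qed.

(** For fixed k the error does not grow with N. When k >= N the sum in the weight
is empty and both terms are of order at most k^2 (1 + ln k). *)
Lemma cov_weight_log N k : (0 < k)%N -> (0 < N)%N ->
  `|cov_weight N k - k%:R ^+ 2 / 4 * ln N%:R| <= 2 * (k%:R ^+ 2 * (1 + ln k%:R)).
Proof.
move=> k0 N0.
have k1 : 1 <= k%:R :> R by rewrite ler1n.
have lk : 0 <= ln k%:R :> R by rewrite ln_ge0.
have kk : k%:R <= k%:R ^+ 2 :> R by rewrite expr2 ler_peMr//; lra.
have kl : 0 <= k%:R ^+ 2 * ln k%:R :> R by rewrite mulr_ge0// sqr_ge0.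
have [kN|Nk] := ltnP k N.
  have [/andP[l u] _] := cov_weight_itv k0 kN.
  by rewrite ler_norml; apply/andP; split; move: l u; lra.
have NkR : N%:R <= k%:R :> R by rewrite ler_nat.
rewrite /cov_weight (_ : N - k = 0)%N ?big_geq ?subr0//; last exact/eqP.
have lN : 0 <= ln N%:R :> R by rewrite ln_ge0// ler1n.
have lNk : ln N%:R <= ln k%:R :> R by rewrite ler_ln ?posrE ?ltr0n.
have : k%:R ^+ 2 * ln N%:R <= k%:R ^+ 2 * ln k%:R :> R by rewrite ler_wpM2l// sqr_ge0.
have : 0 <= k%:R ^+ 2 * ln N%:R :> R by rewrite mulr_ge0// sqr_ge0.
have : 0 <= N%:R :> R by [].
by rewrite ler_norml => *; apply/andP; split; lra.
Qed.

(** The companion of cov_weight_log for frequencies that are large compared with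
N, where ln k would be too big. *)
Lemma cov_weight_unif N k : (0 < k)%N -> (0 < N)%N ->
  `|cov_weight N k - k%:R ^+ 2 / 4 * ln N%:R| <= 2 * (k%:R ^+ 2 * (1 + ln N%:R)).
Proof.
move=> k0 N0.
have k1 : 1 <= k%:R :> R by rewrite ler1n.
have lN : 0 <= ln N%:R :> R by rewrite ln_ge0// ler1n.
have kk : k%:R <= k%:R ^+ 2 :> R by rewrite expr2 ler_peMr//; lra.
have kl : 0 <= k%:R ^+ 2 * ln N%:R :> R by rewrite mulr_ge0// sqr_ge0.
have [kN|Nk] := ltnP k N.
  have [/andP[_ u] A0] := cov_weight_itv k0 kN.
  by rewrite ler_norml; apply/andP; split; move: A0 u; lra.
have NkR : N%:R <= k%:R :> R by rewrite ler_nat.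
rewrite /cov_weight (_ : N - k = 0)%N ?big_geq ?subr0//; last exact/eqP.
have : 0 <= N%:R :> R by [].
by rewrite ler_norml => *; apply/andP; split; lra.
Qed.

End covariance_weight.

(** * Complex-valued integrals *)

Section complex_parts.
Context {R : realType}.
Implicit Types x y : R[i].

Lemma Re_add x y : (@complex.Re R) (x + y) = (@complex.Re R) x + (@complex.Re R) y.
Proof. by case: x y => [? ?] [? ?]. Qed.

Lemma Im_add x y : (@complex.Im R) (x + y) = (@complex.Im R) x + (@complex.Im R) y.
Proof. by case: x y => [? ?] [? ?]. Qed.

Lemma Re_mul x y : (@complex.Re R) (x * y) =
  (@complex.Re R) x * (@complex.Re R) y - (@complex.Im R) x * (@complex.Im R) y.
Proof. by case: x y => [? ?] [? ?]. Qed.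

Lemma Im_mul x y : (@complex.Im R) (x * y) =
  (@complex.Re R) x * (@complex.Im R) y + (@complex.Im R) x * (@complex.Re R) y.
Proof. by case: x y => [? ?] [? ?]. Qed.

Lemma Re_opp x : (@complex.Re R) (- x) = - (@complex.Re R) x. Proof. by case: x. Qed.
Lemma Im_opp x : (@complex.Im R) (- x) = - (@complex.Im R) x. Proof. by case: x. Qed.

Lemma normc_sqr x : normc x ^+ 2 = (@complex.Re R) x ^+ 2 + (@complex.Im R) x ^+ 2.
Proof. by case: x => a b /=; rewrite sqr_sqrtr// addr_ge0 ?sqr_ge0. Qed.

Lemma normc_ge0 x : 0 <= normc x.
Proof. by case: x => a b /=; exact: sqrtr_ge0. Qed.

Lemma ler_Re_normc x : `|(@complex.Re R) x| <= normc x.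
Proof.
by case: x => a b /=; rewrite -sqrtr_sqr ler_wsqrtr// lerDl sqr_ge0.
Qed.

Lemma ler_Im_normc x : `|(@complex.Im R) x| <= normc x.
Proof.
by case: x => a b /=; rewrite -sqrtr_sqr ler_wsqrtr// lerDr sqr_ge0.
Qed.

Lemma normc_le x : normc x <= `|(@complex.Re R) x| + `|(@complex.Im R) x|.
Proof.
rewrite -(@ler_pXn2r _ 2) ?nnegrE ?normc_ge0 ?addr_ge0//.
rewrite normc_sqr sqrrD !real_normK ?num_real// lerD2r lerDl.
by rewrite mulrn_wge0// mulr_ge0.
Qed.

Lemma normc_real (r : R) : normc r%:C = `|r|.
Proof. by rewrite /= expr0n addr0 sqrtr_sqr. Qed.

Lemma mul_conjc x : x * conjc x = (normc x ^+ 2)%:C.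
Proof.
rewrite normc_sqr; case: x => a b; apply/eqP; rewrite eq_complex /=.
by apply/andP; split; apply/eqP; ring.
Qed.

Lemma normc_prod (I : Type) (r : seq I) (P : pred I) (F : I -> R[i]) :
  normc (\prod_(i <- r | P i) F i) = \prod_(i <- r | P i) normc (F i).
Proof. exact: (big_morph _ (@normcM R) (@normc1 R)). Qed.

Lemma ler_normc_sum (I : Type) (r : seq I) (P : pred I) (F : I -> R[i]) :
  normc (\sum_(i <- r | P i) F i) <= \sum_(i <- r | P i) normc (F i).
Proof.
elim/big_rec2: _ => [|i y x _ yx]; first by rewrite normc0.
by rewrite (le_trans (le_normcD _ _))// lerD2l.
Qed.

End complex_parts.

Section complex_integral_theory.
Context d (T : measurableType d) (R : realType).
Variables (mu : {measure set T -> \bar R}) (D : set T).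
Hypothesis mD : measurable D.
Implicit Types F G : T -> R[i].

Lemma CmeasurableD F G : Cmeasurable D F -> Cmeasurable D G ->
  Cmeasurable D (fun x => F x + G x).
Proof.
move=> [F1 F2] [G1 G2]; split.
- by apply: eq_measurable_fun (measurable_funD F1 G1) => x _ /=; rewrite Re_add.
- by apply: eq_measurable_fun (measurable_funD F2 G2) => x _ /=; rewrite Im_add.
Qed.

Lemma CmeasurableM F G : Cmeasurable D F -> Cmeasurable D G ->
  Cmeasurable D (fun x => F x * G x).
Proof.
move=> [F1 F2] [G1 G2]; split.
- apply: eq_measurable_fun (measurable_funB (measurable_funM F1 G1) (measurable_funM F2 G2)).
  by move=> x _ /=; rewrite Re_mul.
- apply: eq_measurable_fun (measurable_funD (measurable_funM F1 G2) (measurable_funM F2 G1)).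
  by move=> x _ /=; rewrite Im_mul.
Qed.

Lemma Cmeasurable_cst c : Cmeasurable D (fun=> c : R[i]).
Proof. by split; exact: measurable_cst. Qed.

Lemma Cmeasurable_prod (I : Type) (r : seq I) (F : I -> T -> R[i]) :
  (forall i, Cmeasurable D (F i)) ->
  Cmeasurable D (fun x => \prod_(i <- r) F i x).
Proof.
move=> mF; elim: r => [|i r ih].
  by rewrite (_ : (fun _ => _) = fun=> 1); [exact: Cmeasurable_cst|apply/funext => x; rewrite big_nil].
rewrite (_ : (fun _ => _) = fun x => F i x * \prod_(i <- r) F i x).
  exact: CmeasurableM.
by apply/funext => x; rewrite big_cons.
Qed.

Lemma Cmeasurable_real (h : T -> R) : measurable_fun D h ->
  Cmeasurable D (fun x => (h x)%:C).
Proof. by move=> mh; split => //; exact: measurable_cst. Qed.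

Lemma measurable_normc_sqr F : Cmeasurable D F ->
  measurable_fun D (fun x => normc (F x) ^+ 2).
Proof.
move=> [F1 F2].
apply: eq_measurable_fun (measurable_funD (measurable_funX 2 F1) (measurable_funX 2 F2)).
by move=> x _ /=; rewrite normc_sqr.
Qed.

Lemma measurable_normc F : Cmeasurable D F -> measurable_fun D (@normc R \o F).
Proof.
move=> mF; apply: eq_measurable_fun (measurableT_comp (continuous_measurable_fun (@sqrt_continuous R)) (measurable_normc_sqr mF)).
by move=> x _ /=; rewrite sqrtr_sqr ger0_norm// normc_ge0.
Qed.

Lemma Cintegrable_measurable F : Cintegrable mu D F -> Cmeasurable D F.
Proof. by move=> [/measurable_int/measurable_EFinP ? /measurable_int/measurable_EFinP ?]. Qed.

Lemma CintegrableD F G : Cintegrable mu D F -> Cintegrable mu D G ->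
  Cintegrable mu D (fun x => F x + G x).
Proof.
move=> [F1 F2] [G1 G2]; split.
- by apply: eq_integrable (integrableD mD F1 G1) => // x _ /=; rewrite Re_add.
- by apply: eq_integrable (integrableD mD F2 G2) => // x _ /=; rewrite Im_add.
Qed.

Lemma CintegralD F G : Cintegrable mu D F -> Cintegrable mu D G ->
  Cintegral mu D (fun x => F x + G x) = Cintegral mu D F + Cintegral mu D G.
Proof.
move=> [F1 F2] [G1 G2]; rewrite /Cintegral.
under eq_Rintegral do rewrite Re_add; rewrite RintegralD//.
by under [X in _ +i* X]eq_Rintegral do rewrite Im_add; rewrite RintegralD.
Qed.

Lemma CintegrableZ c F : Cintegrable mu D F -> Cintegrable mu D (fun x => c * F x).
Proof.
move=> [F1 F2]; split.
- apply: eq_integrable (integrableB mD (integrableZl mD (complex.Re c) F1) (integrableZl mD (complex.Im c) F2)) => //.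
  by move=> x _ /=; rewrite Re_mul.
- apply: eq_integrable (integrableD mD (integrableZl mD (complex.Re c) F2) (integrableZl mD (complex.Im c) F1)) => //.
  by move=> x _ /=; rewrite Im_mul.
Qed.

Lemma CintegralZ c F : Cintegrable mu D F ->
  Cintegral mu D (fun x => c * F x) = c * Cintegral mu D F.
Proof.
move=> [F1 F2]; rewrite /Cintegral.
under eq_Rintegral do rewrite Re_mul; rewrite RintegralB//; last 2 first.
- exact: (integrableZl mD (complex.Re c) F1).
- exact: (integrableZl mD (complex.Im c) F2).
under [X in _ +i* X]eq_Rintegral do rewrite Im_mul; rewrite RintegralD//; last 2 first.
- exact: (integrableZl mD (complex.Re c) F2).
- exact: (integrableZl mD (complex.Im c) F1).
by rewrite !RintegralZl//; case: c.
Qed.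

Lemma eq_Cintegral F G : {in D, F =1 G} -> Cintegral mu D F = Cintegral mu D G.
Proof.
by move=> FG; congr (_ +i* _); apply: eq_Rintegral => x xD; rewrite FG.
Qed.

Lemma eq_Cintegrable F G : {in D, F =1 G} -> Cintegrable mu D F -> Cintegrable mu D G.
Proof.
move=> FG [F1 F2]; split; [apply: eq_integrable F1 => //|apply: eq_integrable F2 => //];
  by move=> x xD /=; rewrite FG.
Qed.

Lemma Cintegrable0 : Cintegrable mu D (fun=> 0).
Proof. by split; exact: integrable0. Qed.

Lemma Cintegral0 : Cintegral mu D (fun=> 0) = 0.
Proof.
transitivity (0 * Cintegral mu D (fun=> 0)); last by rewrite mul0r.
rewrite -CintegralZ; last exact: Cintegrable0.
by apply: eq_Cintegral => x _; rewrite mul0r.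
Qed.

Lemma CintegralN F : Cintegrable mu D F ->
  Cintegral mu D (fun x => - F x) = - Cintegral mu D F.
Proof.
move=> iF; rewrite -mulN1r -CintegralZ//.
by apply: eq_Cintegral => x _; rewrite mulN1r.
Qed.

Lemma CintegrableB F G : Cintegrable mu D F -> Cintegrable mu D G ->
  Cintegrable mu D (fun x => F x - G x).
Proof.
move=> iF iG; apply: eq_Cintegrable (CintegrableD iF (CintegrableZ (-1) iG)).
by move=> x _; rewrite mulN1r.
Qed.

Lemma CintegralB F G : Cintegrable mu D F -> Cintegrable mu D G ->
  Cintegral mu D (fun x => F x - G x) = Cintegral mu D F - Cintegral mu D G.
Proof.
move=> iF iG; rewrite -CintegralN// -CintegralD//.
by apply: eq_Cintegrable (CintegrableZ (-1) iG) => x _; rewrite mulN1r.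
Qed.

Lemma Cintegrable_sum (I : Type) (r : seq I) (P : pred I) (F : I -> T -> R[i]) :
  (forall i, Cintegrable mu D (F i)) ->
  Cintegrable mu D (fun x => \sum_(i <- r | P i) F i x).
Proof.
move=> iF; elim: r => [|i r ih].
  by apply: eq_Cintegrable Cintegrable0 => x _; rewrite big_nil.
have [Pi|Pi] := boolP (P i).
  by apply: eq_Cintegrable (CintegrableD (iF i) ih) => x _; rewrite big_cons Pi.
by apply: eq_Cintegrable ih => x _; rewrite big_cons (negbTE Pi).
Qed.

Lemma Cintegral_sum (I : Type) (r : seq I) (P : pred I) (F : I -> T -> R[i]) :
  (forall i, Cintegrable mu D (F i)) ->
  Cintegral mu D (fun x => \sum_(i <- r | P i) F i x) =
  \sum_(i <- r | P i) Cintegral mu D (F i).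
Proof.
move=> iF; elim: r => [|i r ih].
  by rewrite big_nil -[RHS]Cintegral0; apply: eq_Cintegral => x _; rewrite big_nil.
rewrite big_cons; case: ifPn => Pi.
  rewrite -ih -CintegralD//; last exact: Cintegrable_sum.
  by apply: eq_Cintegral => x _; rewrite big_cons Pi.
by rewrite -ih; apply: eq_Cintegral => x _; rewrite big_cons (negbTE Pi).
Qed.

Lemma Cintegrable_le F (g : T -> R) : Cmeasurable D F ->
  mu.-integrable D (EFin \o g) -> (forall x, D x -> normc (F x) <= g x) ->
  Cintegrable mu D F.
Proof.
move=> [F1 F2] ig Fg; split; apply: le_integrable ig => //;
  try by [apply/measurable_EFinP].
- by move=> x Dx /=; rewrite lee_fin (le_trans (ler_Re_normc _))// (le_trans (Fg x Dx))// ler_norm.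
- by move=> x Dx /=; rewrite lee_fin (le_trans (ler_Im_normc _))// (le_trans (Fg x Dx))// ler_norm.
Qed.

Lemma integrable_normc F : Cintegrable mu D F ->
  mu.-integrable D (EFin \o (@normc R \o F)).
Proof.
move=> iF; have mF := Cintegrable_measurable iF; case: iF => F1 F2.
apply: le_integrable (integrableD mD (integrable_norm F1) (integrable_norm F2)) => //.
  by apply/measurable_EFinP; exact: measurable_normc.
move=> x Dx /=; rewrite lee_fin ger0_norm ?normc_ge0//.
by rewrite (le_trans (normc_le _))// ler_norm.
Qed.

(** The factor 2 comes from bounding the real and the imaginary part separately. *)
Lemma normc_Cintegral_le F : Cintegrable mu D F ->
  normc (Cintegral mu D F) <= 2 * (\int[mu]_(x in D) normc (F x))%R.
Proof.
move=> iF; have iN := integrable_normc iF; case: iF => F1 F2.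
rewrite (le_trans (normc_le _))// mulr_natl mulr2n lerD//=.
- rewrite (le_trans (le_normr_Rintegral _ _))//.
  by apply: le_Rintegral => //; [exact: integrable_norm|move=> x _; exact: ler_Re_normc].
- rewrite (le_trans (le_normr_Rintegral _ _))//.
  by apply: le_Rintegral => //; [exact: integrable_norm|move=> x _; exact: ler_Im_normc].
Qed.

Lemma Cintegral_real (h : T -> R) :
  Cintegral mu D (fun x => (h x)%:C) = (\int[mu]_(x in D) h x)%R%:C.
Proof.
rewrite /Cintegral/=; congr (_ +i* _).
by rewrite /Rintegral integral0.
Qed.

Lemma Cintegrable_real (h : T -> R) : mu.-integrable D (EFin \o h) ->
  Cintegrable mu D (fun x => (h x)%:C).
Proof. by move=> ih; split => //; exact: integrable0. Qed.

End complex_integral_theory.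

(** * Densities and product measures *)

Section integral_density.
Local Open Scope ereal_scope.
Context d (T : measurableType d) (R : realType).
Variables (m nu : {measure set T -> \bar R}) (h : T -> R).
Hypotheses (mh : measurable_fun setT h) (h0 : forall x, (0 <= h x)%R)
  (nuE : forall A, measurable A -> nu A = density m h A).

Import HBNNSimple.

(** Approximate by simple functions from below and pass to the limit on both
sides by monotone convergence. *)
Lemma ge0_integral_density (f : T -> \bar R) : measurable_fun setT f ->
  (forall x, 0 <= f x) -> \int[nu]_x f x = \int[m]_x (f x * (h x)%:E).
Proof.
move=> mf f0; pose f_ := nnsfun_approx measurableT mf.
have cvgf x : setT x -> (f_ n x)%:E @[n --> \oo] --> f x.
  by move=> _; apply: cvg_nnsfun_approx => // *; exact: f0.
have ndf x a b : (a <= b)%N -> (f_ a x <= f_ b x)%R.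
  by move=> ab; exact/lefP/nd_nnsfun_approx.
have mfh n : measurable_fun setT (fun x => (f_ n x * h x)%:E).
  by apply/measurable_EFinP/measurable_funM.
transitivity (limn (fun n => \int[nu]_x (f_ n x)%:E)).
  rewrite -monotone_convergence//.
  - by apply: eq_integral => x _; apply/esym/cvg_lim => //; exact: cvgf.
  - by move=> n; exact/measurable_EFinP/measurable_funP.
  - by move=> n x _; rewrite lee_fin.
  - by move=> x _ a b ab; rewrite lee_fin ndf.
transitivity (limn (fun n => \int[m]_x (f_ n x * h x)%:E)); last first.
  rewrite -monotone_convergence//.
  - apply: eq_integral => x _; apply/cvg_lim => //.
    under eq_fun do rewrite EFinM muleC.
    by rewrite muleC; apply: cvgeZl => //; exact: cvgf.
  - by move=> n x _; rewrite lee_fin mulr_ge0.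
  - by move=> x _ a b ab; rewrite lee_fin ler_wpM2r// ndf.
congr (limn _); apply/funext => n.
rewrite integralT_nnsfun sintegralE.
transitivity (\sum_(r \in range (f_ n))
    \int[m]_x (r * \1_(f_ n @^-1` [set r]) x * h x)%:E).
  apply: eq_fsbigr => r /[!inE] -[x _ <-]{r}.
  have r0 : (0 <= f_ n x)%R by [].
  rewrite nuE// /density integral_mkcond.
  rewrite -ge0_integralZl//; last first.
    by move=> y _; rewrite patchE; case: ifP => // _; rewrite lee_fin.
    apply: (measurable_restrictT _ _).1 => //; exact/measurable_EFinP/measurable_funTS.
  apply: eq_integral => y _; rewrite patchE indicE.
  case: (y \in _); rewrite -?EFinM; first by rewrite mulr1.
  by rewrite !mulr0 mul0r.
rewrite -ge0_integral_fsum//.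
- apply: eq_integral => x _; rewrite [in RHS]fimfunE mulrC mulr_fsumr//= -fsumEFin//.
  by apply: eq_fsbigr => r _; rewrite mulrC.
- move=> r; apply/measurable_EFinP/measurable_funM => //.
  by apply: measurable_funM.
- move=> r x _; rewrite lee_fin mulr_ge0//.
  by rewrite -lee_fin nnfun_muleindic_ge0.
Qed.

End integral_density.

Section complex_density.
Context d (T : measurableType d) (R : realType).
Variables (m nu : {measure set T -> \bar R}) (h : T -> R).
Hypotheses (mh : measurable_fun setT h) (h0 : forall x, 0 <= h x)
  (nuE : forall A, measurable A -> nu A = density m h A).

Let integrable_density (f : T -> R) : measurable_fun setT f ->
  m.-integrable setT (fun x => (f x * h x)%:E) -> nu.-integrable setT (EFin \o f).
Proof.
move=> mf /integrableP[_ fhoo]; apply/integrableP; split; first exact/measurable_EFinP.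
rewrite (ge0_integral_density mh h0 nuE)//=; last first.
  by apply/measurable_EFinP; exact: measurableT_comp.
rewrite (eq_integral (fun x => `|(f x * h x)%:E|)%E)// => x _ /=.
by rewrite normrM (ger0_norm (h0 x)).
Qed.

Let integral_density (f : T -> R) : measurable_fun setT f ->
  m.-integrable setT (fun x => (f x * h x)%:E) ->
  (\int[nu]_x f x)%R = (\int[m]_x (f x * h x))%R.
Proof.
move=> mf ifh; rewrite /Rintegral [in LHS]integralE [in RHS]integralE.
have mfE : measurable_fun setT (EFin \o f) by exact/measurable_EFinP.
rewrite (ge0_integral_density mh h0 nuE); last 2 first.
- exact: measurable_funepos.
- by move=> x; rewrite funepos_ge0.
rewrite (ge0_integral_density mh h0 nuE); last 2 first.
- exact: measurable_funeneg.
- by move=> x; rewrite funeneg_ge0.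
congr (fine (_ - _)); apply: eq_integral => x _.
- by rewrite !funeposE /= -!EFin_max -EFinM maxr_pMl// mul0r.
- by rewrite !funenegE /= -!EFin_max -EFinM maxr_pMl// mul0r mulNr.
Qed.

Lemma Cintegrable_density (F : T -> R[i]) : Cmeasurable setT F ->
  Cintegrable m setT (fun x => F x * (h x)%:C) -> Cintegrable nu setT F.
Proof.
move=> [F1 F2] [iF1 iF2]; split; apply: integrable_density => //.
- by apply: eq_integrable iF1 => // x _; congr EFin; rewrite /comp Re_mul /= mulr0 subr0.
- by apply: eq_integrable iF2 => // x _; congr EFin; rewrite /comp Im_mul /= mulr0 add0r.
Qed.

Lemma Cintegral_density (F : T -> R[i]) : Cmeasurable setT F ->
  Cintegrable m setT (fun x => F x * (h x)%:C) ->
  Cintegral nu setT F = Cintegral m setT (fun x => F x * (h x)%:C).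
Proof.
move=> [F1 F2] [iF1 iF2]; rewrite /Cintegral.
rewrite integral_density//; last first.
  by apply: eq_integrable iF1 => // x _; congr EFin; rewrite /comp Re_mul /= mulr0 subr0.
rewrite integral_density//; last first.
  by apply: eq_integrable iF2 => // x _; congr EFin; rewrite /comp Im_mul /= mulr0 add0r.
congr (_ +i* _); apply: eq_Rintegral => x _.
- by rewrite Re_mul /= mulr0 subr0.
- by rewrite Im_mul /= mulr0 add0r.
Qed.

End complex_density.

Section product_integral.
Context d1 d2 (T1 : measurableType d1) (T2 : measurableType d2) (R : realType).
Variables (m1 : {sigma_finite_measure set T1 -> \bar R})
  (m2 : {sigma_finite_measure set T2 -> \bar R}).

Let integrable_prod (u : T1 -> R) (v : T2 -> R) :
  m1.-integrable setT (EFin \o u) -> m2.-integrable setT (EFin \o v) ->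
  (m1 \x m2)%E.-integrable setT (fun z => (u z.1 * v z.2)%:E).
Proof.
move=> iu iv; have mu := measurable_int _ iu; have mv := measurable_int _ iv.
apply/integrable12ltyP.
  apply/measurable_EFinP/measurable_funM.
    by apply: measurableT_comp measurable_fst; exact/measurable_EFinP.
  by apply: measurableT_comp measurable_snd; exact/measurable_EFinP.
under eq_integral => x _.
  rewrite (eq_integral (fun y => `|u x|%:E * `|(v y)%:E|)%E); last first.
    by move=> y _ /=; rewrite normrM.
  rewrite ge0_integralZl//; last first.
    exact: measurableT_comp mv.
  over.
rewrite /= ge0_integralZr//.
- case/integrableP: iu => _ uoo; case/integrableP: iv => _ voo.
  by rewrite lte_mul_pinfty// ?integral_ge0// ge0_fin_numE// integral_ge0.
- by apply/measurable_EFinP; apply: measurableT_comp => //; exact/measurable_EFinP.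
- exact: integral_ge0.
Qed.

Let integral_prod (u : T1 -> R) (v : T2 -> R) :
  m1.-integrable setT (EFin \o u) -> m2.-integrable setT (EFin \o v) ->
  (\int[(m1 \x m2)%E]_z (u z.1 * v z.2))%R = (\int[m1]_x u x)%R * (\int[m2]_y v y)%R.
Proof.
move=> iu iv; rewrite {1}/Rintegral -integral12_prod_meas1; last exact: integrable_prod.
rewrite /fubini_F/=.
under eq_integral => x _.
  rewrite (eq_integral (fun y => (u x)%:E * (v y)%:E)%E)//.
  rewrite integralZl// -[X in (_ * X)%E]fineK; last exact: integrable_fin_num.
  over.
rewrite /= integralZr// fineM//; exact: integrable_fin_num.
Qed.

Variables (F : T1 -> R[i]) (G : T2 -> R[i]).
Hypotheses (iF : Cintegrable m1 setT F) (iG : Cintegrable m2 setT G).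

Lemma Cintegrable_prod : Cintegrable (m1 \x m2)%E setT (fun z => F z.1 * G z.2).
Proof.
case: iF iG => F1 F2 [G1 G2]; split.
- apply: eq_integrable (integrableB measurableT (integrable_prod F1 G1) (integrable_prod F2 G2)) => //.
  by move=> z _ /=; rewrite Re_mul.
- apply: eq_integrable (integrableD measurableT (integrable_prod F1 G2) (integrable_prod F2 G1)) => //.
  by move=> z _ /=; rewrite Im_mul.
Qed.

Lemma Cintegral_prod : Cintegral (m1 \x m2)%E setT (fun z => F z.1 * G z.2) =
  Cintegral m1 setT F * Cintegral m2 setT G.
Proof.
case: iF iG => F1 F2 [G1 G2]; rewrite /Cintegral.
under eq_Rintegral do rewrite Re_mul.
under [X in _ +i* X]eq_Rintegral do rewrite Im_mul.
rewrite RintegralB//; [|exact: (integrable_prod F1 G1)|exact: (integrable_prod F2 G2)].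
rewrite RintegralD//; [|exact: (integrable_prod F1 G2)|exact: (integrable_prod F2 G1)].
rewrite (@integral_prod (@complex.Re R \o F) (@complex.Re R \o G))//.
rewrite (@integral_prod (@complex.Im R \o F) (@complex.Im R \o G))//.
rewrite (@integral_prod (@complex.Re R \o F) (@complex.Im R \o G))//.
by rewrite (@integral_prod (@complex.Im R \o F) (@complex.Re R \o G)).
Qed.

End product_integral.

Section tuple_product.
Context d (T : measurableType d) (R : realType).
Variable mu : {sigma_finite_measure set T -> \bar R}.

(** Induction on n: the product measure on (n + 1)-tuples is the image of a binary
product under concatenation, so Fubini splits off the first factor. *)
Lemma Cintegral_tuple_prod n (F : 'I_n -> T -> R[i]) :
  (forall k, Cintegrable mu setT (F k)) ->
  Cintegrable (tuple_measure mu (n:=n)) setT (fun z => \prod_(k < n) F k (tnth z k)) /\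
  Cintegral (tuple_measure mu (n:=n)) setT (fun z => \prod_(k < n) F k (tnth z k)) =
  \prod_(k < n) Cintegral mu setT (F k).
Proof.
elim: n F => [|n ih] F iF.
  under eq_fun do rewrite big_ord0; rewrite big_ord0.
  have int1 c : (\int[tuple_measure mu (n:=0)]_x (cst c%:E) x = c%:E)%E.
    rewrite integral_cst// -[RHS]mule1; congr (_ * _)%E.
    exact: (@diracT _ _ R ([tuple] : 0.-tuple T)).
  have icst (c : R) : (tuple_measure mu (n:=0)).-integrable setT (EFin \o cst c).
    apply/integrableP; split; first by apply/measurable_EFinP.
    by rewrite (eq_integral (cst `|c|%:E))// int1 ltry.
  split; first by split; exact: icst.
  by rewrite /Cintegral /Rintegral (int1 1) (int1 0).
have [ih1 ih2] := ih (fun k => F (lift ord0 k)) (fun k => iF _).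
pose m2 := [the {sigma_finite_measure set (n.-tuple T) -> \bar R} of tuple_measure mu (n:=n)].
pose c (p : T * n.-tuple T) : n.+1.-tuple T := [tuple of p.1 :: p.2].
have mc : measurable_fun setT c by exact: measurable_cons.
have mF : Cmeasurable setT (fun z : n.+1.-tuple T => \prod_(k < n.+1) F k (tnth z k)).
  apply: Cmeasurable_prod => k.
  have [Fk1 Fk2] := Cintegrable_measurable (iF k).
  split.
    exact: (measurableT_comp Fk1 (measurable_tnth k)).
  exact: (measurableT_comp Fk2 (measurable_tnth k)).
have cE p : \prod_(k < n.+1) F k (tnth (c p) k) =
    F ord0 p.1 * \prod_(k < n) F (lift ord0 k) (tnth p.2 k).
  rewrite big_ord_recl; congr (_ * _).
  by apply: eq_bigr => k _; rewrite tnthS.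
have iprod := @Cintegrable_prod _ _ _ _ _ mu m2 _ _ (iF ord0) ih1.
have Iprod := @Cintegral_prod _ _ _ _ _ mu m2 _ _ (iF ord0) ih1.
have {}iprod : Cintegrable (mu \x m2)%E setT (fun p => \prod_(k < n.+1) F k (tnth (c p) k)).
  by apply: (eq_Cintegrable measurableT _ iprod) => p _; rewrite cE.
have {}Iprod : Cintegral (mu \x m2)%E setT (fun p => \prod_(k < n.+1) F k (tnth (c p) k)) =
    \prod_(k < n.+1) Cintegral mu setT (F k).
  rewrite big_ord_recl -ih2 -Iprod.
  by apply: eq_Cintegral => p _; rewrite cE.
case: iprod mF => iF1 iF2 [mF1 mF2].
have mE1 := (measurable_EFinP _ _).2 mF1; have mE2 := (measurable_EFinP _ _).2 mF2.
split.
- split.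
    exact: (@integrable_pushforward _ _ _ _ R c mc (mu \x m2)%E setT _ mE1 iF1 measurableT).
  exact: (@integrable_pushforward _ _ _ _ R c mc (mu \x m2)%E setT _ mE2 iF2 measurableT).
- rewrite -Iprod /Cintegral; congr (_ +i* _); congr fine.
    exact: (@integral_pushforward _ _ _ _ R c mc (mu \x m2)%E setT _ mE1 iF1 measurableT).
  exact: (@integral_pushforward _ _ _ _ R c mc (mu \x m2)%E setT _ mE2 iF2 measurableT).
Qed.

End tuple_product.

(** * Rotations and dilations of the plane *)

Section lebesgue_affine.
Local Open Scope ereal_scope.
Context {R : realType}.
Local Notation mu := (@lebesgue_measure R).
Implicit Type F : R -> \bar R.

(** The image of Lebesgue measure under a translation agrees with it on half-open
intervals, which determine it. *)
Lemma ge0_integral_translation F (a : R) : measurable_fun setT F ->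
  (forall x, 0 <= F x) -> \int[mu]_x F (x + a)%R = \int[mu]_x F x.
Proof.
move=> mF F0.
have mphi : measurable_fun setT (fun x : measurableTypeR R => (x + a)%R : measurableTypeR R).
  exact: measurable_funD.
transitivity (\int[pushforward mu (fun x : measurableTypeR R => (x + a)%R : measurableTypeR R)]_x F x).
  by rewrite ge0_integral_pushforward// => y _; exact: F0.
apply: eq_measure_integral => A mA _ /=.
apply/esym/(@lebesgue_measure_unique R
  (@measure_function_pushforward__canonical__measure_function_Measure _ _ _ _ R mu _ mphi)) => //.
move=> _ [[b c] _ <-] /=; rewrite /pushforward.
rewrite (_ : _ @^-1` _ = `](b - a)%R, (c - a)%R]%classic); last first.
  by apply/seteqP; split => x /=; rewrite !in_itv/= ltrBlDr lerBrDr.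
rewrite !lebesgue_measure_itv/= !lte_fin ltrD2r; case: ifP => // _.
by rewrite -!EFinB; congr EFin; ring.
Qed.

Lemma ge0_integral_dilation F (l : R) : (0 < l)%R -> measurable_fun setT F ->
  (forall x, 0 <= F x) -> \int[mu]_x F x = l%:E * \int[mu]_x F (l * x)%R.
Proof.
move=> l0 mF F0.
have mphi : measurable_fun setT (fun x : measurableTypeR R => (l * x)%R : measurableTypeR R).
  exact: measurable_funM.
pose nu := @measure_function_pushforward__canonical__measure_function_Measure _ _ _ _ R mu _ mphi.
have -> : \int[mu]_x F (l * x)%R = \int[nu]_x F x.
  by rewrite /nu/= ge0_integral_pushforward// => y _; exact: F0.
have l0' : (0 <= l)%R by exact: ltW.
transitivity (\int[mscale (NngNum l0') nu]_x F x); last exact: ge0_integral_mscale.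
apply: eq_measure_integral => A mA _ /=.
apply: (@lebesgue_measure_unique R (mscale (NngNum l0') nu)) => //.
move=> _ [[b c] _ <-] /=; rewrite /mscale/= /pushforward.
rewrite (_ : _ @^-1` _ = `](b / l)%R, (c / l)%R]%classic); last first.
  by apply/seteqP; split => x /=; rewrite !in_itv/= ltr_pdivrMr// ler_pdivlMr// ![(x * l)%R]mulrC.
rewrite !lebesgue_measure_itv/= !lte_fin ltr_pM2r ?invr_gt0//; case: ifP => // _; last by rewrite mule0.
by rewrite -!EFinB -EFinM; congr EFin; field; rewrite gt_eqF.
Qed.

End lebesgue_affine.

Section plane_invariance.
Local Open Scope ereal_scope.
Context {R : realType}.
Local Notation mu := (@lebesgue_measure R).
Local Notation mu2 := (mu \x mu)%E.
Implicit Type G : R * R -> \bar R.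

Let horizontal_shear G (a : R) : measurable_fun setT G -> (forall z, 0 <= G z) ->
  \int[mu2]_z G (z.1 + a * z.2, z.2)%R = \int[mu2]_z G z.
Proof.
move=> mG G0.
have mS : measurable_fun setT (fun z : R * R => (z.1 + a * z.2, z.2)%R).
  apply/measurable_fun_pairP; split => /=; last exact: measurable_snd.
  by apply: measurable_funD => //; apply: measurable_funM.
have -> := @fubini_tonelli2 _ _ _ _ R mu mu _ (measurableT_comp mG mS) (fun=> G0 _).
have -> := @fubini_tonelli2 _ _ _ _ R mu mu _ mG G0.
apply: eq_integral => y _.
rewrite /fubini_G/=; apply: (@ge0_integral_translation R (fun x => G (x, y))) => //.
by apply: measurableT_comp mG _; exact: measurable_pair2.
Qed.

Let vertical_shear G (a : R) : measurable_fun setT G -> (forall z, 0 <= G z) ->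
  \int[mu2]_z G (z.1, z.2 + a * z.1)%R = \int[mu2]_z G z.
Proof.
move=> mG G0.
have mS : measurable_fun setT (fun z : R * R => (z.1, z.2 + a * z.1)%R).
  apply/measurable_fun_pairP; split => /=; first exact: measurable_fst.
  by apply: measurable_funD => //; apply: measurable_funM.
have -> := @fubini_tonelli1 _ _ _ _ R mu mu _ (measurableT_comp mG mS) (fun=> G0 _).
have -> := @fubini_tonelli1 _ _ _ _ R mu mu _ mG G0.
apply: eq_integral => x _.
rewrite /fubini_F/=; apply: (@ge0_integral_translation R (fun y => G (x, y))) => //.
by apply: measurableT_comp mG _; exact: measurable_pair1.
Qed.

Definition plane_rotation (t : R) (z : R * R) : R * R :=
  (cos t * z.1 - sin t * z.2, sin t * z.1 + cos t * z.2)%R.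

Lemma measurable_plane_rotation t : measurable_fun setT (plane_rotation t).
Proof.
apply/measurable_fun_pairP; split => /=.
  by apply: measurable_funB; apply: measurable_funM.
by apply: measurable_funD; apply: measurable_funM.
Qed.

(* A rotation by t is the product of a horizontal, a vertical and a horizontal
shear, with slopes - tan (t / 2), sin t and - tan (t / 2); here tan (t / 2) is
written sin t / (1 + cos t). *)
Let rotation_shears G t : (1 + cos t != 0)%R -> measurable_fun setT G ->
  (forall z, 0 <= G z) -> \int[mu2]_z G (plane_rotation t z) = \int[mu2]_z G z.
Proof.
move=> ct mG G0; set u := (sin t / (1 + cos t))%R.
have ms1 : measurable_fun setT (fun z : R * R => (z.1 + - u * z.2, z.2)%R).
  apply/measurable_fun_pairP; split => /=; last exact: measurable_snd.
  by apply: measurable_funD => //; apply: measurable_funM.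
have ms2 : measurable_fun setT (fun z : R * R => (z.1, z.2 + sin t * z.1)%R).
  apply/measurable_fun_pairP; split => /=; first exact: measurable_fst.
  by apply: measurable_funD => //; apply: measurable_funM.
rewrite -(horizontal_shear (- u) mG G0).
rewrite -(vertical_shear (sin t) (measurableT_comp mG ms1))//=.
rewrite -(horizontal_shear (- u) (measurableT_comp (measurableT_comp mG ms1) ms2))//=.
apply: eq_integral => -[x y] _ /=; congr (G (_, _)); rewrite /u.
- have s2 : (sin t ^+ 2 = 1 - cos t ^+ 2)%R by rewrite sin2cos2.
  have -> : (x + - (sin t / (1 + cos t)) * y + - (sin t / (1 + cos t)) *
     (y + sin t * (x + - (sin t / (1 + cos t)) * y)) =
     x - sin t ^+ 2 / (1 + cos t) * x - sin t / (1 + cos t) * y * (2 - sin t ^+ 2 / (1 + cos t)))%R.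
    by field.
  by rewrite s2 /=; field.
- have s2 : (sin t ^+ 2 = 1 - cos t ^+ 2)%R by rewrite sin2cos2.
  have -> : (y + sin t * (x + - (sin t / (1 + cos t)) * y) =
    sin t * x + y * (1 - sin t ^+ 2 / (1 + cos t)))%R by field.
  by rewrite s2 /=; field.
Qed.

(** Shears preserve planar Lebesgue measure because, by Tonelli, they are
translations in one variable. The half-turn, for which the shear factorisation
degenerates, is the square of the quarter-turn. *)
Lemma ge0_integral_rotation G t : measurable_fun setT G ->
  (forall z, 0 <= G z) -> \int[mu2]_z G (plane_rotation t z) = \int[mu2]_z G z.
Proof.
move=> mG G0; have [ct|] := eqVneq (1 + cos t)%R 0%R; last by move=> ?; exact: rotation_shears.
have ct1 : (cos t = -1)%R by apply/eqP; rewrite -subr_eq0 opprK addrC ct.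
have st0 : (sin t = 0)%R.
  by apply/eqP; rewrite -sqrf_eq0 sin2cos2 ct1 sqrrN expr1n subrr.
have c2 : (1 + cos (pi / 2) != 0 :> R)%R by rewrite cos_pihalf addr0 oner_eq0.
rewrite -(rotation_shears c2 mG G0).
rewrite -(rotation_shears c2 (measurableT_comp mG (measurable_plane_rotation (pi / 2))))//=.
apply: eq_integral => -[x y] _; congr G.
rewrite /plane_rotation/= cos_pihalf sin_pihalf ct1 st0.
by congr pair; ring.
Qed.

Lemma ge0_integral_dilation2 G (l : R) : (0 < l)%R -> measurable_fun setT G ->
  (forall z, 0 <= G z) ->
  \int[mu2]_z G z = (l ^+ 2)%:E * \int[mu2]_z G (l * z.1, l * z.2)%R.
Proof.
move=> l0 mG G0.
have ml : measurable_fun setT (fun z : R * R => (l * z.1, l * z.2)%R).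
  by apply/measurable_fun_pairP; split => /=; apply: measurable_funM.
have mGl := measurableT_comp mG ml.
have -> := @fubini_tonelli1 _ _ _ _ R mu mu _ mGl (fun=> G0 _).
have -> := @fubini_tonelli1 _ _ _ _ R mu mu _ mG G0.
have mFG : measurable_fun setT (fubini_F mu G) by exact: measurable_fun_fubini_tonelli_F.
rewrite (ge0_integral_dilation l0)//; last by move=> x; apply: integral_ge0 => y _; exact: G0.
rewrite expr2 EFinM -muleA; congr (_ * _).
rewrite -ge0_integralZl//; last 3 first.
- exact: (@measurable_fun_fubini_tonelli_F _ _ _ _ R mu _ mGl (fun=> G0 _)).
- by move=> x _; apply: integral_ge0 => y _; exact: G0.
- by rewrite lee_fin ltW.
apply: eq_integral => x _; rewrite /fubini_F /=.
apply: (@ge0_integral_dilation R (fun y => G (l * x, y)%R)) => //.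
by apply: measurableT_comp mG _; exact: measurable_pair1.
Qed.

End plane_invariance.

(** * The argument and full periods *)

Section expi.
Context {R : realType}.
Implicit Types t u x : R.

Lemma expiD t u : expi (t + u) = expi t * expi u :> R[i].
Proof.
apply/eqP; rewrite /expi eq_complex /= cosD sinD; apply/andP; split => //.
by rewrite addrC mulrC [X in _ + X]mulrC; apply/eqP; ring.
Qed.

Lemma expi0 : expi 0 = 1 :> R[i].
Proof. by rewrite /expi cos0 sin0. Qed.

Lemma normc_expi t : normc (expi t : R[i]) = 1.
Proof. by rewrite /expi /= cos2Dsin2 sqrtr1. Qed.

Lemma conj_expi t : conjc (expi t) = expi (- t) :> R[i].
Proof. by rewrite /expi cosN sinN. Qed.

Lemma expiMn t n : expi t ^+ n = expi (n%:R * t) :> R[i].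
Proof.
elim: n => [|n ih]; first by rewrite mul0r expr0 expi0.
by rewrite exprS ih -expiD mulrS mulrDl mul1r.
Qed.

Lemma expi_periodic t : expi (t + 2 * pi) = expi t :> R[i].
Proof. by rewrite /expi mulr_natl cosD2pi sinD2pi. Qed.

Lemma Arg_scaled_expi r x : 0 < r -> - pi < x <= pi ->
  Arg (r%:C * expi x) = x.
Proof.
move=> r0 /andP[px xp].
have -> : r%:C * expi x = (r * cos x) +i* (r * sin x) by rewrite /expi; simpc.
rewrite /Arg /=.
have -> : Num.sqrt ((r * cos x) ^+ 2 + (r * sin x) ^+ 2) = r.
  by rewrite !exprMn -mulrDr cos2Dsin2 mulr1 sqrtr_sqr gtr0_norm.
rewrite mulrAC divff ?gt_eqF// mul1r pmulr_rge0//.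
have [x0|x0] := leP 0 x.
  by rewrite sin_ge0_pi ?x0 ?xp// cosK// in_itv/= x0 xp.
have sx : sin x < 0.
  by rewrite -oppr_gt0 -sinN sin_gt0_pi// oppr_gt0 x0/= ltrNl.
by rewrite leNgt sx/= cosKN ?opprK// ?(ltW px) ?(ltW x0).
Qed.

End expi.

Section measurable_argument.
Context {R : realType}.

Lemma measurable_acos : measurable_fun (`[-1, 1]%classic : set R) (@acos R).
Proof.
have -> : `[-1, 1]%classic = [set -1] `|` `]-1, 1[%classic `|` [set 1] :> set R.
  apply/seteqP; split => x /=; rewrite !in_itv/=.
    move=> /andP[]; rewrite !le_eqVlt => /predU1P[->|x1]; first by left; left.
    by move=> /predU1P[->|x2]; [right|left; right; rewrite x1 x2].
  by move=> [[->|/andP[a b]]|->]; rewrite ?lexx ?ltW//= ?andbT ?lerN10// ltW// (lt_trans a b).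
apply/measurable_funU => //; first exact: measurableU.
split; last exact: measurable_fun_set1.
apply/measurable_funU => //; split; first exact: measurable_fun_set1.
apply: open_continuous_measurable_fun; first exact: itv_open.
by move=> x; rewrite inE/= in_itv/= => x11; exact: continuous_acos.
Qed.

Lemma measurable_normc_toC : measurable_fun setT (fun z : R * R => normc (toC z)).
Proof.
by apply: measurable_normc; split; [exact: measurable_fst|exact: measurable_snd].
Qed.

Lemma measurable_Arg : measurable_fun setT (fun z : R * R => Arg (toC z)).
Proof.
have mt : measurable_fun setT (fun z : R * R => acos (complex.Re (toC z) / normc (toC z))).
  apply: (@measurable_comp _ _ _ _ _ _ (`[-1, 1]%classic : set R) (@acos R) setT
    (fun z : R * R => complex.Re (toC z) / normc (toC z))) => //.
  - by move=> _ [z _ <-]; exact: (cos_Arg_itv (toC z)).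
  - exact: measurable_acos.
  apply: measurable_funM; first exact: measurable_fst.
  rewrite (_ : (fun _ => _) = fun z => normc (toC z) `^ (-1)).
    exact: (measurableT_comp (@measurable_powR R (-1)) measurable_normc_toC).
  by apply/funext => z; rewrite powR_inv1// normc_ge0.
apply: measurable_fun_if => //.
- apply: measurable_fun_ler => //; exact: measurable_snd.
- exact: measurable_funTS.
- by apply: measurable_funTS; exact: measurableT_comp.
Qed.

End measurable_argument.

Section circle_average.
Local Open Scope ereal_scope.
Context {R : realType}.
Local Notation mu := (@lebesgue_measure R).
Implicit Type P F : R -> \bar R.

Lemma integral_shift_itv P (a b c : R) : measurable_fun setT P -> (forall x, 0 <= P x) ->
  \int[mu]_(x in `]a, b]) P (x + c)%R = \int[mu]_(x in `](a + c)%R, (b + c)%R]) P x.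
Proof.
move=> mP P0; rewrite integral_mkcond [RHS]integral_mkcond.
rewrite -(ge0_integral_translation (F := P \_ `](a + c)%R, (b + c)%R]) c).
- apply: eq_integral => x _; rewrite !patchE.
  by congr (if _ then _ else _); apply/idP/idP; rewrite !inE/= !in_itv/= ltrD2r lerD2r.
- by apply/(measurable_restrictT _ _).1 => //; exact: measurable_funTS.
- by move=> x; apply: erestrict_ge0 => ? _; exact: P0.
Qed.

Let integral_split P (a b c : R) : (a <= b)%R -> (b <= c)%R ->
  measurable_fun setT P -> (forall x, 0 <= P x) ->
  \int[mu]_(x in `]a, c]) P x =
  \int[mu]_(x in `]a, b]) P x + \int[mu]_(x in `]b, c]) P x.
Proof.
move=> ab bc mP P0; rewrite -ge0_integral_setU//.
- by rewrite -itv_bndbnd_setU// bnd_simp.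
- exact: measurable_funTS.
- apply/disj_setPS => y [/=]; rewrite 2!in_itv/= => /andP[_ yx] /andP[].
  by rewrite ltNge yx.
Qed.

(** Cut the interval at 0 and translate its negative part by one period. *)
Lemma integral_period P (a : R) : (- (2 * pi) <= a <= 0)%R ->
  measurable_fun setT P -> (forall x, 0 <= P x) -> (forall x, P (x + 2 * pi)%R = P x) ->
  \int[mu]_(x in `]a, (a + 2 * pi)%R]) P x = \int[mu]_(x in `]0%R, (2 * pi)%R]) P x.
Proof.
move=> /andP[a1 a2] mP P0 Pper.
have a3 : (0 <= a + 2 * pi)%R by rewrite -lerBlDr sub0r.
have a4 : (a + 2 * pi <= 2 * pi)%R by rewrite gerDr.
rewrite (integral_split a2 a3 mP P0) (integral_split a3 a4 mP P0) addeC; congr (_ + _).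
have := @integral_shift_itv P a 0%R (2 * pi)%R mP P0; rewrite add0r => <-.
by apply: eq_integral => x _; rewrite Pper.
Qed.

End circle_average.

(** * Rotational averages of the Gaussian weight *)

Section gauss_bridge.
Context {R : realType}.
Local Notation mu := (@lebesgue_measure R).
Local Notation plane := (measurableTypeR R * measurableTypeR R)%type.

(** The measure mu_gauss again, but on the plane presented as the product of two
copies of the line whose sigma-algebra is generated by half-open intervals, as
for Lebesgue measure. The two presentations are convertible without being
syntactically equal, and the identity map transports integrals between them. *)
Definition gauss_density N : set plane -> \bar R :=
  density (mu \x mu)%E (gauss_weight N).

HB.instance Definition _ N := isMeasure.Build _ _ _ (gauss_density N)
  (density0 (mu \x mu)%E (gauss_weight N))
  (@density_ge0 _ _ _ (mu \x mu)%E (gauss_weight N) (fun=> expR_ge0 _))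
  (@density_sigma_additive _ _ _ (mu \x mu)%E (gauss_weight N)
    (measurable_gauss_weight N) (fun=> expR_ge0 _)).

Lemma ge0_integral_mu_gauss N (G : R * R -> \bar R) : measurable_fun setT G -> (forall z, 0 <= G z)%E ->
  (\int[mu_gauss N]_z G z = \int[(mu \x mu)%E]_z (G z * (gauss_weight N z)%:E))%E.
Proof.
move=> mG G0.
rewrite -[RHS](@ge0_integral_density _ _ R (mu \x mu)%E (gauss_density N) (gauss_weight N)
  (measurable_gauss_weight N) (fun=> expR_ge0 _) (fun A _ => erefl) G mG G0).
have mid : measurable_fun setT (fun z : plane => z : R * R) by exact: measurable_id.
exact: (@ge0_integral_pushforward _ _ _ _ R _ mid (gauss_density N) setT G measurableT mG (fun z _ => G0 z)).
Qed.

End gauss_bridge.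

Section gauss_average.
Local Open Scope ereal_scope.
Context {R : realType}.
Local Notation mu := (@lebesgue_measure R).
Implicit Types (F : R -> \bar R) (G : R * R -> \bar R) (z : R * R) (N : nat).

Lemma toC_rotation t z : toC (plane_rotation t z) = (expi t * toC z)%R.
Proof.
case: z => x y; apply/eqP; rewrite eq_complex /=.
by apply/andP; split; apply/eqP; ring.
Qed.

Lemma normc_rotation t z : normc (toC (plane_rotation t z)) = normc (toC z).
Proof. by rewrite toC_rotation normcM normc_expi mul1r. Qed.

Lemma ge0_integral_mu_gauss_rotation N G t : measurable_fun setT G ->
  (forall z, 0 <= G z) ->
  \int[mu_gauss N]_z G (plane_rotation t z) = \int[mu_gauss N]_z G z.
Proof.
move=> mG G0; have mGt := measurableT_comp mG (measurable_plane_rotation t).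
have -> := ge0_integral_mu_gauss N mGt (fun=> G0 _).
have -> := ge0_integral_mu_gauss N mG G0.
rewrite -[RHS](@ge0_integral_rotation R _ t).
- by apply: eq_integral => z _ /=; rewrite /gauss_weight normc_rotation.
- by apply: emeasurable_funM => //; apply/measurable_EFinP; exact: measurable_gauss_weight.
- by move=> z; rewrite mule_ge0// lee_fin expR_ge0.
Qed.

Let Arg_radial (r x : R) : (0 < r)%R -> Arg (r%:C * expi x)%R = Arg (expi x).
Proof.
move=> r0; have E := Arg_polar (expi x : R[i]).
rewrite normc_expi mul1r in E.
by rewrite [in LHS]E Arg_scaled_expi// Arg_bounds.
Qed.

Let integral_Arg_rotation F z : toC z != 0%R -> measurable_fun setT F ->
  (forall x, 0 <= F x) ->
  \int[mu]_(t in `](- pi)%R, pi]) F (Arg (toC (plane_rotation t z))) =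
  \int[mu]_(t in `](- pi)%R, pi]) F t.
Proof.
move=> z0 mF F0; have r0 : (0 < normc (toC z))%R.
  rewrite lt_neqAle normc_ge0 andbT eq_sym; apply: contra z0 => /eqP n0.
  by apply/eqP/eq0_normc.
pose P x := F (Arg (expi x)).
have mP : measurable_fun setT P.
  apply: measurableT_comp mF _.
  rewrite (_ : (fun x => _) = (fun z => Arg (toC z)) \o (fun x => (cos x, sin x)))//.
  apply: measurableT_comp measurable_Arg _.
  by apply/measurable_fun_pairP; split => /=; apply: continuous_measurable_fun; [exact: continuous_cos|exact: continuous_sin].
have P0 x : 0 <= P x by exact: F0.
have Pper x : P (x + 2 * pi)%R = P x by rewrite /P expi_periodic.
have p0 := pi_ge0 R; have /andP[A1 A2] := Arg_bounds (toC z).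
transitivity (\int[mu]_(t in `](- pi)%R, pi]) P (t + Arg (toC z))%R).
  apply: eq_integral => t _; rewrite toC_rotation [in LHS](Arg_polar (toC z)).
  by rewrite mulrCA -expiD Arg_radial.
have E1 : (pi = - pi + 2 * pi :> R)%R by rewrite mulr_natl mulr2n addrA addNr add0r.
have E2 : (pi + Arg (toC z) = - pi + Arg (toC z) + 2 * pi :> R)%R by rewrite {1}E1; ring.
rewrite integral_shift_itv// E2 integral_period//; last first.
  by apply/andP; split; lra.
rewrite -(@integral_period _ P (- pi)%R)//; last by apply/andP; split; lra.
rewrite -E1; apply: eq_integral => x; rewrite inE/= in_itv/= => xpi.
by rewrite /P -[expi x]mul1r Arg_scaled_expi.
Qed.

(** Under a rotation-invariant measure the argument is uniform and independent of
the modulus. Average the integral on the left over all rotations and exchange the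
two integrals: at fixed z <> 0 the average over the angle is that of F over the
circle, and the modulus is unchanged. *)
Lemma circle_average_gauss N F (w : R -> \bar R) : measurable_fun setT F ->
  (forall x, 0 <= F x) -> measurable_fun setT w -> (forall r, 0 <= w r) ->
  (2 * pi)%:E * \int[mu_gauss N]_z (F (Arg (toC z)) * w (normc (toC z))) =
  \int[mu]_(t in `](- pi)%R, pi]) F t * \int[mu_gauss N]_z w (normc (toC z)).
Proof.
move=> mF F0 mw w0; have p0 := pi_gt0 R.
have mww : measurable_fun setT (fun z : R * R => w (normc (toC z))).
  exact: measurableT_comp mw measurable_normc_toC.
have mFA : measurable_fun setT (fun z : R * R => F (Arg (toC z))).
  exact: measurableT_comp mF measurable_Arg.
have mG : measurable_fun setT (fun z : R * R => F (Arg (toC z)) * w (normc (toC z))).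
  exact: emeasurable_funM.
have G0 z : 0 <= F (Arg (toC z)) * w (normc (toC z)) by rewrite mule_ge0.
pose H (p : R * (R * R)) : \bar R := (\1_(`](- pi)%R, pi]%classic : set R) p.1)%:E *
  (F (Arg (toC (plane_rotation p.1 p.2))) * w (normc (toC p.2))).
have mrot : measurable_fun setT (fun p : R * (R * R) => plane_rotation p.1 p.2).
  have m1 : measurable_fun setT (fun p : R * (R * R) => p.1) by exact: measurable_fst.
  have m2 : measurable_fun setT (fun p : R * (R * R) => p.2.1).
    exact: measurableT_comp measurable_fst measurable_snd.
  have m3 : measurable_fun setT (fun p : R * (R * R) => p.2.2).
    exact: measurableT_comp measurable_snd measurable_snd.
  have mc : measurable_fun setT (fun p : R * (R * R) => cos p.1).
    apply: measurableT_comp m1; apply: continuous_measurable_fun; exact: continuous_cos.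
  have ms : measurable_fun setT (fun p : R * (R * R) => sin p.1).
    apply: measurableT_comp m1; apply: continuous_measurable_fun; exact: continuous_sin.
  apply/measurable_fun_pairP; split => /=.
    by apply: measurable_funB; apply: measurable_funM.
  by apply: measurable_funD; apply: measurable_funM.
have mH : measurable_fun setT H.
  apply: emeasurable_funM.
    apply/measurable_EFinP; apply: measurableT_comp measurable_fst.
    exact: measurable_indic.
  apply: emeasurable_funM; first exact: measurableT_comp mFA mrot.
  exact: measurableT_comp mww measurable_snd.
have H0 p : 0 <= H p by rewrite /H !mule_ge0// lee_fin.
have fub : \int[mu]_t \int[mu_gauss N]_z H (t, z) = \int[mu_gauss N]_z \int[mu]_t H (t, z).
  exact: (@fubini_tonelli _ _ _ _ R mu [the {sigma_finite_measure set _ -> \bar R} of mu_gauss N] H mH H0).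
transitivity (\int[mu]_t \int[mu_gauss N]_z H (t, z)).
  have Et (t : R) : \int[mu_gauss N]_z H (t, z) =
      (\1_(`](- pi)%R, pi]%classic : set R) t)%:E *
      \int[mu_gauss N]_z (F (Arg (toC z)) * w (normc (toC z))).
    have mGt := measurableT_comp mG (measurable_plane_rotation t).
    rewrite -(ge0_integral_mu_gauss_rotation N t mG G0) -(ge0_integralZl _ _ mGt)//.
      by apply: eq_integral => z _; rewrite /comp normc_rotation.
    by move=> z _; exact: G0.
  under [in RHS]eq_integral do rewrite Et.
  rewrite ge0_integralZr//; last 2 first.
  - exact/measurable_EFinP/measurable_indic.
  - exact: integral_ge0.
  congr (_ * _); apply/esym; rewrite integral_indic// setIT.
  transitivity (mu `](- pi)%R, pi]); first by [].
  rewrite lebesgue_measure_itv/= lte_fin gtrN//.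
  by rewrite -EFinB opprK mulr_natl mulr2n.
rewrite fub.
have E (z : R * R) : toC z != 0%R -> \int[mu]_t H (t, z) =
   \int[mu]_(t in `](- pi)%R, pi]) F t * w (normc (toC z)).
  move=> z0; rewrite -(integral_Arg_rotation z0 mF F0) [in RHS]integral_mkcond.
  have mFz : measurable_fun setT (fun x : R => F (Arg (toC (plane_rotation x z)))).
    apply: measurableT_comp mFA _.
    exact: (measurableT_comp mrot (measurable_pair2 z)).
  rewrite -ge0_integralZr//; last 2 first.
  - by apply/(measurable_restrictT _ _).1 => //; exact: measurable_funTS.
  - by move=> x _; apply: erestrict_ge0 => ? _; exact: F0.
  apply: eq_integral => x _; rewrite /H patchE indicE muleA.
  by have [xA|xA] := boolP (x \in (`](- pi)%R, pi]%classic : set R)); rewrite /= ?mul1e ?mul0e.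
rewrite -ge0_integralZl//; last exact: integral_ge0.
apply: ge0_ae_eq_integral => //.
- by apply: (@measurable_fun_fubini_tonelli_G _ _ _ _ R mu _ mH H0).
- by apply: emeasurable_funM => //.
- by move=> z _; apply: integral_ge0 => x _; exact: (H0 (x, z)).
- by move=> z _; rewrite mule_ge0// integral_ge0.
- have mz : measurable ([set 0%R] `*` [set 0%R] : set (R * R)) by exact: measurableX.
  exists ([set 0%R] `*` [set 0%R]); split => //.
    apply: null_set_integral => //.
      by apply/measurable_EFinP/measurable_funTS; exact: measurable_gauss_weight.
    have z0 : (mu \x mu)%E ([set 0%R] `*` [set 0%R]) = 0.
      rewrite product_measure1E; [|exact: measurable_set1|exact: measurable_set1].
      by rewrite [X in X * _]lebesgue_measure_set1 mul0e.
    exact: z0.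
  move=> [x y] /= /not_implyP[_]; apply: contra_notP => /not_andP xy.
  apply: E; apply/eqP => -[x0 y0].
  by case: xy.
Qed.

End gauss_average.

(** * Radial moments *)

Section radial_moments.
Context {R : realType} (N : nat).
Hypothesis N0 : (0 < N)%N.
Local Notation mu := (@lebesgue_measure R).
Local Notation abs z := (normc (toC z)).
Implicit Types (z : R * R) (n : nat).

(** No closed form is needed: the Gaussian weight enters the asymptotics only
through the positivity, the log-convexity and the two-step recursion of these
moments. *)
Definition radial_moment n : R := (\int[mu_gauss N]_z (abs z ^+ n))%R.

Let M n : \bar R := (\int[mu_gauss N]_z (abs z ^+ n)%:E)%E.

Let mabs n : measurable_fun setT (fun z => abs z ^+ n : R).
Proof. by apply: measurable_funX; exact: measurable_normc_toC. Qed.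

Let mweight n (l : R) : measurable_fun setT
  (fun z => abs z ^+ n * expR (- (N%:R * l ^+ 2 * abs z ^+ 2)) : R).
Proof.
apply: measurable_funM => //; apply: measurableT_comp => //.
by apply: measurableT_comp => //; apply: measurable_funM.
Qed.

Let NR : 0 < N%:R :> R. Proof. by rewrite ltr0n. Qed.

Let absX0 n z : 0 <= abs z ^+ n. Proof. by rewrite exprn_ge0// normc_ge0. Qed.

(* The substitution z -> l z turns the moment into one for the parameter
N l^2. *)
Let dilated n (l : R) : 0 < l -> M n = ((l ^+ (n + 2))%:E *
  \int[(mu \x mu)%E]_z (abs z ^+ n * expR (- (N%:R * l ^+ 2 * abs z ^+ 2)))%:E)%E.
Proof.
move=> l0; rewrite /M ge0_integral_mu_gauss//; last 2 first.
- exact/measurable_EFinP.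
- by move=> z; rewrite lee_fin.
rewrite (ge0_integral_dilation2 l0); last 2 first.
- apply: emeasurable_funM; first exact/measurable_EFinP.
  by apply/measurable_EFinP; exact: measurable_gauss_weight.
- by move=> z; rewrite -EFinM lee_fin mulr_ge0// expR_ge0.
rewrite addnC exprD (EFinM (l ^+ 2) (l ^+ n)) -(muleA (l ^+ 2)%:E); congr (_ * _)%E.
rewrite -ge0_integralZl//.
- apply: eq_integral => z _; rewrite -!EFinM; congr EFin.
  rewrite /gauss_weight.
  have -> : toC (l * z.1, l * z.2) = l%:C * toC z by rewrite /toC; simpc.
  rewrite normcM normc_real gtr0_norm// !exprMn mulrA -!mulrA; congr (_ * (_ * expR _)).
- by apply/measurable_EFinP; exact: mweight.
- by move=> z _; rewrite lee_fin mulr_ge0// expR_ge0.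
- by rewrite lee_fin exprn_ge0// ltW.
Qed.

(* exp (- N l^2 |z|^2) is convex in l^2 and lies above its tangent at l^2 = 1. *)
Let tangent n (l : R) z :
  abs z ^+ n * expR (- (N%:R * 1 ^+ 2 * abs z ^+ 2)) +
  N%:R * (1 - l ^+ 2) * (abs z ^+ n.+2 * expR (- (N%:R * 1 ^+ 2 * abs z ^+ 2))) <=
  abs z ^+ n * expR (- (N%:R * l ^+ 2 * abs z ^+ 2)).
Proof.
have -> : abs z ^+ n.+2 = abs z ^+ n * abs z ^+ 2 by rewrite -exprD addn2.
set q := abs z ^+ 2; rewrite expr1n mulr1.
rewrite [leLHS](_ : _ = abs z ^+ n * (expR (- (N%:R * q)) * (1 + N%:R * (1 - l ^+ 2) * q))); last by ring.
rewrite ler_wpM2l//.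
have -> : expR (- (N%:R * l ^+ 2 * q)) = expR (- (N%:R * q)) * expR (N%:R * (1 - l ^+ 2) * q).
  by rewrite -expRD; congr expR; ring.
by rewrite ler_wpM2l ?expR_ge0// expR_ge1Dx.
Qed.

(* The dilation by 1/2 bounds the moment of order n + 2 by a multiple of the
moment of order n. *)
Let M_lty_step n : (M n < +oo)%E -> (M n.+2 < +oo)%E.
Proof.
move=> Mn; have h0 : (0 < 2^-1 :> R) by rewrite invr_gt0.
have c0 : 0 < N%:R * (1 - 2^-1 ^+ 2) :> R.
  by rewrite mulr_gt0// subr_gt0 exprn_ilt1// invf_lt1// ltr1n.
have H : (\int[(mu \x mu)%E]_z (abs z ^+ n * expR (- (N%:R * 2^-1 ^+ 2 * abs z ^+ 2)))%:E < +oo)%E.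
  move: Mn; rewrite (dilated n h0); apply: contraLR; rewrite -!leNgt leye_eq => /eqP ->.
  by rewrite gt0_muley// lte_fin exprn_gt0.
rewrite (dilated n.+2 ltr01) expr1n mul1e.
suff : ((N%:R * (1 - 2^-1 ^+ 2))%:E * \int[(mu \x mu)%E]_z
    (abs z ^+ n.+2 * expR (- (N%:R * 1 ^+ 2 * abs z ^+ 2)))%:E < +oo)%E.
  apply: contraLR; rewrite -!leNgt leye_eq => /eqP ->.
  by rewrite gt0_muley// lte_fin.
apply: le_lt_trans H; rewrite -ge0_integralZl//.
- apply: ge0_le_integral => //.
  + move=> z _; rewrite -EFinM lee_fin mulr_ge0 ?(ltW c0)// mulr_ge0// expR_ge0.
  + by apply: emeasurable_funM => //; apply/measurable_EFinP; exact: mweight.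
  + by apply/measurable_EFinP; exact: mweight.
  + move=> z _; rewrite -EFinM lee_fin (le_trans _ (tangent n 2^-1 z))// lerDr.
    by rewrite mulr_ge0// expR_ge0.
- by apply/measurable_EFinP; exact: mweight.
- by move=> z _; rewrite lee_fin mulr_ge0// expR_ge0.
- by rewrite lee_fin ltW.
Qed.

Let mwgt n : measurable_fun setT
  (fun z => (abs z ^+ n)%:E * (gauss_weight N z)%:E : \bar R)%E.
Proof.
apply: emeasurable_funM; first exact/measurable_EFinP.
by apply/measurable_EFinP; exact: measurable_gauss_weight.
Qed.

Let M0_lty : (M 0 < +oo)%E.
Proof.
have ig := @integrableT_gauss R.
have iC := @Cintegrable_prod _ _ _ _ R mu mu _ _
  (Cintegrable_real ig) (Cintegrable_real ig).
case: iC => iC _.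
have : (mu \x mu)%E.-integrable setT (fun z : R * R => (gauss_fun z.1 * gauss_fun z.2)%:E).
  by apply: eq_integrable iC => // z _ /=; rewrite mulr0 subr0.
move=> /integrableP[mi]; apply: le_lt_trans.
rewrite /M ge0_integral_mu_gauss; [|exact/measurable_EFinP|by move=> z; rewrite lee_fin].
apply: ge0_le_integral => //.
- by move=> z _; rewrite -EFinM lee_fin mulr_ge0// expR_ge0.
- exact: (mwgt 0%N).
- by apply: (measurableT_comp (f := abse)) => //; exact: mi.
- move=> z _; rewrite -EFinM expr0 mul1r lee_fin ger0_norm; last by rewrite mulr_ge0// expR_ge0.
  rewrite /gauss_weight /gauss_fun -expRD ler_expR normc_toC_sqr -opprD lerN2.
  by rewrite ler_peMl// ?addr_ge0 ?sqr_ge0// ler1n.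
Qed.

Let M_lty n : (M n < +oo)%E.
Proof.
have M2 : (M 2 < +oo)%E by exact: M_lty_step.
have M1 : (M 1 < +oo)%E.
  apply: (@le_lt_trans _ _ (M 0 + M 2)%E); last by rewrite lte_add_pinfty.
  rewrite /M -ge0_integralD//; try exact/measurable_EFinP;
    try by move=> z _; rewrite lee_fin.
  apply: ge0_le_integral => //.
  - by move=> z _; rewrite lee_fin.
  - exact/measurable_EFinP.
  - by apply: emeasurable_funD => //; exact/measurable_EFinP.
  - move=> z _; rewrite -EFinD lee_fin expr0 expr1.
    have := sqr_ge0 (abs z - 1); have := normc_ge0 (toC z).
    by rewrite sqrrB1; nra.
suff : (M n < +oo)%E /\ (M n.+1 < +oo)%E by case.
by elim: n => [|n [h1 h2]]; split => //; exact: M_lty_step.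
Qed.

Lemma integrable_radial n :
  (mu_gauss N).-integrable setT (fun z => (abs z ^+ n)%:E : \bar R).
Proof.
apply/integrableP; split; first exact/measurable_EFinP.
rewrite (eq_integral (fun z => (abs z ^+ n)%:E))//; first exact: M_lty.
by move=> z _; rewrite gee0_abs// lee_fin.
Qed.

Lemma radial_momentE n :
  (radial_moment n)%:E = (\int[mu_gauss N]_z (abs z ^+ n)%:E)%E.
Proof. by rewrite /radial_moment /Rintegral fineK// (integrable_fin_num _ (integrable_radial n)). Qed.

(** The weight is bounded below on the square [1, 2] x [1, 2]. *)
Lemma radial_moment_gt0 n : 0 < radial_moment n.
Proof.
rewrite -lte_fin radial_momentE.
pose Q : set (R * R) := `[1, 2]%classic `*` `[1, 2]%classic.
have mQ : measurable Q by exact: measurableX.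
pose c := expR (- (N%:R * 8)) : R.
have c0 : 0 < c by exact: expR_gt0.
apply: (@lt_le_trans _ _ (\int[(mu \x mu)%E]_(z in Q) c%:E)%E).
  rewrite integral_cst; last exact: mQ.
  have E1 : mu (`[1, 2]%classic : set R) = 1%E.
    rewrite lebesgue_measure_itv/= lte_fin ltr1n/= -EFinB; congr EFin; ring.
  have E2 : (mu \x mu)%E Q = 1%E.
    rewrite product_measure1E; [|exact: measurable_itv|exact: measurable_itv].
    by rewrite [X in (X * _)%E]E1 mul1e; exact: E1.
  by apply: mule_gt0; [rewrite lte_fin|rewrite [X in (_ < X)%E]E2 lte01].
rewrite ge0_integral_mu_gauss//; last 2 first.
- exact/measurable_EFinP.
- by move=> z; rewrite lee_fin.
have mI := mwgt n.
apply: (@le_trans _ _ (\int[(mu \x mu)%E]_(z in Q) ((abs z ^+ n)%:E * (gauss_weight N z)%:E))%E).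
  apply: ge0_le_integral => //.
  - by move=> z _; rewrite lee_fin ltW.
  - exact: measurable_funTS.
  - move=> z Qz.
    have [/andP[x1 x2] /andP[y1 y2]] : (1 <= z.1 <= 2) /\ (1 <= z.2 <= 2).
      by case: Qz => /=; rewrite !in_itv.
    rewrite -EFinM lee_fin -[leLHS]mul1r; apply: ler_pM => //; first exact: ltW.
      rewrite exprn_ege1// -(@ler_pXn2r _ 2) ?nnegrE ?normc_ge0//.
      by rewrite normc_toC_sqr expr1n; nra.
    rewrite /gauss_weight ler_expR lerN2 ler_wpM2l// normc_toC_sqr.
    by nra.
apply: ge0_subset_integral => //.
by move=> z _; rewrite -EFinM lee_fin mulr_ge0// expR_ge0.
Qed.

(** Cauchy-Schwarz: integrate |z|^n (|z| - s)^2 >= 0 at the minimising s. *)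
Lemma radial_moment_convex n :
  radial_moment n.+1 ^+ 2 <= radial_moment n * radial_moment n.+2.
Proof.
have m0 := radial_moment_gt0 n.
pose s := radial_moment n.+1 / radial_moment n.
have H : 0 <= (\int[mu_gauss N]_z (abs z ^+ n.+2 - 2 * s * abs z ^+ n.+1 + s ^+ 2 * abs z ^+ n))%R.
  apply: Rintegral_ge0 => z _.
  rewrite (_ : _ + _ = abs z ^+ n * (abs z - s) ^+ 2); last by rewrite !exprS; ring.
  by rewrite mulr_ge0// sqr_ge0.
have i0 := integrable_radial n; have i1 := integrable_radial n.+1; have i2 := integrable_radial n.+2.
move: H; rewrite RintegralD//; last 2 first.
- exact: (integrableB measurableT i2 (integrableZl measurableT _ i1)).
- exact: (integrableZl measurableT _ i0).
rewrite RintegralB//; last exact: (integrableZl measurableT _ i1).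
rewrite !RintegralZl// -!/(radial_moment _).
rewrite (_ : _ + _ = radial_moment n.+2 - radial_moment n.+1 ^+ 2 / radial_moment n); last first.
  by rewrite /s; field; rewrite gt_eqF.
by rewrite subr_ge0 ler_pdivrMr// mulrC.
Qed.

Let moment_tangent n (l : R) : 0 < l ->
  l ^+ (n + 2) * (radial_moment n + N%:R * (1 - l ^+ 2) * radial_moment n.+2) <= radial_moment n.
Proof.
move=> l0; have ln0 : 0 < l ^+ (n + 2) by rewrite exprn_gt0.
have finJ k (r : R) : 0 < r -> (mu \x mu)%E.-integrable setT
    (fun z => (abs z ^+ k * expR (- (N%:R * r ^+ 2 * abs z ^+ 2)))%:E : \bar R).
  move=> r0; apply/integrableP; split; first by apply/measurable_EFinP; exact: mweight.
  rewrite [X in (X < _)%E](_ : _ = \int[(mu \x mu)%E]_z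
      (abs z ^+ k * expR (- (N%:R * r ^+ 2 * abs z ^+ 2)))%:E)%E; last first.
    by apply: eq_integral => z _; rewrite gee0_abs// lee_fin mulr_ge0// expR_ge0.
  have := M_lty k; rewrite (dilated k r0).
  apply: contraLR; rewrite -!leNgt leye_eq => /eqP ->.
  by rewrite gt0_muley// lte_fin exprn_gt0.
have mE k (r : R) : 0 < r -> radial_moment k = r ^+ (k + 2) *
    (\int[(mu \x mu)%E]_z (abs z ^+ k * expR (- (N%:R * r ^+ 2 * abs z ^+ 2))))%R.
  move=> r0; apply: EFin_inj; rewrite radial_momentE -/(M k) (dilated k r0) EFinM.
  by rewrite /Rintegral fineK// (integrable_fin_num _ (finJ k r r0)).
rewrite [leRHS](mE n l l0) ler_pM2l//.
rewrite (mE n 1)// (mE n.+2 1)// !expr1n !mul1r.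
have j1 := finJ n 1 ltr01; have j2 := finJ n.+2 1 ltr01.
rewrite -RintegralZl//; last by move: j2; rewrite expr1n.
rewrite -RintegralD//; last 2 first.
- by move: j1; rewrite expr1n.
- by move: j2; rewrite expr1n => j2; exact: (integrableZl measurableT _ j2).
apply: le_Rintegral => //.
- move: j1 j2; rewrite expr1n => j1 j2.
  exact: (integrableD measurableT j1 (integrableZl measurableT _ j2)).
- exact: finJ.
- by move=> z _; have := tangent n l z; rewrite expr1n.
Qed.

(** Integration by parts in disguise. Dilating by l and using the tangent line of
the exponential, l^(n + 2) (m n + N (1 - l^2) m (n + 2)) is at most m n for all
l > 0, with equality at l = 1; the derivative of this polynomial in l vanishes
there. *)
Lemma radial_moment_rec n :
  radial_moment n.+2 = n.+2%:R / (2 * N%:R) * radial_moment n.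
Proof.
set a := radial_moment n; set b := radial_moment n.+2.
pose P : {poly R} := 'X^(n + 2) * (a%:P + (N%:R * b) *: (1 - 'X^2)).
have PE l : P.[l] = l ^+ (n + 2) * (a + N%:R * (1 - l ^+ 2) * b).
  by rewrite /P !hornerE; ring.
have : is_derive (1 : R) 1 (fun l => P.[l]) 0.
  apply: (@derive1_at_max _ _ 0 2) => //.
  - by rewrite in_itv/= ltr01 ltr1n.
  - move=> t; rewrite in_itv/= => /andP[t0 _].
    by rewrite !PE (le_trans (moment_tangent n t0))// !expr1n subrr mulr0 mul0r addr0 mul1r.
move=> [_ D1]; have P1 : P^`().[1] = 0.
  by rewrite -[LHS]/(horner P^`() 1) derivE derive1E.
have : P^`().[1] = n.+2%:R * a - 2 * N%:R * b.
  rewrite /P derivM derivXn derivD derivC derivZ derivB derivXn derivC !hornerE.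
  by rewrite !expr1n addn2 /= hornerMn hornerXn expr1n; ring.
rewrite P1 => /esym/eqP; rewrite subr_eq0 => /eqP E.
by rewrite mulrAC E; field; rewrite gt_eqF.
Qed.

End radial_moments.

(** * Gaussian integrals in polar form *)

Section polar_integral.
Context {R : realType} (N : nat).
Hypothesis N0 : (0 < N)%N.
Local Notation mu := (@lebesgue_measure R).
Local Notation abs z := (normc (toC z)).
Implicit Types (z : R * R) (n : nat).

Lemma measurable_circle : measurable (circle : set R).
Proof. exact: measurable_itv. Qed.

Let twopi_gt0 : 0 < 2 * pi :> R. Proof. by rewrite mulr_gt0// pi_gt0. Qed.

Let ge0_polar n (v : R -> R) : measurable_fun circle v -> (forall x, 0 <= v x) ->
  (\int[mu_gauss N]_z (v (Arg (toC z)) * abs z ^+ n)%:E =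
   (\int[mu]_(x in circle) (v x)%:E) * ((2 * pi)^-1 * radial_moment N n)%:E)%E.
Proof.
move=> mv v0.
pose D : set R := `]- pi, pi]%classic.
have mvD : measurable_fun D (EFin \o v).
  apply/measurable_EFinP; apply: measurable_funS mv; first exact: measurable_circle.
  move=> x /=.
  by rewrite /D /circle /= !in_itv/= => /andP[a b]; rewrite (ltW a).
have mF : measurable_fun setT ((EFin \o v) \_ D) by exact: ((measurable_restrictT _ (measurable_itv _)).1 mvD).
have F0 x : (0 <= ((EFin \o v) \_ D) x)%E by apply: erestrict_ge0 => y _; rewrite lee_fin.
have mw : measurable_fun setT (fun r : R => (`|r| ^+ n)%:E).
  by apply/measurable_EFinP; apply: measurable_funX.
have w0 (r : R) : (0 <= (`|r| ^+ n)%:E)%E by rewrite lee_fin exprn_ge0.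
have H := circle_average_gauss N mF F0 mw w0.
have E1 : (\int[mu]_(t in D) ((EFin \o v) \_ D) t = \int[mu]_(x in circle) (v x)%:E)%E.
  transitivity (\int[mu]_(t in D) (v t)%:E)%E.
    by apply: eq_integral => x xD; rewrite patchE ifT.
  exact: integral_itv_obnd_cbnd mvD.
have E2 : (\int[mu_gauss N]_z (`|abs z| ^+ n)%:E = (radial_moment N n : R)%:E)%E.
  rewrite [RHS](radial_momentE N0 n); apply: eq_integral => z _.
  by rewrite ger0_norm// normc_ge0.
have E3 : (\int[mu_gauss N]_z (((EFin \o v) \_ D) (Arg (toC z)) * (`|abs z| ^+ n)%:E) =
    \int[mu_gauss N]_z (v (Arg (toC z)) * abs z ^+ n)%:E)%E.
  apply: eq_integral => z _; rewrite patchE mem_set; last first.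
    by rewrite /D/= in_itv/= Arg_bounds.
  by rewrite -EFinM ger0_norm// normc_ge0.
move: H; rewrite E1 E2 E3 => H.
rewrite mulrC EFinM muleA -H -muleA muleC -muleA -EFinM.
by rewrite mulVf ?mule1// gt_eqF.
Qed.

Let measurable_comp_Arg (u : R -> R) : measurable_fun circle u ->
  measurable_fun setT (fun z : R * R => u (Arg (toC z))).
Proof.
move=> mu'; apply: (@measurable_comp _ _ _ _ _ _ (circle : set R) u setT
    (fun z : R * R => Arg (toC z))) => //.
- exact: measurable_circle.
- move=> _ [z _ <-]; rewrite /circle/= in_itv/=.
  by have /andP[a b] := Arg_bounds (toC z); rewrite (ltW a).
- exact: measurable_Arg.
Qed.

Let measurable_polar n (u : R -> R) : measurable_fun circle u ->
  measurable_fun setT (fun z : R * R => u (Arg (toC z)) * abs z ^+ n).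
Proof.
move=> mu'; apply: measurable_funM; first exact: measurable_comp_Arg.
by apply: measurable_funX; exact: measurable_normc_toC.
Qed.

Lemma integrable_polar n (u : R -> R) : mu.-integrable circle (EFin \o u) ->
  (mu_gauss N).-integrable setT (fun z => (u (Arg (toC z)) * abs z ^+ n)%:E : \bar R).
Proof.
move=> iu; have mu' : measurable_fun circle u by apply/measurable_EFinP; exact: measurable_int iu.
apply/integrableP; split; first by apply/measurable_EFinP; exact: measurable_polar.
rewrite (eq_integral (fun z => (`|u (Arg (toC z))| * abs z ^+ n)%:E)); last first.
  by move=> z _; congr EFin; rewrite normrM (ger0_norm (exprn_ge0 _ (normc_ge0 _))).
rewrite (@ge0_polar n (fun x => `|u x|)) //; last exact: measurableT_comp.
rewrite lte_mul_pinfty//.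
- exact: integral_ge0.
- case/integrableP: iu => _ iu; rewrite ge0_fin_numE//; first exact: integral_ge0.
- by rewrite ltry.
Qed.

(** The independence of argument and modulus, extended from nonnegative functions
by splitting u into positive and negative parts. *)
Lemma integral_polar n (u : R -> R) : mu.-integrable circle (EFin \o u) ->
  (\int[mu_gauss N]_z (u (Arg (toC z)) * abs z ^+ n) =
  (2 * pi)^-1 * (\int[mu]_(x in circle) u x) * radial_moment N n)%R.
Proof.
move=> iu; have mu' : measurable_fun circle u by apply/measurable_EFinP; exact: measurable_int iu.
have mC := measurable_circle.
pose up x := Num.max (u x) 0; pose um x := Num.max (- u x) 0.
have up0 x : 0 <= up x by rewrite le_max lexx orbT.
have um0 x : 0 <= um x by rewrite le_max lexx orbT.
have mup : measurable_fun circle up by exact: measurable_maxr.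
have mum : measurable_fun circle um.
  by apply: measurable_maxr => //; exact: measurableT_comp.
have ipn : mu.-integrable circle (EFin \o up).
  apply: le_integrable iu => //; first exact/measurable_EFinP.
  move=> x _ /=; rewrite lee_fin ger0_norm// /up ge_max normr_ge0 andbT ler_norm//.
have imn : mu.-integrable circle (EFin \o um).
  apply: le_integrable iu => //; first exact/measurable_EFinP.
  by move=> x _ /=; rewrite lee_fin ger0_norm// /um ge_max normr_ge0 andbT -normrN ler_norm.
have uE x : u x = up x - um x.
  by rewrite /up /um /Order.max; case: ltP => ?; case: ltP => ?; lra.
under eq_Rintegral do rewrite uE mulrBl.
rewrite RintegralB//; [|exact: (integrable_polar n ipn)|exact: (integrable_polar n imn)].
under [in RHS]eq_Rintegral do rewrite uE.
rewrite RintegralB// /Rintegral !ge0_polar// !fineM//; try exact: integrable_fin_num.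
by rewrite /=; ring.
Qed.

Let polar_form (z : R * R) (i j : nat) : toC z ^+ i * conjc (toC z) ^+ j =
  (abs z ^+ (i + j))%:C * expi (- ((j%:Z - i%:Z)%:~R * Arg (toC z))).
Proof.
rewrite [toC z in LHS]Arg_polar; set r := normc _; set t := Arg _.
have cr : conjc (r%:C * expi t) = r%:C * expi (- t).
  by rewrite /expi cosN sinN; simpc.
rewrite cr !exprMn mulrACA -exprD -rmorphXn !expiMn -expiD; congr (_ * expi _).
by rewrite rmorphB/= -!pmulrn; ring.
Qed.

Let Cintegrable_phase (h : R -> R[i]) (k : int) : Cintegrable mu circle h ->
  Cintegrable mu circle (fun t => expi (- (k%:~R * t)) * h t).
Proof.
move=> ih; have mC := measurable_circle.
have mexp : Cmeasurable circle (fun t => expi (- (k%:~R * t)) : R[i]).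
  have ml : measurable_fun (circle : set R) (fun t : R => - (k%:~R * t)).
    by apply: measurableT_comp => //; apply: measurable_funM.
  split.
    exact: (measurableT_comp (continuous_measurable_fun (@continuous_cos R)) ml).
  exact: (measurableT_comp (continuous_measurable_fun (@continuous_sin R)) ml).
apply: (@Cintegrable_le _ _ R mu circle mC _ (@normc R \o h)); last 2 first.
  exact: integrable_normc.
  by move=> t _; rewrite normcM normc_expi mul1r.
exact: CmeasurableM mexp (Cintegrable_measurable ih).
Qed.

(** In polar form z^i conj(z)^j = |z|^(i + j) e^(- i (j - i) arg z), so the angular
integral is the Fourier coefficient of h at j - i. *)
Lemma Cintegral_polar (h : R -> R[i]) (i j : nat) : Cintegrable mu circle h ->
  Cintegrable (mu_gauss N) setT
    (fun z => h (Arg (toC z)) * (toC z ^+ i * conjc (toC z) ^+ j)) /\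
  Cintegral (mu_gauss N) setT
    (fun z => h (Arg (toC z)) * (toC z ^+ i * conjc (toC z) ^+ j)) =
  fourier h (j%:Z - i%:Z) * (radial_moment N (i + j))%:C.
Proof.
move=> ih; pose g t := expi (- ((j%:Z - i%:Z)%:~R * t)) * h t.
have [g1 g2] : Cintegrable mu circle g by exact: Cintegrable_phase.
have E z : h (Arg (toC z)) * (toC z ^+ i * conjc (toC z) ^+ j) =
    (complex.Re (g (Arg (toC z))) * abs z ^+ (i + j)) +i*
    (complex.Im (g (Arg (toC z))) * abs z ^+ (i + j)).
  rewrite polar_form /g; set e := expi _; set r := _ ^+ _; move: (h _) e r => [a b] [c d] r.
  by apply/eqP; rewrite eq_complex /=; apply/andP; split; apply/eqP; ring.
rewrite (_ : (fun z => _) = fun z => (complex.Re (g (Arg (toC z))) * abs z ^+ (i + j)) +i*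
    (complex.Im (g (Arg (toC z))) * abs z ^+ (i + j))); last exact/funext.
split; first by split; [exact: (integrable_polar (i + j) g1)|exact: (integrable_polar (i + j) g2)].
rewrite /Cintegral/= (integral_polar (i + j) g1) (integral_polar (i + j) g2).
rewrite /fourier /circle_integral -/g /Cintegral.
set a := Rintegral _ _ _; set b := Rintegral _ _ _.
rewrite -[X in X +i* _]/((2 * pi)^-1 * a * _) -[X in _ +i* X]/((2 * pi)^-1 * b * _).
move: a b (radial_moment _ _) => a b r.
by simpc.
Qed.

End polar_integral.

(** * Sequences converging fast in mean square *)

Section fast_L2_limit.
Context d (T : measurableType d) (R : realType).
Variables (mu : {measure set T -> \bar R}) (D : set T) (u : nat -> T -> R).
Hypotheses (mD : measurable D) (mu_ : forall n, measurable_fun D (u n))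
  (u_fast : forall m n, (m <= n)%N ->
    (\int[mu]_(x in D) ((u n x - u m x) ^+ 2)%:E <= ((4 ^+ m)^-1)%:E)%E).

(* By AM-GM |u (n + 1) - u n| <= 2^-n + 2^n (u (n + 1) - u n)^2, and the series of
the last terms has finite integral. *)
Let step n x : R := 2 ^+ n * (u n.+1 x - u n x) ^+ 2.

Let W x : \bar R := (\sum_(n <oo) (step n x)%:E)%E.

Let step0 n x : 0 <= step n x.
Proof. by rewrite /step mulr_ge0 ?sqr_ge0// exprn_ge0. Qed.

Let mstep n : measurable_fun D (step n).
Proof.
by apply: measurable_funM => //; apply: measurable_funX; exact: measurable_funB.
Qed.

Let mW : measurable_fun D W.
Proof.
apply: ge0_emeasurable_sum => [n x _ _|n _]; first by rewrite lee_fin.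
exact/measurable_EFinP.
Qed.

Let geometric_le n : \sum_(0 <= i < n) (2 ^+ i)^-1 <= 2 :> R.
Proof.
suff -> : \sum_(0 <= i < n) (2 ^+ i)^-1 = 2 - 2 * (2 ^+ n)^-1 :> R.
  by rewrite lerBlDr lerDl mulr_ge0// invr_ge0 exprn_ge0.
elim: n => [|n ih]; first by rewrite big_nil expr0 invr1 mulr1 subrr.
rewrite big_nat_recr//= ih exprS; field.
by rewrite expf_neq0.
Qed.

Let W_ae : {ae mu, forall x, D x -> W x \is a fin_num}.
Proof.
apply: (@integrable_ae _ _ _ _ D) => //; apply/integrableP; split => //.
rewrite (eq_integral W); last first.
  by move=> x _; rewrite gee0_abs// nneseries_ge0// => n _ _; rewrite lee_fin.
rewrite integral_nneseries//; last 2 first.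
- by move=> n; exact/measurable_EFinP.
- by move=> n x _; rewrite lee_fin.
apply: (@le_lt_trans _ _ 2%:E); last by rewrite ltry.
apply: lime_le.
  by apply: is_cvg_nneseries => n _ _; apply: integral_ge0 => x _; rewrite lee_fin.
apply: nearW => n; apply: (@le_trans _ _ (\sum_(0 <= i < n) ((2 ^+ i)^-1)%:E)%E).
  apply: lee_sum => i _.
  rewrite (eq_integral (fun x => (2 ^+ i)%:E * ((u i.+1 x - u i x) ^+ 2)%:E)%E)//.
  rewrite ge0_integralZl//; try by [rewrite lee_fin exprn_ge0|move=> x _; rewrite lee_fin sqr_ge0].
    2: by apply/measurable_EFinP; apply: measurable_funX; exact: measurable_funB.
  apply: (@le_trans _ _ ((2 ^+ i)%:E * ((4 ^+ i)^-1)%:E)%E).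
    by rewrite lee_pmul2l// ?lte_fin ?exprn_gt0// u_fast.
  rewrite -EFinM lee_fin (_ : 4 = 2 * 2 :> R); last by ring.
  by rewrite exprMn invfM mulrA divff ?mul1r// expf_neq0.
by rewrite sumEFin lee_fin.
Qed.

Let W_cvg x : W x \is a fin_num -> cvgn (u ^~ x).
Proof.
move=> Wx; pose dx n := u n.+1 x - u n x.
have dx_le n : `|dx n| <= (2 ^+ n)^-1 + step n x.
  have p0 : 0 < 2 ^+ n :> R by rewrite exprn_gt0.
  have -> : step n x = 2 ^+ n * `|dx n| ^+ 2 by rewrite /step /dx -normrX ger0_norm ?sqr_ge0.
  set t := `|dx n|; have t0 : 0 <= t by exact: normr_ge0.
  rewrite -(ler_pM2l p0) mulrDr divff ?gt_eqF// mulrA -expr2 -exprMn.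
  set y := 2 ^+ n * t; have : 0 <= (y - 1) ^+ 2 by exact: sqr_ge0.
  have y0 : 0 <= y by rewrite mulr_ge0// ltW.
  by rewrite sqrrB1; lra.
have cd : cvgn (series dx).
  apply: normed_cvg; apply: nondecreasing_is_cvgn.
    by apply: nondecreasing_series => n _ _; exact: normr_ge0.
  exists (2 + fine (W x)) => _ [n _ <-] /=.
  apply: (@le_trans _ _ (\sum_(0 <= i < n) ((2 ^+ i)^-1 + step i x))).
    by rewrite seriesEnat; apply: ler_sum => i _; exact: dx_le.
  rewrite big_split/= lerD// -lee_fin fineK// -sumEFin.
  by apply: nneseries_lim_ge => i _ _; rewrite lee_fin.
have -> : u ^~ x = (fun n => u 0%N x + series dx n).
  apply/funext => n; have := telescopeK (u ^~ x) => /(congr1 (fun f => f n)) /= E.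
  by rewrite (_ : series dx n = u n x - u 0%N x)// addrC subrK.
by apply: is_cvgD => //; exact: is_cvg_cst.
Qed.

Let E := D `&` [set x | W x \is a fin_num].

Let mE : measurable E. Proof. exact: emeasurable_fin_num. Qed.

(** Where W is finite the increments of u are absolutely summable, and W is finite
almost everywhere because its integral is. Off this set the sequence is replaced
by 0, which makes the pointwise limit total; Fatou's lemma then gives the rate. *)
Lemma fast_L2_limit : exists v : T -> R, measurable_fun D v /\
  forall m, (\int[mu]_(x in D) ((v x - u m x) ^+ 2)%:E <= ((4 ^+ m)^-1)%:E)%E.
Proof.
pose w n : T -> R := (u n) \_ E.
have w_cvg x : cvgn (w ^~ x).
  rewrite /w; under eq_fun do rewrite patchE.
  have [xE|xE] := boolP (x \in E); last exact: is_cvg_cst.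
  by apply: W_cvg; move: xE; rewrite inE => -[].
pose v x : R := limn (w ^~ x).
have mw n : measurable_fun D (w n).
  apply: (measurable_restrict (u n) mE mD).1; apply: measurable_funS (mu_ n) => //.
have mv : measurable_fun D v.
  by apply: (measurable_fun_cvg mw) => x _; exact: w_cvg.
have uw n : {ae mu, forall x, D x -> u n x = w n x}.
  apply: filterS W_ae => x Wx Dx; rewrite /w patchE mem_set//; split => //.
  exact: Wx.
have msq (f g : T -> R) : measurable_fun D f -> measurable_fun D g ->
    measurable_fun D (fun x => ((f x - g x) ^+ 2)%:E).
  by move=> mf mg; apply/measurable_EFinP; apply: measurable_funX; exact: measurable_funB.
exists v; split => // m.
have -> : (\int[mu]_(x in D) ((v x - u m x) ^+ 2)%:E =
    \int[mu]_(x in D) ((v x - w m x) ^+ 2)%:E)%E.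
  apply: ge0_ae_eq_integral => //; [exact: msq|exact: msq|..].
  - by move=> x _; rewrite lee_fin sqr_ge0.
  - by move=> x _; rewrite lee_fin sqr_ge0.
  - by apply: filterS (uw m) => x + Dx => /(_ Dx) ->.
have vE x : ((v x - w m x) ^+ 2)%:E = limn_einf (fun n => ((w n x - w m x) ^+ 2)%:E).
  have c : ((w n x - w m x) ^+ 2)%:E @[n --> \oo] --> ((v x - w m x) ^+ 2)%:E.
    apply: cvg_EFin; first exact: nearW.
    rewrite expr2; under eq_fun do rewrite /= expr2.
    by apply: cvgM; apply: cvgB; [exact: w_cvg|exact: cvg_cst|exact: w_cvg|exact: cvg_cst].
  by rewrite limn_einf_lim; apply/esym/cvg_lim => //; exact: cvg_einfs.
under eq_integral do rewrite vE.
apply: le_trans (fatou _ _ _ _) _ => //.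
- by move=> n; exact: msq.
- by move=> n x _; rewrite lee_fin sqr_ge0.
rewrite limn_einf_lim; apply: lime_le; first exact: is_cvg_einfs.
apply: nearW => n; pose N := maxn n m.
apply: (@le_trans _ _ (\int[mu]_(x in D) ((w N x - w m x) ^+ 2)%:E)%E).
  by apply: ereal_inf_lbound; exists N => //=; exact: leq_maxl.
apply: le_trans (u_fast (leq_maxr n m)); apply: ge0_le_integral => //.
- by move=> x _; rewrite lee_fin sqr_ge0.
- exact: msq.
- exact: msq.
move=> x _; rewrite lee_fin /w !patchE.
by case: ifP => _//; rewrite subrr expr0n sqr_ge0.
Qed.

End fast_L2_limit.

(** * Calculus on the circle *)

Section circle_calculus.
Context {R : realType}.
Local Notation mu := (@lebesgue_measure R).

Lemma lebesgue_measure_circle : mu circle = (2 * pi)%:E.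
Proof.
have p0 := pi_gt0 R.
rewrite /circle lebesgue_measure_itv/= lte_fin gtrN//.
by rewrite -EFinB opprK mulr_natl mulr2n.
Qed.

(** The boundary terms cancel by periodicity. *)
Lemma circle_FTC (F f : R -> R) : (forall t : R, is_derive t 1 F (f t)) -> continuous f ->
  F pi = F (- pi) -> (\int[mu]_(t in circle) f t = 0)%R.
Proof.
move=> Ff cf Fpi; have p0 := pi_gt0 R.
have cF : continuous F.
  move=> t; apply/differentiable_continuous/derivable1_diffP.
  by have [] := Ff t.
rewrite /Rintegral /circle (@continuous_FTC2 _ f F).
- by rewrite Fpi subee.
- by rewrite gtrN.
- exact: continuous_subspaceT.
- split.
  + by move=> t _; have [] := Ff t.
  + by apply: cvg_at_right_filter; exact: cF.
  + by apply: cvg_at_left_filter; exact: cF.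
- by move=> t _; rewrite derive1E; have [_ ->] := Ff t.
Qed.

Lemma integrable_continuous_circle (f : R -> R) : continuous f ->
  mu.-integrable circle (EFin \o f).
Proof.
move=> cf; apply: continuous_compact_integrable; first exact: segment_compact.
exact: continuous_subspaceT.
Qed.

Lemma circle_integration_by_parts (u v du dv : R -> R) :
  (forall t : R, is_derive t 1 u (du t)) -> (forall t : R, is_derive t 1 v (dv t)) ->
  continuous du -> continuous dv -> u pi * v pi = u (- pi) * v (- pi) ->
  (\int[mu]_(t in circle) (u t * dv t) = - \int[mu]_(t in circle) (du t * v t))%R.
Proof.
move=> u' v' cdu cdv uv.
have cu : continuous u.
  by move=> t; apply/differentiable_continuous/derivable1_diffP; have [] := u' t.
have cv : continuous v.
  by move=> t; apply/differentiable_continuous/derivable1_diffP; have [] := v' t.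
have c1 : continuous (fun t => u t * dv t) by move=> t; apply: cvgM; [exact: cu|exact: cdv].
have c2 : continuous (fun t => du t * v t) by move=> t; apply: cvgM; [exact: cdu|exact: cv].
apply/eqP; rewrite -addr_eq0 -RintegralD//; last 3 first.
- exact: measurable_circle.
- exact: integrable_continuous_circle.
- exact: integrable_continuous_circle.
apply/eqP; apply: (@circle_FTC (fun t => u t * v t)) => //.
- move=> t; apply: is_derive_eq; rewrite /GRing.scale/=.
  by rewrite [v t * _]mulrC.
- by move=> t; apply: cvgD; [exact: c1|exact: c2].
Qed.

Definition wave (k : int) (t : R) : R[i] := expi (k%:~R * t).

Lemma wave0 t : wave 0 t = 1.
Proof. by rewrite /wave mul0r expi0. Qed.

Lemma waveD k l t : wave (k + l) t = wave k t * wave l t.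
Proof. by rewrite /wave rmorphD/= mulrDl expiD. Qed.

Lemma conj_wave k t : conjc (wave k t) = wave (- k) t.
Proof. by rewrite /wave conj_expi rmorphN/= mulNr. Qed.

Lemma normc_wave k t : normc (wave k t) = 1.
Proof. exact: normc_expi. Qed.

Lemma is_derive_cos_freq (a t : R) : is_derive t 1 (fun t => cos (a * t)) (- (a * sin (a * t))).
Proof.
apply: is_derive_eq; rewrite /GRing.scale/=; ring.
Qed.

Lemma is_derive_sin_freq (a t : R) : is_derive t 1 (fun t => sin (a * t)) (a * cos (a * t)).
Proof.
apply: is_derive_eq; rewrite /GRing.scale/=; ring.
Qed.

Lemma continuous_cos_freq (a : R) : continuous (fun t => cos (a * t)).
Proof.
by move=> t; apply/differentiable_continuous/derivable1_diffP; have [] := is_derive_cos_freq a t.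
Qed.

Lemma continuous_sin_freq (a : R) : continuous (fun t => sin (a * t)).
Proof.
by move=> t; apply/differentiable_continuous/derivable1_diffP; have [] := is_derive_sin_freq a t.
Qed.

Lemma sin_int_pi (k : int) : sin (k%:~R * pi) = 0 :> R.
Proof.
have H (n : nat) : sin (n%:R * pi) = 0 :> R.
  elim: n => [|n ih]; first by rewrite mul0r sin0.
  by rewrite mulrS mulrDl mul1r addrC sinDpi ih oppr0.
case: k => n; first exact: H.
by rewrite NegzE mulrNz mulNr sinN -pmulrn H oppr0.
Qed.

Lemma measurable_wave k (D : set R) : Cmeasurable D (wave k).
Proof.
split.
- apply: measurable_funTS; apply: continuous_measurable_fun; exact: continuous_cos_freq.
- apply: measurable_funTS; apply: continuous_measurable_fun; exact: continuous_sin_freq.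
Qed.

Lemma Cintegrable_wave k : Cintegrable mu circle (wave k).
Proof.
split; apply: integrable_continuous_circle.
- exact: continuous_cos_freq.
- exact: continuous_sin_freq.
Qed.

Lemma circle_integral_wave (k : int) : circle_integral (wave k) = (k == 0)%:R.
Proof.
rewrite /circle_integral /Cintegral; have [->|k0] := eqVneq k 0.
  rewrite (_ : (\int[mu]_(x in circle) complex.Re (wave 0 x) = 2 * pi)%R); last first.
    under eq_Rintegral do rewrite wave0.
    by rewrite Rintegral_cst ?mul1r; [rewrite [X in fine X]lebesgue_measure_circle|exact: measurable_circle].
  rewrite (_ : (\int[mu]_(x in circle) complex.Im (wave 0 x) = 0)%R); last first.
    under eq_Rintegral do rewrite wave0.
    by rewrite Rintegral_cst ?mul0r//; exact: measurable_circle.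
  rewrite -[_ +i* _]/((2 * pi)%:C) -rmorphM mulVf// gt_eqF// mulr_gt0// pi_gt0//.
have kR : k%:~R != 0 :> R by rewrite intr_eq0.
rewrite (_ : (\int[mu]_(x in circle) complex.Re (wave k x) = 0)%R); last first.
  apply: (@circle_FTC (fun t => k%:~R^-1 * sin (k%:~R * t))).
  - move=> t; have H := is_derive_sin_freq k%:~R t.
    apply: is_derive_eq; rewrite /GRing.scale/=.
    by rewrite mulrA mulVf// mul1r.
  - exact: continuous_cos_freq.
  - by rewrite mulrN sinN sin_int_pi oppr0.
rewrite (_ : (\int[mu]_(x in circle) complex.Im (wave k x) = 0)%R) ?mulr0//.
apply: (@circle_FTC (fun t => - k%:~R^-1 * cos (k%:~R * t))).
- move=> t; have H := is_derive_cos_freq k%:~R t.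
  apply: is_derive_eq; rewrite /GRing.scale/=.
  by rewrite mulrNN mulrA mulVf// mul1r.
- exact: continuous_sin_freq.
- by rewrite mulrN cosN.
Qed.

End circle_calculus.

(** * Polynomial approximation of a step *)

Section step_polynomials.
Context {R : realType}.

Lemma bernoulli_le (x : R) m : 0 <= x <= 1 -> 1 - m%:R * x <= (1 - x) ^+ m.
Proof.
move=> /andP[x0 x1]; elim: m => [|m ih]; first by rewrite mul0r subr0 expr0.
rewrite exprS; apply: (@le_trans _ _ ((1 - x) * (1 - m%:R * x))); last first.
  by rewrite ler_wpM2l// subr_ge0.
rewrite mulrS; have : 0 <= m%:R * x ^+ 2 by rewrite mulr_ge0// sqr_ge0.
by lra.
Qed.

Lemma bernoulli_ge (x : R) m : 0 <= x -> 1 + m%:R * x <= (1 + x) ^+ m.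
Proof.
move=> x0; elim: m => [|m ih]; first by rewrite mul0r addr0 expr0.
rewrite exprS; apply: (@le_trans _ _ ((1 + x) * (1 + m%:R * x))); last first.
  by rewrite ler_wpM2l// addr_ge0.
rewrite mulrS; have : 0 <= m%:R * x ^+ 2 by rewrite mulr_ge0// sqr_ge0.
by lra.
Qed.

(** For 0 <= u <= 1 these polynomials tend to 1 below 1/2 and to 0 above 1/2, by
Bernoulli's inequality; they approximate a step without Weierstrass' theorem. *)
Definition step_poly n (u : R) : R := (1 - u ^+ n) ^+ (2 ^ n).

Lemma step_poly_itv n u : 0 <= u <= 1 -> 0 <= step_poly n u <= 1.
Proof.
move=> /andP[u0 u1]; have un : 0 <= u ^+ n <= 1 by rewrite exprn_ge0//= exprn_ile1.
move: un => /andP[a b].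
have c : 0 <= 1 - u ^+ n by rewrite subr_ge0.
by rewrite /step_poly exprn_ge0//= exprn_ile1// lerBlDr lerDl.
Qed.

Lemma step_poly_cvg1 u : 0 <= u -> u < 2^-1 -> step_poly n u @[n --> \oo] --> (1 : R).
Proof.
move=> u0 u2; have u1 : u <= 1 by rewrite (le_trans (ltW u2))// invf_le1// ler1n.
apply: (@squeeze_cvgr _ _ _ _ (fun n => 1 - (2 * u) ^+ n) (fun=> 1)).
- apply: nearW => n; have u01 : 0 <= u <= 1 by rewrite u0.
  have /andP[_ ->] := step_poly_itv n u01.
  rewrite andbT exprMn -natrX; apply: bernoulli_le.
  by rewrite exprn_ge0//= exprn_ile1.
- apply: cvg_to_eq (subr0 1); apply: cvgB; first exact: cvg_cst.
  apply: cvg_expr; rewrite ger0_norm ?mulr_ge0//.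
  by rewrite mulrC -ltr_pdivlMr// div1r.
- exact: cvg_cst.
Qed.

Lemma step_poly_cvg0 u : 2^-1 < u -> u <= 1 -> step_poly n u @[n --> \oo] --> (0 : R).
Proof.
move=> u2 u1; have u0 : 0 < u by rewrite (lt_trans _ u2)// invr_gt0.
have uu : 1 < 2 * u by rewrite mulrC -ltr_pdivrMr// div1r.
apply: (@squeeze_cvgr _ _ _ _ (fun=> 0) (fun n => (2 * u)^-1 ^+ n)).
- apply: nearW => n; have u01 : 0 <= u <= 1 by rewrite ltW.
  have /andP[s0 s1] := step_poly_itv n u01; rewrite s0.
  have x0 : 0 <= u ^+ n by rewrite exprn_ge0// ltW.
  have x1 : u ^+ n <= 1 by rewrite exprn_ile1// ltW.
  rewrite andTb exprVn.
  have b0 : 0 < (2 * u) ^+ n by rewrite exprn_gt0// mulr_gt0.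
  rewrite -[leRHS]mul1r ler_pdivlMr//.
  apply: (@le_trans _ _ (step_poly n u * (1 + u ^+ n) ^+ (2 ^ n))).
    rewrite ler_wpM2l//.
    rewrite (le_trans _ (bernoulli_ge _ x0))// exprMn natrX.
    by rewrite lerDr.
  rewrite /step_poly -exprMn exprn_ile1//.
    by rewrite mulr_ge0// ?subr_ge0// addr_ge0.
  by rewrite -subr_sqr expr1n lerBlDr lerDl sqr_ge0.
- exact: cvg_cst.
- apply: cvg_expr; rewrite ger0_norm ?invr_ge0 ?mulr_ge0 ?(ltW u0)//.
  by rewrite invf_lt1// mulr_gt0.
Qed.

End step_polynomials.

Section circle_integral_linear.
Context {R : realType}.
Local Notation mu := (@lebesgue_measure R).
Local Notation mC := (@measurable_circle R).
Implicit Types f g p : R -> R[i].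

Lemma circle_integralD f g : Cintegrable mu circle f -> Cintegrable mu circle g ->
  circle_integral (fun t => f t + g t) = circle_integral f + circle_integral g.
Proof. by move=> ? ?; rewrite /circle_integral (@CintegralD _ _ R mu circle mC)// mulrDr. Qed.

Lemma circle_integralB f g : Cintegrable mu circle f -> Cintegrable mu circle g ->
  circle_integral (fun t => f t - g t) = circle_integral f - circle_integral g.
Proof. by move=> ? ?; rewrite /circle_integral (@CintegralB _ _ R mu circle mC)// mulrBr. Qed.

Lemma circle_integralZ c f : Cintegrable mu circle f ->
  circle_integral (fun t => c * f t) = c * circle_integral f.
Proof. by move=> ?; rewrite /circle_integral (@CintegralZ _ _ R mu circle mC)// mulrCA. Qed.

Lemma circle_integral_sum (I : Type) (r : seq I) (F : I -> R -> R[i]) :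
  (forall i, Cintegrable mu circle (F i)) ->
  circle_integral (fun t => \sum_(i <- r) F i t) = \sum_(i <- r) circle_integral (F i).
Proof. by move=> ?; rewrite /circle_integral (@Cintegral_sum _ _ R mu circle mC)// mulr_sumr. Qed.

Lemma eq_circle_integral f g : (forall t, f t = g t) ->
  circle_integral f = circle_integral g.
Proof. by move=> fg; congr circle_integral; exact/funext. Qed.

Lemma fourierE f k : fourier f k = circle_integral (fun t => wave (- k) t * f t).
Proof.
by rewrite /fourier; apply: eq_circle_integral => t; rewrite /wave rmorphN/= mulNr.
Qed.

Lemma Cintegrable_bounded_mul p f (M : R) : Cmeasurable circle p ->
  (forall t, circle t -> normc (p t) <= M) -> Cintegrable mu circle f ->
  Cintegrable mu circle (fun t => p t * f t).
Proof.
move=> mp pM iF; have iN := @integrable_normc _ _ R mu circle mC _ iF.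
apply: (@Cintegrable_le _ _ R mu circle mC _ (fun t => M * normc (f t))).
- exact: CmeasurableM mp (Cintegrable_measurable iF).
- exact: (@integrableZl _ _ R mu circle mC M _ iN).
- by move=> t ct; rewrite normcM ler_wpM2r ?normc_ge0// pM.
Qed.

Lemma Cintegrable_wave_mul k f : Cintegrable mu circle f ->
  Cintegrable mu circle (fun t => wave k t * f t).
Proof.
apply: (@Cintegrable_bounded_mul _ _ 1); first exact: measurable_wave.
by move=> t _; rewrite normc_wave.
Qed.

Lemma fourierD f g k : Cintegrable mu circle f -> Cintegrable mu circle g ->
  fourier (fun t => f t + g t) k = fourier f k + fourier g k.
Proof.
move=> fi gi; rewrite !fourierE -circle_integralD; [|exact: Cintegrable_wave_mul..].
by apply: eq_circle_integral => t; rewrite mulrDr.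
Qed.

Lemma fourierB f g k : Cintegrable mu circle f -> Cintegrable mu circle g ->
  fourier (fun t => f t - g t) k = fourier f k - fourier g k.
Proof.
move=> fi gi; rewrite !fourierE -circle_integralB; [|exact: Cintegrable_wave_mul..].
by apply: eq_circle_integral => t; rewrite mulrBr.
Qed.

Lemma fourierZ c f k : Cintegrable mu circle f ->
  fourier (fun t => c * f t) k = c * fourier f k.
Proof.
move=> fi; rewrite !fourierE -circle_integralZ; [|exact: Cintegrable_wave_mul].
by apply: eq_circle_integral => t; rewrite mulrCA.
Qed.

Lemma fourier_wave_mul j f k : fourier (fun t => wave j t * f t) k = fourier f (k - j).
Proof.
rewrite !fourierE; apply: eq_circle_integral => t.
by rewrite mulrA -waveD opprB addrC.
Qed.

Lemma fourier_wave j k : fourier (wave j : R -> R[i]) k = (j == k)%:R.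
Proof.
rewrite fourierE -[RHS](_ : ((j - k : int) == 0)%:R = _); last by rewrite subr_eq0.
by rewrite -circle_integral_wave; apply: eq_circle_integral => t; rewrite -waveD addrC.
Qed.

Lemma fourier_one k : fourier (fun=> 1 : R[i]) k = (k == 0 :> int)%:R.
Proof.
rewrite eq_sym -(fourier_wave 0 k) !fourierE.
by apply: eq_circle_integral => t; rewrite wave0.
Qed.

End circle_integral_linear.

(** * Uniqueness of Fourier coefficients *)

Section fourier_uniqueness.
Context {R : realType}.
Local Notation mu := (@lebesgue_measure R).
Local Notation mC := (@measurable_circle R).
Implicit Types f g p q : R -> R[i].

Definition zero_fourier g : Prop :=
  Cintegrable mu circle g /\ forall k, fourier g k = 0.

(** The multipliers p form an algebra containing all trigonometric polynomials,
which is what lets an arbitrary polynomial in a cosine be tested against g. *)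
Definition preserves_zero_fourier p : Prop :=
  forall g, zero_fourier g -> zero_fourier (fun t => p t * g t).

Local Notation pzf := preserves_zero_fourier.

Let pzf_cst c : pzf (fun=> c).
Proof.
move=> g [ig g0]; split; first exact: (@CintegrableZ _ _ R mu circle mC).
by move=> k; rewrite fourierZ// g0 mulr0.
Qed.

Let pzf_wave j : pzf (wave j).
Proof.
move=> g [ig g0]; split; first exact: Cintegrable_wave_mul.
by move=> k; rewrite fourier_wave_mul g0.
Qed.

Let pzfD p q : pzf p -> pzf q -> pzf (fun t => p t + q t).
Proof.
move=> hp hq g zg; have [p1 p2] := hp g zg; have [q1 q2] := hq g zg.
rewrite (_ : (fun t => _) = fun t => p t * g t + q t * g t); last first.
  by apply/funext => t; rewrite mulrDl.
split; first exact: (@CintegrableD _ _ R mu circle mC).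
by move=> k; rewrite fourierD// p2 q2 addr0.
Qed.

Let pzfM p q : pzf p -> pzf q -> pzf (fun t => p t * q t).
Proof.
move=> hp hq g zg; have := hp _ (hq g zg).
by rewrite (_ : (fun t => _) = fun t => p t * q t * g t)//; apply/funext => t; rewrite mulrA.
Qed.

Let pzfX p n : pzf p -> pzf (fun t => p t ^+ n).
Proof.
move=> hp; elim: n => [|n ih]; first exact: pzf_cst.
rewrite (_ : (fun t => _) = fun t => p t * p t ^+ n); first exact: pzfM.
by apply/funext => t; rewrite exprS.
Qed.

(* Equal to 1/2 at the endpoints of the arc with centre c and half-width d < pi,
   above 1/2 inside the arc and below 1/2 on the rest of the circle. *)
Let bump (c d t : R) : R := 2^-1 + (cos (t - c) - cos d) / 4.

Let bump_itv c d t : 0 <= bump c d t <= 1.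
Proof.
have := cos_geN1 (t - c); have := cos_le1 (t - c).
have := cos_geN1 d; have := cos_le1 d => a b e f.
by rewrite /bump; apply/andP; split; lra.
Qed.

Let pzf_bump c d : pzf (fun t => (bump c d t)%:C).
Proof.
rewrite (_ : (fun t => _) = fun t => (2^-1 - cos d / 4)%:C +
    ((8^-1)%:C * expi (- c) * wave 1 t + (8^-1)%:C * expi c * wave (-1) t)).
  apply: pzfD; first exact: pzf_cst.
  by apply: pzfD; apply: pzfM; [exact: pzf_cst|exact: pzf_wave|exact: pzf_cst|exact: pzf_wave].
apply/funext => t; rewrite /bump /wave mul1r rmorphN/= mulN1r -!mulrA -!expiD.
rewrite -(opprB t c) [- c + t]addrC.
rewrite /expi cosN sinN; apply/eqP; rewrite eq_complex /=.
by apply/andP; split; apply/eqP; field.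
Qed.

Let pzf_step c d n : pzf (fun t => (step_poly n (bump c d t))%:C).
Proof.
rewrite (_ : (fun t => _) = fun t => (1 + (-1) * (bump c d t)%:C ^+ n) ^+ (2 ^ n)).
  apply: pzfX; apply: pzfD; first exact: pzf_cst.
  by apply: pzfM; [exact: pzf_cst|apply: pzfX; exact: pzf_bump].
by apply/funext => t; rewrite /step_poly rmorphXn rmorphB rmorphXn rmorph1 mulN1r.
Qed.

Let twopi_neq0 : (2 * pi)^-1%:C != 0 :> R[i].
Proof. by rewrite fmorph_eq0 invr_eq0 gt_eqF// mulr_gt0// pi_gt0. Qed.

Let zero_fourier_integral g : zero_fourier g -> Cintegral mu circle g = 0.
Proof.
move=> [ig g0]; have := g0 0; rewrite fourierE /circle_integral => /eqP.
rewrite mulf_eq0 (negbTE twopi_neq0)/= => /eqP <-.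
by apply: eq_Cintegral => t _; rewrite oppr0 wave0 mul1r.
Qed.

Section arc.
Variables (g : R -> R[i]) (gr : R -> R).
Hypotheses (igr : mu.-integrable circle (EFin \o gr))
  (gr0 : (\int[mu]_(t in circle) gr t = 0)%R)
  (step_gr0 : forall c d n, (\int[mu]_(t in circle) (step_poly n (bump c d t) * gr t) = 0)%R).

Let mgr : measurable_fun circle gr.
Proof. by apply/measurable_EFinP; exact: measurable_int igr. Qed.

Let mbump c d : measurable_fun circle (bump c d).
Proof.
apply: measurable_funD => //; apply: measurable_funM => //; apply: measurable_funB => //.
apply: (measurableT_comp (continuous_measurable_fun (@continuous_cos R))).
exact: measurable_funB.
Qed.

Let cos_lt (d s : R) : 0 < d -> d < pi -> d < `|s| -> `|s| < 2 * pi - d -> cos s < cos d.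
Proof.
move=> d0 dpi ds s2; have -> : cos s = cos `|s| by case: (ger0P s) => // _; rewrite cosN.
have [sp|sp] := leP `|s| pi.
  by rewrite ltr_cos// in_itv/= ?normr_ge0 ?(ltW d0) ?(ltW dpi).
have -> : cos `|s| = cos (2 * pi - `|s|).
  by rewrite -[LHS]cosN mulr_natl [in RHS]addrC cosD2pi.
rewrite ltr_cos ?in_itv/=; [|apply/andP; split; lra|apply/andP; split; lra].
by lra.
Qed.

(* The complement of the arc [- pi, x] is tested rather than the arc itself, since
step_poly tends to 0 where bump exceeds 1/2; dominated convergence then gives the
integral over the complement, and the total integral vanishes. *)
Let arc_integral (x : R) : - pi < x < pi -> (\int[mu]_(t in `[- pi, x]) gr t = 0)%R.
Proof.
move=> /andP[x1 x2]; have p0 := pi_gt0 R.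
pose c : R := (x - pi) / 2; pose d : R := (x + pi) / 2.
have d0 : 0 < d by rewrite /d; lra.
have dpi : d < pi by rewrite /d; lra.
pose A : set R := `[- pi, x]%classic.
pose h : R -> R := gr \_ (~` A).
have sub : A `<=` circle.
  move=> t; rewrite /A /circle /= !in_itv/= => /andP[a b]; rewrite a/=.
  by rewrite (le_trans b)// ltW.
have mA : measurable A by exact: measurable_itv.
have lim t : circle t -> t != - pi -> t != x -> t != pi ->
    (step_poly n (bump c d t) * gr t) @[n --> \oo] --> (h t : R).
  rewrite /circle/= in_itv/= => /andP[t1 t2] tp tx tpi.
  have {}t1 : - pi < t by rewrite lt_neqAle eq_sym tp.
  have {}t2 : t < pi by rewrite lt_neqAle tpi.
  have /andP[u0 u1] := bump_itv c d t.
  rewrite /h patchE in_setC if_neg; case: ifPn => tA.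
    apply: cvg_to_eq (mul0r (gr t)); apply: cvgMl; apply: step_poly_cvg0 => //.
    move: tA; rewrite inE /A/= in_itv/= => /andP[_ tlx].
    have {}tlx : t < x by rewrite lt_neqAle tx.
    suff : cos d < cos (t - c) by rewrite /bump; lra.
    have -> : cos (t - c) = cos `|t - c| by case: (ger0P (t - c)) => // _; rewrite cosN.
    rewrite ltr_cos ?in_itv/= ?normr_ge0 ?(ltW d0) ?(ltW dpi)//=.
      by rewrite ltr_norml /c /d; apply/andP; split; lra.
    by rewrite ler_norml /c; apply/andP; split; lra.
  apply: cvg_to_eq (mul1r (gr t)); apply: cvgMl; apply: step_poly_cvg1 => //.
  have xt : x < t.
    by move: tA; rewrite notin_setE /A/= in_itv/= (ltW t1)/= => /negP; rewrite -ltNge.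
  suff : cos (t - c) < cos d by rewrite /bump; lra.
  apply: cos_lt => //; rewrite ger0_norm; rewrite /c /d; lra.
have msg n : measurable_fun circle (fun t => step_poly n (bump c d t) * gr t).
  apply: measurable_funM => //; apply: measurable_funX; apply: measurable_funB => //.
  exact: measurable_funX.
have mh : measurable_fun circle h.
  apply: (measurable_restrict gr (measurableC mA) mC).1.
  by apply: measurable_funS mgr; [exact: mC|exact: subIsetl].
have exc : {ae mu, forall t, circle t -> (step_poly n (bump c d t) * gr t)%:E @[n --> \oo] --> (h t)%:E}.
  exists [set - pi; x; pi]; split.
  - by apply: measurableU; [apply: measurableU|]; exact: measurable_set1.
  - by rewrite null_set_setU// ?null_set_setU//; try exact: lebesgue_measure_set1;
      try exact: measurable_set1; apply: measurableU; exact: measurable_set1.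
  move=> t /= /not_implyP[ct]; apply: contra_notP => /not_orP[/not_orP[/eqP a /eqP b] /eqP e].
  by apply: cvg_EFin; [exact: nearW|exact: lim].
have dom : {ae mu, forall t n, circle t ->
    (`|(step_poly n (bump c d t) * gr t)%:E| <= `|gr t|%:E)%E}.
  apply: aeW => t n _; rewrite lee_fin normrM.
  have /andP[s0 s1] := step_poly_itv n (bump_itv c d t).
  by rewrite ger0_norm// ler_piMl.
have := @dominated_convergence _ _ R mu circle mC _ _ _
  (fun n => (measurable_EFinP _ _).2 (msg n)) ((measurable_EFinP _ _).2 mh) exc
  (integrable_norm igr) dom.
move=> [ih _ cvgI].
have h0 : (\int[mu]_(t in circle) h t = 0)%R.
  rewrite /Rintegral -(cvg_lim _ cvgI)//.
  rewrite (_ : (fun n => _) = fun=> 0%E); first by rewrite lim_cst.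
  apply/funext => n; apply/eqP; rewrite -(@fineK _ (integral _ _ _)); last first.
    apply: integrable_fin_num; first exact: mC.
    apply: le_integrable igr; [exact: mC|by apply/measurable_EFinP; exact: msg|].
    move=> t _ /=; rewrite lee_fin normrM.
    have /andP[s0 s1] := step_poly_itv n (bump_itv c d t).
    by rewrite ger0_norm// ler_piMl.
  by rewrite -[X in X%:E]/(\int[mu]_(t in circle) (step_poly n (bump c d t) * gr t))%R step_gr0.
have split_gr : (\int[mu]_(t in circle) gr t =
    \int[mu]_(t in circle) (gr \_ A) t + \int[mu]_(t in circle) h t)%R.
  rewrite -RintegralD//.
  - apply: eq_Rintegral => t _; rewrite /h !patchE in_setC if_neg.
    by case: ifP => _; rewrite ?addr0 ?add0r.
  - exact: mC.
  - rewrite (_ : EFin \o (gr \_ A) = (EFin \o gr) \_ A); last first.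
      by apply/funext => t /=; rewrite !patchE; case: ifP.
    apply: (@integrable_restrict _ _ R mu A mA circle mC (EFin \o gr)).1.
    by apply: integrableS igr; [exact: mC|apply: measurableI => //; exact: mC|exact: subIsetl].
move: split_gr; rewrite gr0 h0 addr0 => /esym.
rewrite -Rintegral_mkcondr (_ : circle `&` A = A) //.
exact/setIidr.
Qed.

(** The function whose integral from - pi to x is zero for all x has, by Lebesgue
differentiation, the derivative of 0 almost everywhere. *)
Lemma arcs_ae_zero : {ae mu, forall t, circle t -> gr t = 0}.
Proof.
have p0 := pi_gt0 R.
pose f := gr \_ circle.
have if' : mu.-integrable setT (EFin \o f).
  rewrite (_ : EFin \o f = (EFin \o gr) \_ circle); last first.
    by apply/funext => t /=; rewrite /f !patchE; case: ifP.
  by apply/(integrable_mkcond _ _).1 => //; exact: mC.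
have lf : locally_integrable setT f by apply: open_integrable_locally => //; exact: openT.
have intf y : mu.-integrable [set` Interval (BLeft (- pi)) (BRight y)] (EFin \o f).
  by apply: integrableS if'.
have ftc := FTC1 intf lf.
have ends : mu.-negligible [set - pi; pi : R].
  exists [set - pi; pi]; split => //.
    by apply: measurableU; exact: measurable_set1.
  by rewrite null_set_setU//; try exact: lebesgue_measure_set1; exact: measurable_set1.
have {}ends : {ae mu, forall t, t <> - pi /\ t <> pi}.
  apply: (negligibleS _ ends) => t /= /not_andP[/contrapT ->|/contrapT ->]; [by left|by right].
apply: (@filterS2 _ _ (ae_filter_ringOfSetsType mu) _ _ _ _ ftc ends) => t ft [tn tp]; rewrite /circle/= in_itv/= => /andP[t1 t2].
have {}t1 : - pi < t by rewrite lt_neqAle t1 andbT; apply/eqP => /esym.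
have {}t2 : t < pi by rewrite lt_neqAle t2 andbT; apply/eqP.
have [|_ F't] := ft; first exact: t1.
have <- : f t = gr t by rewrite /f patchE mem_set// /circle/= in_itv/= !ltW.
rewrite -F't derive1E.
rewrite (@near_eq_derive _ _ _ _ (cst 0)); first by rewrite derive_cst.
near=> y.
have y12 : - pi < y < pi.
  apply/andP; split; near: y; [exact: lt_nbhsr|exact: lt_nbhsl].
rewrite -(arc_integral y12); apply: eq_Rintegral => s; rewrite inE/= in_itv/= => /andP[s1 s2].
rewrite /f patchE mem_set// /circle/= in_itv/= s1/= (le_trans s2)//.
by case/andP: y12 => _ /ltW.
Unshelve. all: by end_near. Qed.

End arc.

(** Vanishing Fourier coefficients kill every trigonometric polynomial, hence the
polynomials step_poly in a shifted cosine, hence all integrals over arcs. Only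
integrability is assumed of g, so that Parseval's identity becomes available for
functions not known beforehand to be square-integrable. *)
Theorem zero_fourier_ae g : zero_fourier g -> {ae mu, forall t, circle t -> g t = 0}.
Proof.
move=> zg; have [[g1 g2] _] := zg.
have /eqP := zero_fourier_integral zg; rewrite /Cintegral eq_complex/= => /andP[/eqP r0 /eqP i0].
have S c d n : Cintegral mu circle (fun t => (step_poly n (bump c d t))%:C * g t) = 0.
  by apply: zero_fourier_integral; exact: pzf_step.
have Sr c d n : (\int[mu]_(t in circle) (step_poly n (bump c d t) * complex.Re (g t)) = 0)%R.
  have /eqP := S c d n; rewrite /Cintegral eq_complex => /andP[/eqP + _] => /= <-.
  by apply: eq_Rintegral => t _; rewrite Re_mul /= mul0r subr0.
have Si c d n : (\int[mu]_(t in circle) (step_poly n (bump c d t) * complex.Im (g t)) = 0)%R.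
  have /eqP := S c d n; rewrite /Cintegral eq_complex => /andP[_ /eqP] => /= <-.
  by apply: eq_Rintegral => t _; rewrite Im_mul /= mul0r addr0.
have Z1 := arcs_ae_zero g1 r0 Sr; have Z2 := arcs_ae_zero g2 i0 Si.
apply: (@filterS2 _ _ (ae_filter_ringOfSetsType mu) _ _ _ _ Z1 Z2) => t z1 z2 ct.
by move: (z1 ct) (z2 ct) => /=; case: (g t) => a b /= -> ->.
Qed.

End fourier_uniqueness.

(** * The Riesz-Fischer theorem *)

Section frequencies.

Definition zfreq (l : nat) : int := if odd l then Negz l./2 else Posz l./2.

Definition zindex (k : int) : nat :=
  match k with Posz n => n.*2 | Negz n => n.*2.+1 end.

Lemma zfreqK : cancel zfreq zindex.
Proof.
move=> l; rewrite /zfreq /zindex; have E := odd_double_half l.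
by case: (odd l) E => /= <-; rewrite ?add0n ?add1n //= ?uphalf_double ?doubleK.
Qed.

Lemma zindexK : cancel zindex zfreq.
Proof.
by case=> n; rewrite /zfreq /zindex /= ?odd_double /= ?uphalf_double ?doubleK.
Qed.

End frequencies.

Section square_summable.
Context {R : realType}.

(** Summability of a nonnegative sequence; as a bound on partial sums it needs no
limit and compares termwise. *)
Definition bounded_sums (w : nat -> R) : Prop :=
  (forall l, 0 <= w l) /\ exists C, forall n, \sum_(0 <= l < n) w l <= C.

Lemma bounded_sums_tail w : bounded_sums w -> forall e, 0 < e ->
  exists n0, forall m n, (n0 <= m)%N -> \sum_(m <= l < n) w l <= e.
Proof.
move=> [w0 [C wC]] e e0.
have nd : nondecreasing_seq (series w).
  by apply: nondecreasing_series => n _ _; exact: w0.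
have cw : cvgn (series w).
  apply: nondecreasing_is_cvgn => //.
  by exists C => _ [n _ <-]; rewrite seriesEnat; exact: wC.
have /cvgrPdist_lt /(_ e e0)[n0 _ H] := cw.
exists n0 => m n nm; have [mn|nm'] := leqP m n; last first.
  by rewrite big_geq ?(ltW e0)// ltnW.
have := H m nm; rewrite /= => Hm.
have E : series w n = series w m + \sum_(m <= l < n) w l.
  by rewrite !seriesEnat /= (big_cat_nat (n := m)).
have L : series w n <= limn (series w) by exact: nondecreasing_cvgn_le.
have : limn (series w) - series w m < e by rewrite (le_lt_trans (ler_norm _)).
by rewrite E in L; lra.
Qed.

Lemma bounded_sums_le v w : (forall l, 0 <= v l <= w l) -> bounded_sums w -> bounded_sums v.
Proof.
move=> vw [_ [C wC]]; split; first by move=> l; have /andP[] := vw l.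
exists C => n; apply: le_trans (wC n); apply: ler_sum => l _.
by have /andP[] := vw l.
Qed.

End square_summable.

Lemma CmeasurableB d (T : measurableType d) (R : realType) (D : set T) (F G : T -> R[i]) :
  Cmeasurable D F -> Cmeasurable D G -> Cmeasurable D (fun t => F t - G t).
Proof.
move=> [F1 F2] [G1 G2]; split.
  by apply: eq_measurable_fun (measurable_funB F1 G1) => t _ /=; rewrite Re_add Re_opp.
by apply: eq_measurable_fun (measurable_funB F2 G2) => t _ /=; rewrite Im_add Im_opp.
Qed.

Section L2_inequalities.
Context d (T : measurableType d) (R : realType).
Variables (mu : {measure set T -> \bar R}) (D : set T) (mD : measurable D).
Implicit Types F G : T -> R[i].

Let mnormsq F : Cmeasurable D F -> measurable_fun D (fun t => (normc (F t) ^+ 2)%:E).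
Proof. by move=> mF; apply/measurable_EFinP; exact: measurable_normc_sqr. Qed.

Let nn F t : (0 <= (normc (F t) ^+ 2)%:E)%E.
Proof. by rewrite lee_fin sqr_ge0. Qed.

Lemma integral_normc_sqrD F G : Cmeasurable D F -> Cmeasurable D G ->
  (\int[mu]_(t in D) (normc (F t + G t) ^+ 2)%:E <=
   2%:E * \int[mu]_(t in D) (normc (F t) ^+ 2)%:E +
   2%:E * \int[mu]_(t in D) (normc (G t) ^+ 2)%:E)%E.
Proof.
move=> mF mG.
rewrite -!ge0_integralZl//; try exact: mnormsq.
have nn2 (H : T -> R[i]) t : (0 <= 2%:E * (normc (H t) ^+ 2)%:E)%E.
  by apply: mule_ge0; [rewrite lee_fin|exact: nn].
have m2 (H : T -> R[i]) : Cmeasurable D H -> measurable_fun D (fun t => 2%:E * (normc (H t) ^+ 2)%:E)%E.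
  by move=> mH; apply: emeasurable_funM => //; exact: mnormsq.
rewrite -ge0_integralD//; try exact: m2.
apply: ge0_le_integral => //.
- by move=> t _; rewrite lee_fin sqr_ge0.
- by apply: mnormsq; exact: CmeasurableD.
- by apply: emeasurable_funD; exact: m2.
- move=> t _; rewrite -!EFinM -EFinD lee_fin.
  apply: (@le_trans _ _ ((normc (F t) + normc (G t)) ^+ 2)).
    by rewrite ler_pXn2r ?nnegrE ?normc_ge0 ?addr_ge0 ?normc_ge0// le_normcD.
  have := sqr_ge0 (normc (F t) - normc (G t)).
  by rewrite sqrrB sqrrD; lra.
Qed.

Lemma integral_normc_sqrE F : Cmeasurable D F ->
  (\int[mu]_(t in D) (normc (F t) ^+ 2)%:E =
   \int[mu]_(t in D) (complex.Re (F t) ^+ 2)%:E +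
   \int[mu]_(t in D) (complex.Im (F t) ^+ 2)%:E)%E.
Proof.
move=> [mF1 mF2]; rewrite -ge0_integralD//.
- by apply: eq_integral => t _; rewrite -EFinD normc_sqr.
- by move=> t _; rewrite lee_fin sqr_ge0.
- by apply/measurable_EFinP; exact: measurable_funX mF1.
- by move=> t _; rewrite lee_fin sqr_ge0.
- by apply/measurable_EFinP; exact: measurable_funX mF2.
Qed.

Lemma integral_Re_sqr_le F : Cmeasurable D F ->
  (\int[mu]_(t in D) (complex.Re (F t) ^+ 2)%:E <= \int[mu]_(t in D) (normc (F t) ^+ 2)%:E)%E.
Proof.
move=> mF; rewrite (integral_normc_sqrE mF) leeDl//.
by apply: integral_ge0 => t _; rewrite lee_fin sqr_ge0.
Qed.

Lemma integral_Im_sqr_le F : Cmeasurable D F ->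
  (\int[mu]_(t in D) (complex.Im (F t) ^+ 2)%:E <= \int[mu]_(t in D) (normc (F t) ^+ 2)%:E)%E.
Proof.
move=> mF; rewrite (integral_normc_sqrE mF) leeDr//.
by apply: integral_ge0 => t _; rewrite lee_fin sqr_ge0.
Qed.

(** Cauchy-Schwarz in the form of Young's inequality with a free parameter s, which
keeps square roots out. *)
Lemma L2_product_integrable F G (A B : R) : Cmeasurable D F -> Cmeasurable D G ->
  (\int[mu]_(t in D) (normc (F t) ^+ 2)%:E <= A%:E)%E ->
  (\int[mu]_(t in D) (normc (G t) ^+ 2)%:E <= B%:E)%E ->
  Cintegrable mu D (fun t => F t * G t) /\
  forall s, 0 < s -> normc (Cintegral mu D (fun t => F t * G t)) <= s * A + s^-1 * B.
Proof.
move=> mF mG FA GB.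
have int (H : T -> R[i]) C : Cmeasurable D H -> (\int[mu]_(t in D) (normc (H t) ^+ 2)%:E <= C%:E)%E ->
    mu.-integrable D (EFin \o (fun t => normc (H t) ^+ 2)).
  move=> mH HC; apply/integrableP; split; first exact: mnormsq.
  rewrite (le_lt_trans _ (ltry C))// (le_trans _ HC)//.
  by rewrite le_eqVlt; apply/orP; left; apply/eqP; apply: eq_integral => t _; rewrite gee0_abs/=.
have iF := int _ _ mF FA; have iG := int _ _ mG GB.
have young s x y : 0 < s -> 2 * (x * y) <= s * x ^+ 2 + s^-1 * y ^+ 2 :> R.
  move=> s0; have : 0 <= s^-1 * (s * x - y) ^+ 2 by rewrite mulr_ge0 ?sqr_ge0// invr_ge0 ltW.
  suff -> : s^-1 * (s * x - y) ^+ 2 = s * x ^+ 2 + s^-1 * y ^+ 2 - 2 * (x * y) by rewrite subr_ge0.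
  by field; rewrite gt_eqF.
have is_ s : mu.-integrable D (EFin \o (fun t => s * normc (F t) ^+ 2 + s^-1 * normc (G t) ^+ 2)).
  have := integrableD mD (integrableZl mD s iF) (integrableZl mD s^-1 iG).
  by apply: eq_integrable.
have iFG : Cintegrable mu D (fun t => F t * G t).
  apply: (Cintegrable_le mD _ (is_ 1)); first exact: CmeasurableM.
  move=> t _; rewrite normcM (le_trans _ (young _ _ _ _))//.
  by rewrite ler_peMl ?ler1n// mulr_ge0 ?normc_ge0.
split=> // s s0; rewrite (le_trans (normc_Cintegral_le _ iFG))//.
have iN := integrable_normc mD iFG.
rewrite -RintegralZl//.
apply: (@le_trans _ _ (\int[mu]_(t in D) (s * normc (F t) ^+ 2 + s^-1 * normc (G t) ^+ 2))%R).
  apply: le_Rintegral => //; first exact: (integrableZl mD 2 iN).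
  by move=> t _; rewrite normcM young.
rewrite RintegralD//; [|exact: (integrableZl mD _ iF)|exact: (integrableZl mD _ iG)].
rewrite !RintegralZl//.
have R_le (H : T -> R[i]) C : Cmeasurable D H -> (\int[mu]_(t in D) (normc (H t) ^+ 2)%:E <= C%:E)%E ->
    (\int[mu]_(t in D) (normc (H t) ^+ 2) <= C)%R.
  move=> mH HC; rewrite -lee_fin /Rintegral fineK//.
  by apply: integrable_fin_num => //; exact: int HC.
by rewrite lerD// ler_wpM2l ?invr_ge0 ?(ltW s0)//; exact: R_le.
Qed.

End L2_inequalities.

Section riesz_fischer.
Context {R : realType}.
Local Notation mu := (@lebesgue_measure R).
Local Notation mC := (@measurable_circle R).
Implicit Types (f g F G : R -> R[i]) (b : nat -> R[i]).

Definition trig_sum b n (t : R) : R[i] := \sum_(0 <= l < n) b l * wave (zfreq l) t.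

Definition L2sq F : \bar R := (\int[mu]_(t in circle) (normc (F t) ^+ 2)%:E)%E.

Lemma Cintegrable_trig b (r : seq nat) :
  Cintegrable mu circle (fun t => \sum_(l <- r) b l * wave (zfreq l) t).
Proof.
apply: (@Cintegrable_sum _ _ R mu circle mC) => l.
by apply: (@CintegrableZ _ _ R mu circle mC); exact: Cintegrable_wave.
Qed.

Lemma measurable_trig b (r : seq nat) :
  Cmeasurable circle (fun t => \sum_(l <- r) b l * wave (zfreq l) t).
Proof. exact: Cintegrable_measurable (Cintegrable_trig b r). Qed.

Let mnormsq F : Cmeasurable circle F -> measurable_fun circle (fun t => (normc (F t) ^+ 2)%:E).
Proof. by move=> mF; apply/measurable_EFinP; exact: measurable_normc_sqr. Qed.

Let nn F t : (0 <= (normc (F t) ^+ 2)%:E)%E.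
Proof. by rewrite lee_fin sqr_ge0. Qed.

Lemma circle_integral_orthogonal b (r : seq nat) : uniq r ->
  circle_integral (fun t => ((normc (\sum_(l <- r) b l * wave (zfreq l) t)) ^+ 2)%:C) =
  (\sum_(l <- r) normc (b l) ^+ 2)%:C.
Proof.
move=> ur; transitivity (circle_integral (fun t => \sum_(l <- r)
   b l * \sum_(j <- r) conjc (b j) * wave (zfreq l - zfreq j) t)).
  apply: eq_circle_integral => t; rewrite -mul_conjc mulr_suml; apply: eq_bigr => l _.
  rewrite -mulrA; congr (_ * _); rewrite rmorph_sum mulr_sumr; apply: eq_bigr => j _.
  by rewrite rmorphM [X in _ * (_ * X)]conj_wave mulrCA -waveD.
have I l : Cintegrable mu circle (fun t => \sum_(j <- r) conjc (b j) * wave (zfreq l - zfreq j) t).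
  apply: (@Cintegrable_sum _ _ R mu circle mC) => j.
  by apply: (@CintegrableZ _ _ R mu circle mC); exact: Cintegrable_wave.
rewrite circle_integral_sum; last by move=> l; exact: (@CintegrableZ _ _ R mu circle mC).
rewrite rmorph_sum !big_seq; apply: eq_bigr => l lr.
rewrite circle_integralZ// circle_integral_sum; last first.
  by move=> j; apply: (@CintegrableZ _ _ R mu circle mC); exact: Cintegrable_wave.
rewrite (bigD1_seq l)//= big1 ?addr0; last first.
  move=> j jl; rewrite circle_integralZ; last exact: Cintegrable_wave.
  rewrite circle_integral_wave subr_eq0 (inj_eq (can_inj zfreqK)) eq_sym.
  by rewrite (negbTE jl) mulr0.
rewrite circle_integralZ; last exact: Cintegrable_wave.
by rewrite circle_integral_wave subrr eqxx mulr1 mul_conjc.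
Qed.

Let twopi_gt0 : 0 < 2 * pi :> R. Proof. by rewrite mulr_gt0// pi_gt0. Qed.

(** Orthogonality of the waves. *)
Lemma L2sq_trig b (r : seq nat) : uniq r ->
  L2sq (fun t => \sum_(l <- r) b l * wave (zfreq l) t) =
  (2 * pi * \sum_(l <- r) normc (b l) ^+ 2)%:E.
Proof.
move=> ur; set S := fun t => _.
have nS t : normc (S t) <= \sum_(l <- r) normc (b l).
  rewrite (le_trans (ler_normc_sum _ _ _))// ler_sum// => l _.
  by rewrite normcM normc_wave mulr1.
have iS : mu.-integrable circle (fun t => (normc (S t) ^+ 2)%:E).
  apply: (@le_integrable _ _ R mu circle mC _ (EFin \o cst ((\sum_(l <- r) normc (b l)) ^+ 2))).
  - by apply: mnormsq; exact: measurable_trig.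
  - move=> t _ /=; rewrite lee_fin !ger0_norm ?sqr_ge0//.
    by rewrite ler_pXn2r// nnegrE ?normc_ge0// sumr_ge0// => l _; exact: normc_ge0.
  - by apply: integrable_continuous_circle => t; exact: cvg_cst.
have fS : L2sq S \is a fin_num 
  by rewrite ge0_fin_numE ?integral_ge0//; have /integrableP[_] := iS; under eq_integral do rewrite gee0_abs//.
rewrite -[LHS]fineK//; congr EFin; rewrite -[LHS]/(\int[mu]_(t in circle) (normc (S t) ^+ 2))%R.
have := circle_integral_orthogonal b ur.
rewrite /circle_integral (@Cintegral_real _ _ R mu circle) -rmorphM => /complexI <-.
by rewrite mulrA mulfV ?mul1r// gt_eqF.
Qed.

Lemma L2sq_le_add F G (A B : R) : Cmeasurable circle F -> Cmeasurable circle G ->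
  (L2sq F <= A%:E)%E -> (L2sq G <= B%:E)%E ->
  (L2sq (fun t => (F t + G t)%R) <= (2 * A + 2 * B)%:E)%E.
Proof.
move=> mF mG FA GB.
apply: (le_trans (@integral_normc_sqrD _ _ R mu circle mC F G mF mG)).
by rewrite (EFinD (2 * A)) (EFinM 2 A) (EFinM 2 B) leeD// lee_pmul2l// lte_fin.
Qed.

(** Convergence of the partial sums along zfreq in mean square. *)
Definition L2_expansion f b : Prop := Cmeasurable circle f /\
  forall e, 0 < e -> exists n0, forall n, (n0 <= n)%N ->
    (L2sq (fun t => (f t - trig_sum b n t)%R) <= e%:E)%E.

Lemma trig_sumB b m n : (m <= n)%N -> forall t,
  trig_sum b n t - trig_sum b m t = \sum_(l <- index_iota m n) b l * wave (zfreq l) t.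
Proof.
move=> mn t; rewrite /trig_sum (big_cat_nat (n := m))//=.
by rewrite addrAC subrr add0r.
Qed.

(** A subsequence of the partial sums converges at the geometric rate required by
fast_L2_limit, real and imaginary parts apart; the tails of the coefficients
control the distance from the subsequence to all later partial sums. *)
Theorem riesz_fischer b : bounded_sums (fun l => normc (b l) ^+ 2) ->
  exists h, L2_expansion h b.
Proof.
move=> bb.
have /choice[n0 n0P] : forall j : nat, exists n0, forall m n, (n0 <= m)%N ->
    2 * pi * \sum_(m <= l < n) normc (b l) ^+ 2 <= (4 ^+ j)^-1.
  move=> j; have e0 : 0 < (4 ^+ j)^-1 / (2 * pi) :> R by rewrite divr_gt0// invr_gt0 exprn_gt0.
  have [n0 H] := bounded_sums_tail bb e0.
  by exists n0 => m n mn; have := H m n mn; rewrite ler_pdivlMr// mulrC.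
pose N j := (\sum_(0 <= i < j.+1) n0 i)%N.
have Nn0 j : (n0 j <= N j)%N by rewrite /N big_nat_recr//= leq_addl.
have Nmono m n : (m <= n)%N -> (N m <= N n)%N.
  by move=> mn; rewrite /N [leqRHS](big_cat_nat (n := m.+1))//= leq_addr.
have S_le m n : (N m <= n)%N ->
    (L2sq (fun t => (trig_sum b n t - trig_sum b (N m) t)%R) <= ((4 ^+ m)^-1)%:E)%E.
  move=> mn; rewrite (_ : (fun t => _) = fun t => \sum_(l <- index_iota (N m) n) b l * wave (zfreq l) t); last first.
    by apply/funext => t; exact: trig_sumB.
  by rewrite L2sq_trig ?iota_uniq// lee_fin n0P.
have mS n : Cmeasurable circle (trig_sum b n) by exact: measurable_trig.
have mSB m n : Cmeasurable circle (fun t => trig_sum b n t - trig_sum b m t).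
  exact: CmeasurableB.
have fast (p : R[i] -> R) : (forall x y, p (x - y) = p x - p y) ->
    (forall n, measurable_fun circle (p \o trig_sum b n)) ->
    (forall m n, (\int[mu]_(t in circle) (p (trig_sum b n t - trig_sum b m t) ^+ 2)%:E <=
        L2sq (fun t => (trig_sum b n t - trig_sum b m t)%R))%E) ->
    exists v : R -> R, measurable_fun circle v /\ forall m,
    (\int[mu]_(t in circle) ((v t - p (trig_sum b (N m) t)) ^+ 2)%:E <= ((4 ^+ m)^-1)%:E)%E.
  move=> pB pm pn.
  apply: (@fast_L2_limit _ _ R mu circle (fun m => p \o trig_sum b (N m)) mC).
    by move=> n; exact: pm.
  move=> m n mn; apply: le_trans (S_le m (N n) (Nmono _ _ mn)).
  apply: le_trans (pn (N m) (N n)).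
  rewrite le_eqVlt; apply/orP; left; apply/eqP; apply: eq_integral => t _.
  by rewrite pB.
have [v1 [mv1 H1]] := fast (@complex.Re R) (fun x y => ltac:(by rewrite Re_add Re_opp))
  (fun n => (mS n).1) (fun m n => @integral_Re_sqr_le _ _ R mu circle mC _ (mSB m n)).
have [v2 [mv2 H2]] := fast (@complex.Im R) (fun x y => ltac:(by rewrite Im_add Im_opp))
  (fun n => (mS n).2) (fun m n => @integral_Im_sqr_le _ _ R mu circle mC _ (mSB m n)).
pose h t := v1 t +i* v2 t.
have mh : Cmeasurable circle h by [].
exists h; split => // e e0.
have HN m : (L2sq (fun t => (h t - trig_sum b (N m) t)%R) <= (2 * (4 ^+ m)^-1)%:E)%E.
  rewrite /L2sq (@integral_normc_sqrE _ _ R mu circle mC _ (CmeasurableB mh (mS (N m)))).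
  rewrite mulr_natl mulr2n EFinD leeD//.
    apply: le_trans (H1 m); rewrite le_eqVlt; apply/orP; left; apply/eqP.
    by apply: eq_integral => t _; rewrite Re_add Re_opp.
  apply: le_trans (H2 m); rewrite le_eqVlt; apply/orP; left; apply/eqP.
  by apply: eq_integral => t _; rewrite Im_add Im_opp.
have [m me] : exists m, 6 * (4 ^+ m)^-1 <= e.
  have c : (4^-1 : R) ^+ m @[m --> \oo] --> (0 : R).
    by apply: cvg_expr; rewrite ger0_norm ?invr_ge0 ?ler0n// invf_lt1 ?ltr0n// ltr1n.
  have e6 : 0 < e / 6 by rewrite divr_gt0.
  have /cvgrPdist_lt /(_ _ e6) [m _ Hm] := c.
  exists m; have := Hm m (leqnn m); rewrite /= sub0r normrN exprVn ger0_norm ?invr_ge0 ?exprn_ge0//.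
  by rewrite ltr_pdivlMr// mulrC => /ltW.
exists (N m) => n mn.
rewrite (_ : (fun t => _) = fun t => (h t - trig_sum b (N m) t) + (trig_sum b (N m) t - trig_sum b n t)); last first.
  by apply/funext => t; rewrite addrA subrK.
apply: le_trans (L2sq_le_add (CmeasurableB mh (mS _)) (mSB _ _) (HN m) _) _.
  rewrite (_ : L2sq _ = L2sq (fun t => trig_sum b n t - trig_sum b (N m) t)); first exact: S_le.
  by apply: eq_integral => t _; rewrite -normcN opprB.
by rewrite lee_fin; apply: le_trans me; lra.
Qed.

End riesz_fischer.

(** * Pairing with a square-integrable function *)

Section L2_pairing.
Context {R : realType}.
Local Notation mu := (@lebesgue_measure R).
Local Notation mC := (@measurable_circle R).
Implicit Types (f g F G : R -> R[i]) (b : nat -> R[i]).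

(** The topology of the complex numbers enters only through this modulus form of
convergence. *)
Definition sums_to (u : nat -> R[i]) (a : R[i]) : Prop :=
  forall e, 0 < e -> exists n0, forall n, (n0 <= n)%N -> normc (a - u n) <= e.

Lemma sums_to_unique u a a' : sums_to u a -> sums_to u a' -> a = a'.
Proof.
move=> ua ua'; apply/eqP; rewrite -subr_eq0; apply/eqP/eq0_normc/eqP.
rewrite eq_le normc_ge0 andbT; apply/ler_addgt0Pl => e e0.
have e2 : 0 < e / 2 by rewrite divr_gt0.
have [n1 H1] := ua _ e2; have [n2 H2] := ua' _ e2.
rewrite (_ : a - a' = (a - u (maxn n1 n2)) - (a' - u (maxn n1 n2))); last by ring.
rewrite addr0 (le_trans (le_normcD _ _))// normcN [leRHS]splitr lerD//.
- by apply: H1; exact: leq_maxl.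
- by apply: H2; exact: leq_maxr.
Qed.

Lemma sums_to_eventually u a n0 : (forall n, (n0 <= n)%N -> u n = a) -> sums_to u a.
Proof.
by move=> ua e e0; exists n0 => n /ua ->; rewrite subrr normc0 ltW.
Qed.

Lemma sums_toZ c u a : sums_to u a -> sums_to (fun n => c * u n) (c * a).
Proof.
move=> ua e e0; have c0 : 0 < normc c + 1 by rewrite ltr_wpDl ?normc_ge0.
have [n0 H] := ua _ (divr_gt0 e0 c0); exists n0 => n /H.
rewrite ler_pdivlMr// -mulrBr normcM => h; apply: le_trans h.
by rewrite mulrC ler_wpM2l ?normc_ge0// lerDl.
Qed.

Lemma sums_toB u v a a' : sums_to u a -> sums_to v a' ->
  sums_to (fun n => u n - v n) (a - a').
Proof.
move=> ua vb e e0; have e2 : 0 < e / 2 by rewrite divr_gt0.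
have [n1 H1] := ua _ e2; have [n2 H2] := vb _ e2.
exists (maxn n1 n2) => n; rewrite geq_max => /andP[/H1 h1 /H2 h2].
rewrite (_ : a - a' - _ = (a - u n) - (a' - v n)); last by ring.
by rewrite (le_trans (le_normcD _ _))// normcN [leRHS]splitr lerD.
Qed.

Lemma sums_to_normc_le u a C : sums_to u a -> (exists n0, forall n, (n0 <= n)%N -> normc (u n) <= C) ->
  normc a <= C.
Proof.
move=> ua [n0 uC]; apply/ler_addgt0Pl => e e0; have [n1 H] := ua _ e0.
have := H _ (leq_maxr n0 n1); have := uC _ (leq_maxl n0 n1).
move=> h1 h2; rewrite -[a](subrK (u (maxn n0 n1))).
by rewrite (le_trans (le_normcD _ _))// lerD.
Qed.

Lemma normc_circle_integral_le f :
  normc (circle_integral f) <= normc (Cintegral mu circle f).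
Proof.
have p2 : 1 <= 2 * pi :> R by have := pi_ge2 R; lra.
rewrite /circle_integral normcM normc_real ger0_norm ?invr_ge0 ?(le_trans _ p2)//.
by rewrite ler_piMl ?normc_ge0// invf_le1// (lt_le_trans _ p2).
Qed.

Lemma L2_circle_le G : L2_circle G -> exists2 B, 0 <= B & (L2sq G <= B%:E)%E.
Proof.
move=> [mG Goo]; have G0 : (0 <= L2sq G)%E.
  by apply: integral_ge0 => t _; rewrite lee_fin sqr_ge0.
exists (fine (L2sq G)); first exact: fine_ge0.
by rewrite fineK// ge0_fin_numE.
Qed.

Lemma L2sq_wave k : (L2sq (wave k : R -> R[i]) <= (2 * pi)%:E)%E.
Proof.
have := @L2sq_trig R (fun=> 1) [:: zindex k] erefl.
rewrite big_seq1 normc1 expr1n mulr1 => <-.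
rewrite le_eqVlt; apply/orP; left; apply/eqP; congr L2sq; apply/funext => t.
by rewrite big_seq1 mul1r zindexK.
Qed.

Lemma L2_circle_wave k : L2_circle (wave k : R -> R[i]).
Proof.
by split; [exact: measurable_wave|exact: le_lt_trans (L2sq_wave k) (ltry _)].
Qed.

Lemma L2_circle_integrable G : L2_circle G -> Cintegrable mu circle G.
Proof.
move=> G2; have [B B0 GB] := L2_circle_le G2.
have [+ _] := @L2_product_integrable _ _ R mu circle mC (wave 0) G _ B
  (measurable_wave 0 circle) G2.1 (L2sq_wave 0) GB.
by apply: (@eq_Cintegrable _ _ R mu circle mC) => t _; rewrite wave0 mul1r.
Qed.

Lemma L2_expansion_L2 f b : L2_expansion f b -> L2_circle f.
Proof.
move=> [mf fb]; split => //; have [n0 /(_ n0 (leqnn _)) H] := fb 1 ltr01.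
have S2 := @L2sq_trig R b _ (iota_uniq 0 n0).
rewrite (_ : f = fun t => (f t - trig_sum b n0 t) + trig_sum b n0 t); last first.
  by apply/funext => t; rewrite subrK.
have mS : Cmeasurable circle (trig_sum b n0) by exact: measurable_trig.
apply: le_lt_trans (L2sq_le_add (CmeasurableB mf mS) mS H _) (ltry _).
by rewrite /trig_sum /index_iota subn0 S2.
Qed.

(** Integrating the partial sums against G gives finite sums of products of
coefficients, and the remainder is controlled by Cauchy-Schwarz. The constant s
below is chosen so that each of its two terms is at most e / 2. *)
Lemma L2_expansion_pairing f b G : L2_expansion f b -> L2_circle G ->
  Cintegrable mu circle (fun t => f t * G t) /\
  sums_to (fun n => \sum_(0 <= l < n) b l * fourier G (- zfreq l))
    (circle_integral (fun t => f t * G t)).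
Proof.
move=> fb G2; have [B B0 GB] := L2_circle_le G2.
have [A A0 fA] := L2_circle_le (L2_expansion_L2 fb).
case: fb => mf fb.
have [iFG _] := @L2_product_integrable _ _ R mu circle mC f G A B mf G2.1 fA GB.
split=> // e e0.
pose s := 2 * (B + 1) / e.
have s0 : 0 < s by rewrite divr_gt0// mulr_gt0// ltr_wpDl.
have eta0 : 0 < e / (2 * s) by rewrite divr_gt0// mulr_gt0.
have [n0 H] := fb _ eta0; exists n0 => n n0n.
have mS : Cmeasurable circle (trig_sum b n) by exact: measurable_trig.
have [iD /(_ s s0) D_le] := @L2_product_integrable _ _ R mu circle mC _ G _ B
  (CmeasurableB mf mS) G2.1 (H n n0n) GB.
have iG := L2_circle_integrable G2.
have iS : Cintegrable mu circle (fun t => \sum_(0 <= l < n) b l * (wave (zfreq l) t * G t)).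
  apply: (@Cintegrable_sum _ _ R mu circle mC) => l.
  by apply: (@CintegrableZ _ _ R mu circle mC); exact: Cintegrable_wave_mul.
rewrite (_ : \sum_(0 <= l < n) _ = circle_integral (fun t => \sum_(0 <= l < n) b l * (wave (zfreq l) t * G t))); last first.
  rewrite circle_integral_sum; last first.
    by move=> l; apply: (@CintegrableZ _ _ R mu circle mC); exact: Cintegrable_wave_mul.
  apply: eq_bigr => l _; rewrite circle_integralZ; last exact: Cintegrable_wave_mul.
  by rewrite fourierE opprK.
rewrite -circle_integralB//.
rewrite (_ : circle_integral _ = circle_integral (fun t => (f t - trig_sum b n t) * G t)); last first.
  apply: eq_circle_integral => t; rewrite mulrBl /trig_sum mulr_suml; congr (_ - _).
  by apply: eq_bigr => l _; rewrite mulrA.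
apply: le_trans (normc_circle_integral_le _) _; apply: le_trans D_le _.
have -> : s * (e / (2 * s)) = e / 2 by field; rewrite gt_eqF.
rewrite [leRHS]splitr lerD2l mulrC ler_pdivrMr// /s.
have -> : e / 2 * (2 * (B + 1) / e) = B + 1 by field; rewrite gt_eqF.
by rewrite lerDl.
Qed.

(** The pairing with one wave, whose partial sums are eventually constant. *)
Lemma L2_expansion_fourier f b k : L2_expansion f b -> fourier f k = b (zindex k).
Proof.
move=> fb; have [_ H] := L2_expansion_pairing fb (L2_circle_wave (- k)).
rewrite fourierE (_ : circle_integral _ = circle_integral (fun t => f t * wave (- k) t)); last first.
  by apply: eq_circle_integral => t; rewrite mulrC.
apply: sums_to_unique H _; apply: (@sums_to_eventually _ _ (zindex k).+1) => n kn.
rewrite (bigD1_seq (zindex k)) ?iota_uniq ?mem_index_iota//=.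
rewrite fourier_wave zindexK eqxx mulr1 big1 ?addr0// => l lk.
rewrite fourier_wave eqr_opp; case: eqP => [kl|]; last by rewrite mulr0.
by rewrite kl zfreqK eqxx in lk.
Qed.

(** The function built by Riesz-Fischer from the coefficients of f has the same
coefficients as f, so it equals f almost everywhere. *)
Lemma square_summable_expansion f : Cintegrable mu circle f ->
  bounded_sums (fun l => normc (fourier f (zfreq l)) ^+ 2) ->
  L2_expansion f (fun l => fourier f (zfreq l)).
Proof.
move=> fi fb; have [h hb] := riesz_fischer fb; have [mh Hh] := hb.
have hi := L2_circle_integrable (L2_expansion_L2 hb).
have fz : zero_fourier (fun t => h t - f t).
  split; first exact: (@CintegrableB _ _ R mu circle mC).
  move=> k; rewrite fourierB// (L2_expansion_fourier k hb) zindexK.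
  by rewrite subrr.
have fh := zero_fourier_ae fz; have mf := Cintegrable_measurable fi.
split=> // e e0; have [n0 H] := Hh e e0; exists n0 => n /H.
apply: le_trans; rewrite le_eqVlt; apply/orP; left; apply/eqP.
have mS : Cmeasurable circle (trig_sum (fun l => fourier f (zfreq l)) n) by exact: measurable_trig.
apply: (@ae_eq_integral _ _ R mu circle _ _ mC).
- by apply/measurable_EFinP; apply: measurable_normc_sqr; exact: CmeasurableB.
- by apply/measurable_EFinP; apply: measurable_normc_sqr; exact: CmeasurableB.
- move: fh; apply: (@filterS _ _ (ae_filter_ringOfSetsType mu)) => t ht ct.
  by congr (normc _ ^+ 2)%:E; have /eqP := ht ct; rewrite subr_eq0 => /eqP ->.
Qed.

End L2_pairing.

(** * Weak derivatives on the circle *)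

Section weak_derivatives.
Context {R : realType}.
Local Notation mu := (@lebesgue_measure R).
Local Notation mC := (@measurable_circle R).
Implicit Types (f g h : R -> R[i]) (phi : R -> R) (a b : R) (k : int).

(** The space of these functions is stable under differentiation, which makes its
elements test functions. *)
Definition trig_mono k a b (t : R) : R := a * cos (k%:~R * t) + b * sin (k%:~R * t).

Lemma is_derive_trig_mono k a b (t : R) :
  is_derive t 1 (trig_mono k a b) (trig_mono k (k%:~R * b) (- (k%:~R * a)) t).
Proof.
have dc := is_derive_cos_freq k%:~R t; have ds := is_derive_sin_freq k%:~R t.
rewrite (_ : trig_mono k a b = (cst a * (fun t => cos (k%:~R * t)) + cst b * (fun t => sin (k%:~R * t)))%R); last first.
  by apply/funext.
apply: is_derive_eq; rewrite /GRing.scale/= /trig_mono; ring.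
Qed.

Lemma derive1_trig_mono k a b :
  (trig_mono k a b)^`()%classic = trig_mono k (k%:~R * b) (- (k%:~R * a)).
Proof.
apply/funext => t; rewrite derive1E.
by have := is_derive_trig_mono k a b t => -[_ ->].
Qed.

Lemma wave_periodic k (t : R) : wave k (t + 2 * pi) = wave k t.
Proof.
case: k => n.
  by rewrite /wave -!expiMn expi_periodic.
by rewrite NegzE -[wave _ _]conj_wave -[RHS]conj_wave /wave -!expiMn expi_periodic.
Qed.

Lemma cos_freq_period k (t : R) : cos (k%:~R * (t + 2 * pi)) = cos (k%:~R * t) /\
  sin (k%:~R * (t + 2 * pi)) = sin (k%:~R * t).
Proof.
by have := wave_periodic k t; rewrite /wave /expi => -[].
Qed.

Lemma circle_test_trig_mono k a b : circle_test_function (trig_mono k a b).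
Proof.
split=> [n t|t]; last first.
  by have [c s] := cos_freq_period k t; rewrite /trig_mono c s.
have [a' [b' ->]] : exists a' b', (trig_mono k a b)^`(n)%classic = trig_mono k a' b'.
  elim: n => [|n [a' [b' ih]]]; first by exists a, b.
  by exists (k%:~R * b'), (- (k%:~R * a')); rewrite derive1nS ih derive1_trig_mono.
by have [] := is_derive_trig_mono k a' b' t.
Qed.

Lemma L2_circle_continuous phi : continuous phi -> L2_circle (fun t => (phi t)%:C).
Proof.
move=> cphi; split.
  by apply: Cmeasurable_real; apply: measurable_funTS; exact: continuous_measurable_fun.
have cphi2 : continuous (fun t => phi t ^+ 2).
  by move=> t; apply: cvgM; exact: cphi.
have /integrableP[_] := integrable_continuous_circle cphi2; apply: le_lt_trans.
rewrite le_eqVlt; apply/orP; left; apply/eqP; apply: eq_integral => t _.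
by rewrite normc_real real_normK ?num_real//= ger0_norm// sqr_ge0.
Qed.

Lemma test_function_derive phi : circle_test_function phi ->
  [/\ continuous phi, continuous (phi^`()%classic) &
      forall t : R, is_derive t 1 phi (phi^`()%classic t)].
Proof.
move=> [dphi _]; split.
- by move=> t; apply/differentiable_continuous/derivable1_diffP; exact: (dphi 0%N).
- by move=> t; apply/differentiable_continuous/derivable1_diffP; exact: (dphi 1%N).
- by move=> t; rewrite derive1E; apply/derivableP; exact: (dphi 0%N).
Qed.

(** Integration by parts against the cosine and the sine of frequency k. *)
Lemma fourier_derive_test phi k : circle_test_function phi ->
  fourier (fun t => (phi^`()%classic t)%:C) k =
  'i%C * k%:~R%:C * fourier (fun t => (phi t)%:C) k.
Proof.
move=> tphi; have [cphi cdphi phi'] := test_function_derive tphi.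
have phi_pi : phi pi = phi (- pi).
  by rewrite -(tphi.2 (- pi)) mulr_natl mulr2n addrA addNr add0r.
set a : R := (- k)%:~R.
have E (psi : R -> R) : fourier (fun t => (psi t)%:C) k =
    ((2 * pi)^-1)%:C * ((\int[mu]_(t in circle) (cos (a * t) * psi t))%R +i*
     (\int[mu]_(t in circle) (sin (a * t) * psi t))%R).
  rewrite fourierE /circle_integral /Cintegral; congr (_ * (_ +i* _));
    by apply: eq_Rintegral => t _; rewrite ?Re_mul ?Im_mul /wave /= mulr0 ?subr0 ?add0r.
have cM (u v : R -> R) : continuous u -> continuous v -> continuous (fun t => u t * v t).
  by move=> cu cv t; apply: continuousM; [exact: cu|exact: cv].
have cN (u : R -> R) (c : R) : continuous u -> continuous (fun t => - (c * u t)).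
  by move=> cu t; apply: cvgN; apply: cvgM; [exact: cvg_cst|exact: cu].
have cZ (u : R -> R) (c : R) : continuous u -> continuous (fun t => c * u t).
  by move=> cu t; apply: cvgM; [exact: cvg_cst|exact: cu].
have IC := circle_integration_by_parts (is_derive_cos_freq a) phi'
  (cN _ a (@continuous_sin_freq R a)) cdphi.
have IS := circle_integration_by_parts (is_derive_sin_freq a) phi'
  (cZ _ a (@continuous_cos_freq R a)) cdphi.
rewrite !E IC ?IS; last 2 first.
- by rewrite phi_pi mulrN !sin_int_pi sinN sin_int_pi oppr0.
- by rewrite phi_pi mulrN cosN.
have -> : (\int[mu]_(t in circle) (- (a * sin (a * t)) * phi t))%R =
   - (a * \int[mu]_(t in circle) (sin (a * t) * phi t))%R.
  rewrite -RintegralZl//; [|exact: mC|]; last first.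
    by apply: integrable_continuous_circle; apply: cM => //; exact: continuous_sin_freq.
  rewrite -mulN1r -RintegralZl//; [|exact: mC|]; last first.
    by apply: integrable_continuous_circle; apply: cZ; apply: cM => //; exact: continuous_sin_freq.
  by apply: eq_Rintegral => t _; ring.
have -> : (\int[mu]_(t in circle) (a * cos (a * t) * phi t))%R =
   (a * \int[mu]_(t in circle) (cos (a * t) * phi t))%R.
  rewrite -RintegralZl//; [|exact: mC|]; last first.
    by apply: integrable_continuous_circle; apply: cM => //; exact: continuous_cos_freq.
  by apply: eq_Rintegral => t _; ring.
rewrite mulrCA; congr (_ * _); rewrite /a rmorphN/= opprK.
by apply/eqP; rewrite eq_complex /=; apply/andP; split; apply/eqP; ring.
Qed.

Lemma bounded_trig_mono k a b (t : R) : `|trig_mono k a b t| <= `|a| + `|b|.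
Proof.
rewrite (le_trans (ler_normD _ _))// lerD// normrM ler_piMr//.
- by rewrite ler_norml cos_geN1 cos_le1.
- by rewrite ler_norml sin_geN1 sin_le1.
Qed.

Lemma measurable_trig_mono k a b : measurable_fun circle (trig_mono k a b).
Proof.
apply: measurable_funTS; apply: continuous_measurable_fun.
by have [] := test_function_derive (circle_test_trig_mono k a b).
Qed.

Lemma Cintegrable_trig_mono_mul f k a b : Cintegrable mu circle f ->
  Cintegrable mu circle (fun t => (trig_mono k a b t)%:C * f t).
Proof.
apply: (@Cintegrable_bounded_mul _ _ _ (`|a| + `|b|)).
  by apply: Cmeasurable_real; exact: measurable_trig_mono.
by move=> t _; rewrite normc_real bounded_trig_mono.
Qed.

Lemma circle_integral_trig_mono f k a b : Cintegrable mu circle f ->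
  circle_integral (fun t => f t * (trig_mono k a b t)%:C) =
  a%:C * circle_integral (fun t => f t * (trig_mono k 1 0 t)%:C) +
  b%:C * circle_integral (fun t => f t * (trig_mono k 0 1 t)%:C).
Proof.
move=> fi.
have I c d : Cintegrable mu circle (fun t => f t * (trig_mono k c d t)%:C).
  apply: (@eq_Cintegrable _ _ R mu circle mC _ _ _ (Cintegrable_trig_mono_mul k c d fi)).
  by move=> t _; rewrite mulrC.
rewrite -!circle_integralZ// -circle_integralD; [|exact: (@CintegrableZ _ _ R mu circle mC)..].
apply: eq_circle_integral => t; rewrite mulrCA [X in _ + X]mulrCA -mulrDr -!rmorphM -rmorphD.
by congr (_ * _%:C); rewrite /trig_mono; ring.
Qed.

Lemma fourier_trig_mono f k : Cintegrable mu circle f ->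
  fourier f k = circle_integral (fun t => f t * (trig_mono k 1 0 t)%:C) -
    'i%C * circle_integral (fun t => f t * (trig_mono k 0 1 t)%:C).
Proof.
move=> fi.
have I c d : Cintegrable mu circle (fun t => f t * (trig_mono k c d t)%:C).
  apply: (@eq_Cintegrable _ _ R mu circle mC _ _ _ (Cintegrable_trig_mono_mul k c d fi)).
  by move=> t _; rewrite mulrC.
rewrite -circle_integralZ// -circle_integralB//; last exact: (@CintegrableZ _ _ R mu circle mC).
rewrite fourierE; apply: eq_circle_integral => t.
rewrite mulrCA -mulrBr mulrC; congr (_ * _).
apply/eqP; rewrite eq_complex /trig_mono /wave rmorphN/= mulNr cosN sinN.
by apply/andP; split; apply/eqP; ring.
Qed.

(** Test the definition on the cosine and the sine of frequency k. So
every weak derivative, however it is chosen, has these coefficients. *)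
Lemma fourier_weak_derivative f h k : Cintegrable mu circle f ->
  is_weak_derivative f h -> fourier h k = 'i%C * k%:~R%:C * fourier f k.
Proof.
move=> fi [h2 fh]; have hi := L2_circle_integrable h2.
have H a b := fh _ (circle_test_trig_mono k a b).
have {}H a b : circle_integral (fun t => h t * (trig_mono k a b t)%:C) =
    - circle_integral (fun t => f t * (trig_mono k (k%:~R * b) (- (k%:~R * a)) t)%:C).
  by rewrite -derive1_trig_mono H opprK.
rewrite !fourier_trig_mono// !H mulr0 mulr1 oppr0.
rewrite (circle_integral_trig_mono k 0 (- k%:~R) fi) (circle_integral_trig_mono k k%:~R 0 fi).
rewrite rmorphN !rmorph0 !mul0r add0r addr0.
set X := circle_integral _; set Y := circle_integral _; set K := _%:C.
have i2 : 'i%C * 'i%C = -1 :> R[i] by rewrite -expr2 sqr_i.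
transitivity (K * X + 'i%C * K * Y); first by ring.
transitivity (- ('i%C * 'i%C) * K * X + 'i%C * K * Y); last by ring.
by rewrite i2 opprK mul1r.
Qed.

(** The condition that k^2 |f^(k)|^2 is summable over the integers k, along the
enumeration zfreq. *)
Definition square_summable_derivative f : Prop :=
  Cintegrable mu circle f /\
  bounded_sums (fun l => (zfreq l)%:~R ^+ 2 * normc (fourier f (zfreq l)) ^+ 2).

Lemma bounded_sums_coef f : square_summable_derivative f ->
  bounded_sums (fun l => normc (fourier f (zfreq l)) ^+ 2).
Proof.
move=> [fi [_ [C fC]]]; split; first by move=> l; exact: sqr_ge0.
exists (normc (fourier f (zfreq 0)) ^+ 2 + C) => -[|n].
  rewrite big_geq// addr_ge0 ?sqr_ge0//.
  by have := fC 0%N; rewrite big_geq.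
rewrite big_nat_recl// lerD2l; apply: le_trans (fC n.+1).
rewrite [leRHS]big_nat_recl// ler_wpDl//; first by rewrite mulr_ge0// sqr_ge0.
apply: ler_sum => l _; rewrite ler_peMl ?sqr_ge0//.
have z0 : zfreq l.+1 != 0.
  by rewrite -[0]/(zfreq 0) (inj_eq (can_inj zfreqK)).
by rewrite -real_normK ?num_real// exprn_ege1// -intr_norm ler1z -gtz0_ge1 normr_gt0.
Qed.

(** Riesz-Fischer produces h with coefficients i k f^(k); pairing f with the
derivative of a test function and h with the test function gives opposite sums. *)
Lemma weak_derivative_expansion f : square_summable_derivative f ->
  is_weak_derivative f (weak_derivative f).
Proof.
move=> fS; have [fi f1] := fS.
have fe := square_summable_expansion fi (bounded_sums_coef fS).
pose b l := 'i%C * (zfreq l)%:~R%:C * fourier f (zfreq l).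
have bb : bounded_sums (fun l => normc (b l) ^+ 2).
  apply: (bounded_sums_le _ f1) => l; rewrite sqr_ge0 andTb /b !normcM normc_real.
  have -> : normc ('i%C : R[i]) = 1 by rewrite /= expr0n/= add0r expr1n sqrtr1.
  by rewrite mul1r exprMn real_normK ?num_real.
have [h hb] := riesz_fischer bb.
apply: xgetPex; exists h; split; first exact: L2_expansion_L2 hb.
move=> phi tphi; have [cphi cdphi _] := test_function_derive tphi.
have [_ H1] := L2_expansion_pairing fe (L2_circle_continuous cdphi).
have [_ H2] := L2_expansion_pairing hb (L2_circle_continuous cphi).
apply: sums_to_unique H1 _; rewrite -mulN1r.
have := sums_toZ (-1) H2; congr sums_to; apply/funext => n.
rewrite mulr_sumr; apply: eq_bigr => l _; rewrite fourier_derive_test// /b.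
rewrite [(- zfreq l)%:~R]rmorphN/= rmorphN/=; ring.
Qed.

(** Parseval: the factors i k and i (- k) multiply to k^2. *)
Theorem weak_derivative_pairing f g :
  square_summable_derivative f -> square_summable_derivative g ->
  sums_to (fun n => \sum_(0 <= l < n) ((zfreq l)%:~R ^+ 2)%:C *
     (fourier f (zfreq l) * fourier g (- zfreq l)))
   (circle_integral (fun t => weak_derivative f t * weak_derivative g t)).
Proof.
move=> fS gS; have wf := weak_derivative_expansion fS; have wg := weak_derivative_expansion gS.
have fe : L2_expansion (weak_derivative f) (fun l => fourier (weak_derivative f) (zfreq l)).
  apply: square_summable_expansion; first exact: L2_circle_integrable wf.1.
  apply: (bounded_sums_le _ fS.2) => l; rewrite sqr_ge0 andTb (fourier_weak_derivative _ fS.1 wf).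
  rewrite !normcM normc_real.
  have -> : normc ('i%C : R[i]) = 1 by rewrite /= expr0n/= add0r expr1n sqrtr1.
  by rewrite mul1r exprMn real_normK ?num_real.
have [_] := L2_expansion_pairing fe wg.1; congr sums_to; apply/funext => n.
apply: eq_bigr => l _.
rewrite (fourier_weak_derivative _ fS.1 wf) (fourier_weak_derivative _ gS.1 wg).
have i2 : 'i%C * 'i%C = -1 :> R[i] by rewrite -expr2 sqr_i.
rewrite [(- zfreq l)%:~R]rmorphN/= rmorphN/= expr2 rmorphM/=.
set K := _%:C; set X := fourier _ _; set Y := fourier _ _.
transitivity (- ('i%C * 'i%C) * (K * K * (X * Y))); first by ring.
by rewrite i2 opprK mul1r.
Qed.

End weak_derivatives.

(** * Determinants close to the identity and the Vandermonde product *)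

Section sparse_determinant.
Context {K : comNzRingType} {n : nat}.
Implicit Type C : 'M[K]_n.

Let nofix_eq0 C (s : 'S_n) (k : 'I_n) : (forall l, C k l = (k == l)%:R) ->
  s k != k -> \prod_i C i (s i) = 0.
Proof.
by move=> Ck sk; rewrite (bigD1 k)//= Ck eq_sym (negbTE sk) mul0r.
Qed.

(** A permutation contributing to the determinant fixes every index but a, hence is
the identity. *)
Lemma det_one_row C (a : 'I_n) :
  (forall k l, k != a -> C k l = (k == l)%:R) -> \det C = C a a.
Proof.
move=> Ck; rewrite /determinant (bigD1 1%g)//= [X in _ + X]big1 ?addr0; last first.
  move=> s s1; have [k ka sk] : exists2 k, k != a & s k != k.
    apply/exists_inP; apply: contraR s1 => /exists_inPn sf.
    apply/eqP/permP => k; rewrite perm1.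
    have [->|ka] := eqVneq k a; last by apply/eqP; have := sf k ka; rewrite negbK.
    apply/eqP; apply: contraT => saa.
    have := sf (s a) saa; rewrite negbK => /eqP/perm_inj/eqP.
    by rewrite (negbTE saa).
  by rewrite (nofix_eq0 _ sk) ?mulr0// => l; exact: Ck.
rewrite odd_perm1 expr0 mul1r (bigD1 a)//= perm1 big1 ?mulr1// => k ka.
by rewrite perm1 Ck// eqxx.
Qed.

(** A permutation contributing to the determinant fixes every index but a and b,
hence is the identity or their transposition. *)
Lemma det_two_rows C (a b : 'I_n) : a != b ->
  (forall k l, k != a -> k != b -> C k l = (k == l)%:R) ->
  \det C = C a a * C b b - C a b * C b a.
Proof.
move=> ab Ck; have ba : b != a by rewrite eq_sym.
have t1 : tperm a b != 1%g.
  by apply: contra ab => /eqP t; rewrite -[b](tpermL a b) t perm1.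
have prodab (s : 'S_n) : (forall k, k != a -> k != b -> s k = k) ->
    \prod_i C i (s i) = C a (s a) * C b (s b).
  move=> sk; rewrite (bigD1 a)//= (bigD1 b)//= big1 ?mulr1// => k /andP[ka kb].
  by rewrite sk// Ck// eqxx.
rewrite /determinant (bigD1 1%g)//= (bigD1 (tperm a b))//= [X in _ + (_ + X)]big1 ?addr0; last first.
  move=> s /andP[s1 st]; have [k kab sk] : exists2 k, (k != a) && (k != b) & s k != k.
    apply/exists_inP; apply: contraT => /exists_inPn sf.
    have {}sf k : k != a -> k != b -> s k = k.
      by move=> ka kb; apply/eqP; have := sf k; rewrite unfold_in ka kb negbK => /(_ isT).
    have sab c : s c = c -> forall d, s d = c -> d = c.
      by move=> sc d sd; apply: (@perm_inj _ s); rewrite sc.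
    have saE : (s a == a) || (s a == b).
      apply: contraT; rewrite negb_or => /andP[sa sb].
      by have := sab _ (sf _ sa sb) a erefl => /eqP; rewrite eq_sym (negbTE sa).
    have sbE : (s b == a) || (s b == b).
      apply: contraT; rewrite negb_or => /andP[sa sb].
      by have := sab _ (sf _ sa sb) b erefl => /eqP; rewrite eq_sym (negbTE sb).
    case/orP: saE => /eqP sa.
      case/negP: s1; apply/eqP/permP => k; rewrite perm1.
      have [->//|ka] := eqVneq k a; have [->|kb] := eqVneq k b; last exact: sf.
      case/orP: sbE => /eqP// sb; have := sab a sa b sb => /eqP.
      by rewrite (negbTE ba).
    case/negP: st; apply/eqP/permP => k.
    have [->|ka] := eqVneq k a; first by rewrite tpermL.
    have [->|kb] := eqVneq k b; last by rewrite tpermD ?sf// eq_sym.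
    rewrite tpermR; case/orP: sbE => /eqP// sb; have := sab b sb a sa => /eqP.
    by rewrite (negbTE ab).
  case/andP: kab => ka kb.
  by rewrite (nofix_eq0 _ sk) ?mulr0// => l; exact: Ck.
rewrite odd_perm1 expr0 mul1r odd_tperm ab expr1 mulN1r !prodab.
- by rewrite !perm1 tpermL tpermR.
- by move=> k ka kb; rewrite tpermD// eq_sym.
- by move=> k _ _; rewrite perm1.
Qed.

End sparse_determinant.

Section vandermonde_expansion.
Context {R : realType} (N : nat).
Implicit Type z : N.-tuple (R * R).

(** The product is D conj(D) for the Vandermonde determinant D; expanding both
factors makes the integrand a sum of products of functions of one variable. *)
Lemma vandermonde2_leibniz z : (vandermonde2 z)%:C =
  \sum_(s : 'S_N) \sum_(t : 'S_N) (-1) ^+ s * (-1) ^+ t *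
    \prod_k (toC (tnth z k) ^+ s k * conjc (toC (tnth z k)) ^+ t k).
Proof.
pose a : 'rV[R[i]]_N := \row_j toC (tnth z j).
pose D := \det (Vandermonde N a).
have DE : D = \sum_(s : 'S_N) (-1) ^+ s * \prod_k toC (tnth z k) ^+ s k.
  rewrite /D -det_tr; apply: eq_bigr => s _; congr (_ * _).
  by apply: eq_bigr => k _; rewrite !mxE.
have -> : (vandermonde2 z)%:C = D * conjc D.
  rewrite mul_conjc; congr (_%:C); rewrite /D det_Vandermonde normc_prod -prodrXl.
  apply: eq_bigr => l _; rewrite normc_prod -prodrXl; apply: eq_bigr => k _.
  by rewrite !mxE -normcN opprB.
rewrite DE rmorph_sum mulr_suml; apply: eq_bigr => s _.
rewrite mulr_sumr; apply: eq_bigr => t _.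
rewrite rmorphM rmorph_sign rmorph_prod mulrACA -big_split/=; congr (_ * _).
by apply: eq_bigr => k _; rewrite rmorphXn.
Qed.

End vandermonde_expansion.

(** * Covariances of linear statistics *)

Section ginibre_covariance.
Context {R : realType} (N : nat) (h : nat -> R).
Local Notation mu := (mu_gauss N : set (R * R) -> \bar R).
Local Notation tmu := (tuple_measure (mu_gauss N) (n:=N)).
Implicit Types (phi psi : R * R -> R[i]) (i j : nat).

Definition gauss_moment phi i j : R[i] :=
  Cintegral mu setT (fun z => phi z * (toC z ^+ i * conjc (toC z) ^+ j)).

Definition has_gauss_moments phi : Prop := forall i j,
  Cintegrable mu setT (fun z => phi z * (toC z ^+ i * conjc (toC z) ^+ j)).

Hypotheses (h0 : forall i, 0 < h i) (one_moments : has_gauss_moments (fun=> 1))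
  (gauss_moment1 : forall i j, gauss_moment (fun=> 1) i j = (h i * (i == j)%:R)%:C).

(** The matrix of multiplication by phi on the monomials, whose squared norms are
h: normalising by one of the two norms only avoids square roots and leaves
determinants and traces of products unchanged. *)
Definition gauss_entry phi i j : R[i] := gauss_moment phi i j / (h i)%:C.

Let gauss_entry1 i j : gauss_entry (fun=> 1) i j = (i == j)%:R.
Proof.
rewrite /gauss_entry gauss_moment1 rmorphM/= mulrAC divff ?mul1r ?rmorph_nat//.
by rewrite fmorph_eq0 gt_eqF.
Qed.

Section product_statistic.
Variable F : 'I_N -> R * R -> R[i].
Hypothesis mF : forall k, has_gauss_moments (F k).

Let Fmeas k : Cmeasurable setT (F k).
Proof.
have [m1 m2] := Cintegrable_measurable (mF k 0%N 0%N).
by split; [apply: eq_measurable_fun m1|apply: eq_measurable_fun m2] => z _ /=;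
  rewrite !expr0 !mulr1.
Qed.

Let prodmeas : Cmeasurable setT (fun z : N.-tuple (R * R) => \prod_k F k (tnth z k)).
Proof.
apply: Cmeasurable_prod => k; have [m1 m2] := Fmeas k.
split; first exact: (measurableT_comp m1 (measurable_tnth k)).
exact: (measurableT_comp m2 (measurable_tnth k)).
Qed.

Let expand (z : N.-tuple (R * R)) : \prod_k F k (tnth z k) * (vandermonde2 z)%:C =
  \sum_(s : 'S_N) \sum_(t : 'S_N) (-1) ^+ s * (-1) ^+ t *
    \prod_k (F k (tnth z k) * (toC (tnth z k) ^+ s k * conjc (toC (tnth z k)) ^+ t k)).
Proof.
rewrite vandermonde2_leibniz mulr_sumr; apply: eq_bigr => s _.
rewrite mulr_sumr; apply: eq_bigr => t _.
by rewrite mulrCA -big_split.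
Qed.

(** Integrate the double Leibniz sum term by term; substituting t = t' s, and then
k = s k' in the product of the norms, collects it into one determinant for each
permutation s. *)
Lemma tuple_product_integral :
  Cintegrable tmu setT (fun z => \prod_k F k (tnth z k) * (vandermonde2 z)%:C) /\
  Cintegral tmu setT (fun z => \prod_k F k (tnth z k) * (vandermonde2 z)%:C) =
  (\prod_(i < N) h i)%:C *
    \sum_(s : 'S_N) \det (\matrix_(k, l) gauss_entry (F k) (s k) (s l)).
Proof.
rewrite (_ : (fun z => _) = fun z => \sum_(s : 'S_N) \sum_(t : 'S_N) (-1) ^+ s * (-1) ^+ t *
    \prod_k (F k (tnth z k) * (toC (tnth z k) ^+ s k * conjc (toC (tnth z k)) ^+ t k)));
  last exact/funext.
have prodI (s t : 'S_N) := @Cintegral_tuple_prod _ _ R [the {sigma_finite_measure set _ -> \bar R} of mu]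
  N (fun k z => F k z * (toC z ^+ s k * conjc (toC z) ^+ t k)) (fun k => mF k _ _).
have I2 (s t : 'S_N) := CintegrableZ measurableT ((-1) ^+ s * (-1) ^+ t) (prodI s t).1.
split.
  by apply: (Cintegrable_sum measurableT) => s; apply: (Cintegrable_sum measurableT) => t; exact: I2.
rewrite (Cintegral_sum measurableT); last first.
  by move=> s; apply: (Cintegrable_sum measurableT) => t; exact: I2.
rewrite mulr_sumr; apply: eq_bigr => s _.
rewrite (Cintegral_sum measurableT); last by move=> t; exact: I2.
rewrite /determinant mulr_sumr (reindex_inj (mulIg s))/=.
apply: eq_bigr => t _.
rewrite (CintegralZ measurableT _ (prodI _ _).1) (prodI _ _).2.
have -> : (-1) ^+ s * (-1) ^+ (t * s)%g = (-1) ^+ t :> R[i].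
  by rewrite odd_permM signr_addb mulrCA -signr_addb addbb mulr1.
rewrite mulrCA; congr (_ * _).
rewrite [X in X%:C * _](reindex_inj (@perm_inj _ s)) rmorph_prod -big_split.
apply: eq_bigr => k _; rewrite mxE permM /gauss_entry [RHS]mulrC divfK//.
by rewrite fmorph_eq0 gt_eqF.
Qed.

Lemma ginibre_product_integrable : (0 < ginibre_Z N :> R) ->
  Cintegrable (@ginibre R N) setT (fun z => \prod_k F k (tnth z k)).
Proof.
move=> Z0; have [I1 I2] := tuple_product_integral.
apply: (@Cintegrable_density _ _ R tmu (@ginibre R N)
  (fun z => (ginibre_Z N)^-1 * vandermonde2 z)) => //.
- by apply: measurable_funM => //; exact: measurable_vandermonde2.
- by move=> z; rewrite mulr_ge0 ?vandermonde2_ge0// invr_ge0 ltW.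
apply: (eq_Cintegrable measurableT _ (CintegrableZ measurableT (ginibre_Z N)^-1%:C I1)).
by move=> z _; rewrite rmorphM/= mulrCA.
Qed.

Lemma ginibre_product_mean : (ginibre_Z N :> R) = N`!%:R * \prod_(i < N) h i ->
  ginibre_mean (fun z => \prod_k F k (tnth z k)) =
  N`!%:R^-1 * \sum_(s : 'S_N) \det (\matrix_(k, l) gauss_entry (F k) (s k) (s l)).
Proof.
move=> ZE; have ph0 : 0 < \prod_(i < N) h i by exact: prodr_gt0.
have Z0 : 0 < (ginibre_Z N :> R) by rewrite ZE mulr_gt0// ltr0n fact_gt0.
have [I1 I2] := tuple_product_integral.
rewrite /ginibre_mean (@Cintegral_density _ _ R tmu (@ginibre R N)
  (fun z => (ginibre_Z N)^-1 * vandermonde2 z)) //; last 3 first.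
- by apply: measurable_funM => //; exact: measurable_vandermonde2.
- by move=> z; rewrite mulr_ge0 ?vandermonde2_ge0// invr_ge0 ltW.
- apply: (eq_Cintegrable measurableT _ (CintegrableZ measurableT (ginibre_Z N)^-1%:C I1)).
  by move=> z _; rewrite rmorphM/= mulrCA.
transitivity (Cintegral tmu setT (fun z => (ginibre_Z N)^-1%:C *
    (\prod_k F k (tnth z k) * (vandermonde2 z)%:C))).
  by apply: eq_Cintegral => z _; rewrite rmorphM/= mulrCA.
rewrite (CintegralZ measurableT _ I1) I2 mulrA; congr (_ * _).
rewrite ZE -rmorphM invfM -mulrA mulVf ?gt_eqF// mulr1.
by rewrite fmorphV rmorph_nat.
Qed.

End product_statistic.

Lemma ginibre_ZE : (ginibre_Z N :> R) = N`!%:R * \prod_(i < N) h i.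
Proof.
have [_ I] := tuple_product_integral (fun=> one_moments).
apply: complexI; rewrite rmorphM rmorph_nat mulrC.
rewrite /ginibre_Z -(@Cintegral_real _ _ R tmu setT (@vandermonde2 R N)).
transitivity (Cintegral tmu setT
    (fun z : N.-tuple (R * R) => \prod_(k < N) 1 * (vandermonde2 z)%:C)).
  by apply: eq_Cintegral => z _; rewrite big1 ?mul1r.
rewrite I; congr (_ * _).
rewrite (eq_bigr (fun=> 1)) => [|s _].
  by rewrite sumr_const card_Sn.
rewrite -[RHS](det1 _ N); congr (\det _); apply/matrixP => k l.
by rewrite !mxE gauss_entry1 val_eqE (inj_eq perm_inj).
Qed.

Let Z0 : 0 < (ginibre_Z N :> R).
Proof. by rewrite ginibre_ZE mulr_gt0 ?ltr0n ?fact_gt0//; exact: prodr_gt0. Qed.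

Section pair.
Variables phi psi : R * R -> R[i].
Hypotheses (mphi : has_gauss_moments phi) (mpsi : has_gauss_moments psi)
  (mphipsi : has_gauss_moments (fun z => phi z * psi z)).

Let F (a b k : 'I_N) (z : R * R) : R[i] :=
  (if k == a then phi z else 1) * (if k == b then psi z else 1).

Let mF a b k : has_gauss_moments (F a b k).
Proof.
move=> i j; rewrite /F; case: (k == a); case: (k == b).
- exact: mphipsi.
- by apply: (eq_Cintegrable measurableT _ (mphi i j)) => z _; rewrite mulr1.
- by apply: (eq_Cintegrable measurableT _ (mpsi i j)) => z _; rewrite mul1r.
- by apply: (eq_Cintegrable measurableT _ (one_moments i j)) => z _; rewrite !mul1r.
Qed.

Let prodF a b (z : N.-tuple (R * R)) :
  \prod_k F a b k (tnth z k) = phi (tnth z a) * psi (tnth z b).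
Proof.
rewrite big_split/=; congr (_ * _).
- by rewrite -big_mkcond/= big_pred1_eq.
- by rewrite -big_mkcond/= big_pred1_eq.
Qed.

Let prodF_integrable a b :
  Cintegrable (@ginibre R N) setT (fun z => phi (tnth z a) * psi (tnth z b)).
Proof.
by rewrite -(funext (prodF a b)); exact: (ginibre_product_integrable (mF a b)).
Qed.

(* The second correlation kernel, tested against phi and psi: the case i = j
carries the diagonal term and makes the bracket vanish. *)
Let K (i j : nat) : R[i] := (i == j)%:R * gauss_entry (fun z => phi z * psi z) i i +
  (gauss_entry phi i i * gauss_entry psi j j - gauss_entry phi i j * gauss_entry psi j i).

Let pair_mean a b : ginibre_mean (fun z => phi (tnth z a) * psi (tnth z b)) =
  N`!%:R^-1 * \sum_(s : 'S_N) K (s a) (s b).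
Proof.
rewrite -(funext (prodF a b)) (ginibre_product_mean (mF a b) ginibre_ZE).
congr (_ * _); apply: eq_bigr => s _.
have Fid k : k != a -> k != b -> F a b k = fun=> 1.
  by move=> /negbTE ka /negbTE kb; apply/funext => z; rewrite /F ka kb mulr1.
have [eab|ab] := eqVneq a b.
  move: Fid; rewrite -eab => Fid.
  rewrite (det_one_row (a := a)); last first.
    by move=> k l ka; rewrite mxE Fid// gauss_entry1 val_eqE (inj_eq perm_inj).
  rewrite mxE.
  have -> : F a a a = fun z => phi z * psi z by apply/funext => z; rewrite /F eqxx.
  by rewrite /K eqxx mul1r subrr addr0.
rewrite (det_two_rows ab); last first.
  by move=> k l ka kb; rewrite mxE Fid// gauss_entry1 val_eqE (inj_eq perm_inj).
have Fa : F a b a = phi by apply/funext => z; rewrite /F eqxx (negbTE ab) mulr1.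
have Fb : F a b b = psi by apply/funext => z; rewrite /F eqxx eq_sym (negbTE ab) mul1r.
by rewrite !mxE Fa Fb /K val_eqE (inj_eq perm_inj) (negbTE ab) mul0r add0r.
Qed.

(** For one or two particles the determinant of tuple_product_integral differs from
the identity in at most two rows. Summing over the particles and averaging over
the permutations s replaces the indices s a and s b by a free sum. *)
Lemma ginibre_mean_pairs :
  ginibre_mean (fun z : N.-tuple (R * R) => (\sum_k phi (tnth z k)) * (\sum_k psi (tnth z k))) =
  \sum_(i < N) gauss_entry (fun z => phi z * psi z) i i +
  (\sum_(i < N) gauss_entry phi i i) * (\sum_(i < N) gauss_entry psi i i) -
  \sum_(i < N) \sum_(j < N) gauss_entry phi i j * gauss_entry psi j i.
Proof.
have -> : (fun z : N.-tuple (R * R) => (\sum_k phi (tnth z k)) * (\sum_k psi (tnth z k))) =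
    fun z => \sum_a \sum_b phi (tnth z a) * psi (tnth z b).
  by apply/funext => z; rewrite mulr_suml; apply: eq_bigr => a _; rewrite mulr_sumr.
rewrite /ginibre_mean (Cintegral_sum measurableT); last first.
  by move=> a; apply: (Cintegrable_sum measurableT) => b; exact: prodF_integrable.
transitivity (\sum_a \sum_b N`!%:R^-1 * \sum_(s : 'S_N) K (s a) (s b)).
  apply: eq_bigr => a _; rewrite (Cintegral_sum measurableT); last exact: prodF_integrable.
  by apply: eq_bigr => b _; exact: pair_mean.
transitivity (N`!%:R^-1 * \sum_(s : 'S_N) \sum_(i < N) \sum_(j < N) K i j).
  under eq_bigr do rewrite -mulr_sumr exchange_big/=.
  rewrite -mulr_sumr exchange_big/=; congr (_ * _); apply: eq_bigr => s _.
  rewrite [RHS](reindex_inj (@perm_inj _ s)); apply: eq_bigr => a _.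
  by rewrite [RHS](reindex_inj (@perm_inj _ s)).
rewrite sumr_const card_Sn -[X in _ * X]mulr_natl mulrA mulVf ?mul1r; last first.
  by rewrite pnatr_eq0 -lt0n fact_gt0.
rewrite /K; under eq_bigr do rewrite big_split/= sumrB.
rewrite big_split/= sumrB addrA; congr (_ + _ - _).
  apply: eq_bigr => i _; rewrite (bigD1 i)//= eqxx mul1r big1 ?addr0// => j ji.
  by rewrite eq_sym val_eqE (negbTE ji) mul0r.
by rewrite mulr_suml; apply: eq_bigr => i _; rewrite mulr_sumr.
Qed.

End pair.

Lemma ginibre_mean_linear phi : has_gauss_moments phi ->
  ginibre_mean (fun z : N.-tuple (R * R) => \sum_k phi (tnth z k)) =
  \sum_(i < N) gauss_entry phi i i.
Proof.
move=> mphi; pose F (a k : 'I_N) (z : R * R) : R[i] := if k == a then phi z else 1.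
have mF a k : has_gauss_moments (F a k).
  by rewrite /F; case: (k == a); [exact: mphi|exact: one_moments].
have prodF a (z : N.-tuple (R * R)) : \prod_k F a k (tnth z k) = phi (tnth z a).
  by rewrite /F -big_mkcond/= big_pred1_eq.
have iF a : Cintegrable (@ginibre R N) setT (fun z => phi (tnth z a)).
  by rewrite -(funext (prodF a)); exact: (ginibre_product_integrable (mF a)).
rewrite /ginibre_mean (Cintegral_sum measurableT)//.
transitivity (\sum_(a < N) N`!%:R^-1 * \sum_(s : 'S_N) gauss_entry phi (s a) (s a)).
  apply: eq_bigr => a _.
  rewrite -(funext (prodF a)) -/(ginibre_mean _) (ginibre_product_mean (mF a) ginibre_ZE).
  congr (_ * _); apply: eq_bigr => s _.
  rewrite (det_one_row (a := a)); last first.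
    move=> k l /negbTE ka; rewrite mxE (_ : F a k = fun=> 1); last by rewrite /F ka.
    by rewrite gauss_entry1 val_eqE (inj_eq perm_inj).
  by rewrite mxE /F eqxx.
rewrite -mulr_sumr exchange_big/=.
transitivity (N`!%:R^-1 * \sum_(s : 'S_N) \sum_(i < N) gauss_entry phi i i).
  congr (_ * _); apply: eq_bigr => s _.
  by rewrite [RHS](reindex_inj (@perm_inj _ s)).
by rewrite sumr_const card_Sn -[X in _ * X]mulr_natl mulrA mulVf ?mul1r.
Qed.

(** The determinantal structure of the ensemble: the product of the means cancels,
and the trace of phi psi minus the trace of the product of the two truncated
matrices remains. *)
Theorem ginibre_cov_linear phi psi : has_gauss_moments phi -> has_gauss_moments psi ->
  has_gauss_moments (fun z => phi z * psi z) ->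
  ginibre_cov (fun z : N.-tuple (R * R) => \sum_k phi (tnth z k))
    (fun z => \sum_k psi (tnth z k)) =
  \sum_(i < N) gauss_entry (fun z => phi z * psi z) i i -
  \sum_(i < N) \sum_(j < N) gauss_entry phi i j * gauss_entry psi j i.
Proof.
move=> mphi mpsi mpp; rewrite /ginibre_cov ginibre_mean_pairs//.
by rewrite !ginibre_mean_linear//; ring.
Qed.

End ginibre_covariance.

(** * The covariance as a sum over frequencies *)

Section exact_covariance.
Context {R : realType}.
Local Notation mu := (@lebesgue_measure R).
Local Notation mC := (@measurable_circle R).
Implicit Types (f g : R -> R[i]) (N k : nat).

Section diagonal_sums.
Variable m : nat -> R.

Definition moment_cross i j : R := m (i + j) ^+ 2 / (m (i + i) * m (j + j)).

Lemma moment_crossC i j : moment_cross i j = moment_cross j i.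
Proof. by rewrite /moment_cross addnC [m (i + i) * _]mulrC. Qed.

Lemma moment_cross_ratio i k : moment_cross i (i + k) = moment_ratio m i k.
Proof.
rewrite /moment_cross /moment_ratio -!addnn addnA; congr (_ / (_ * m _)).
by rewrite addnACA.
Qed.

(** The entries at distance k from the diagonal, of which there are N - k. *)
Lemma diagonal_sum N k :
  \sum_(i < N) \sum_(j < N) (j == (i + k)%N :> nat)%:R * moment_cross i j =
  N%:R - cov_weight m N k.
Proof.
rewrite /cov_weight opprB addrC subrK.
rewrite -(big_mkord xpredT (fun i => \sum_(j < N) (j == (i + k)%N :> nat)%:R * moment_cross i j)).
rewrite (eq_bigr (fun i => if (i < N - k)%N then moment_ratio m i k else 0)) => [|i _]; last first.
  rewrite -(big_mkord xpredT (fun j => (j == (i + k)%N :> nat)%:R * moment_cross i j)).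
  rewrite ltn_subRL [(k + i)%N]addnC; case: ifPn => [ikN|].
    rewrite (bigD1_seq (i + k)%N) ?iota_uniq ?mem_index_iota//=.
    rewrite eqxx mul1r moment_cross_ratio big1 ?addr0// => j /negbTE ->.
    by rewrite mul0r.
  rewrite -leqNgt big_nat => Nik; apply: big1 => j /andP[_ jN].
  by rewrite ltn_eqF ?mul0r// (leq_trans jN).
rewrite (big_cat_nat (n := (N - k)%N))//= ?leq_subr//.
rewrite [X in _ + X]big_nat [X in _ + X]big1 ?addr0 => [|i /andP[iN _]]; last first.
  by rewrite ltnNge iN.
by rewrite big_nat [RHS]big_nat; apply: eq_bigr => i /andP[_ ->].
Qed.

Lemma frequency_sum N (z : int) :
  \sum_(i < N) \sum_(j < N) (z == j%:Z - i%:Z :> int)%:R * moment_cross i j =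
  N%:R - cov_weight m N `|z|.
Proof.
case: z => k.
  rewrite -diagonal_sum; apply: eq_bigr => i _; apply: eq_bigr => j _.
  congr (_%:R * _); congr nat_of_bool; lia.
rewrite exchange_big -diagonal_sum; apply: eq_bigr => i _; apply: eq_bigr => j _.
rewrite moment_crossC; congr (_%:R * _); congr nat_of_bool; lia.
Qed.

(** The entries are grouped by their frequency j - i. All these have absolute value
below N, hence index below 2 N under zindex; later frequencies are not attained and
contribute 0 on the right as well. *)
Lemma cross_sum_frequencies N (T : int -> R[i]) n : (N.*2 <= n)%N ->
  \sum_(i < N) \sum_(j < N) T (j%:Z - i%:Z) * (moment_cross i j)%:C =
  \sum_(0 <= l < n) T (zfreq l) * (N%:R - cov_weight m N `|zfreq l|)%:C.
Proof.
move=> Nn.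
transitivity (\sum_(i < N) \sum_(j < N) \sum_(0 <= l < n)
    T (zfreq l) * ((zfreq l == j%:Z - i%:Z :> int)%:R * moment_cross i j)%:C).
  apply: eq_bigr => i _; apply: eq_bigr => j _.
  have ln : (zindex (j%:Z - i%:Z) < n)%N.
    have := ltn_ord i; have := ltn_ord j; rewrite /zindex.
    by case E : (j%:Z - i%:Z) => [k|k]; lia.
  rewrite (bigD1_seq (zindex (j%:Z - i%:Z))) ?iota_uniq ?mem_index_iota//=.
  rewrite zindexK eqxx mul1r big1 ?addr0// => l lz.
  case: eqP => [zE|_]; last by rewrite mul0r mulr0.
  by rewrite -zE zfreqK eqxx in lz.
rewrite (eq_bigr (fun i : 'I_N => \sum_(0 <= l < n) \sum_(j < N) T (zfreq l) *
    ((zfreq l == j%:Z - i%:Z :> int)%:R * moment_cross i j)%:C)); last first.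
  by move=> i _; rewrite exchange_big.
rewrite exchange_big; apply: eq_bigr => l _.
rewrite -frequency_sum rmorph_sum mulr_sumr; apply: eq_bigr => i _.
by rewrite rmorph_sum mulr_sumr.
Qed.

End diagonal_sums.

Section fixed_size.
Variables (N : nat) (N0 : (0 < N)%N).
Local Notation m := (radial_moment N : nat -> R).
Local Notation diag := (fun i => m (i + i)).

Lemma has_gauss_moments_Arg f : Cintegrable mu circle f ->
  has_gauss_moments N (fun z => f (Arg (toC z))).
Proof. by move=> fi i j; have [] := Cintegral_polar N0 i j fi. Qed.

Lemma gauss_moment_Arg f i j : Cintegrable mu circle f ->
  gauss_moment N (fun z => f (Arg (toC z))) i j =
  fourier f (j%:Z - i%:Z) * (m (i + j)%N)%:C.
Proof. by move=> fi; have [] := Cintegral_polar N0 i j fi. Qed.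

Lemma Cintegrable_one : Cintegrable mu circle (fun=> 1 : R[i]).
Proof.
apply: (@eq_Cintegrable _ _ R mu circle mC _ _ _ (Cintegrable_wave 0)).
by move=> t _; rewrite wave0.
Qed.

(** Parseval turns the diagonal term of ginibre_cov_linear into N times the sum of
f^(k) g^(- k) over all k, from which the double sum removes a finite part at each
frequency. *)
Theorem ginibre_cov_fourier f g :
  square_summable_derivative f -> square_summable_derivative g ->
  sums_to (fun n => \sum_(0 <= l < n) fourier f (zfreq l) * fourier g (- zfreq l) *
      (cov_weight m N `|zfreq l|)%:C)
    (ginibre_cov (@linear_statistic R N f) (@linear_statistic R N g)).
Proof.
move=> fS gS; have [fi _] := fS; have [gi _] := gS.
have fe := square_summable_expansion fi (bounded_sums_coef fS).
have ge := square_summable_expansion gi (bounded_sums_coef gS).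
have [fgi fgs] := L2_expansion_pairing fe (L2_expansion_L2 ge).
have m0 : forall n, 0 < m n := radial_moment_gt0 N0.
have one1 i j : gauss_moment N (fun=> 1) i j = (diag i * (i == j)%:R)%:C.
  rewrite [LHS](gauss_moment_Arg i j Cintegrable_one) fourier_one subr_eq0 eqz_nat eq_sym.
  by case: eqP => [->|_]; rewrite ?mul0r ?mulr0 ?mul1r ?mulr1.
rewrite [ginibre_cov _ _](ginibre_cov_linear (h := diag) (fun i => m0 _)
  (has_gauss_moments_Arg Cintegrable_one) one1 (has_gauss_moments_Arg fi)
  (has_gauss_moments_Arg gi) (has_gauss_moments_Arg fgi)).
rewrite (eq_bigr (fun=> circle_integral (fun t => f t * g t))); last first.
  move=> i _; rewrite /gauss_entry [X in X / _](gauss_moment_Arg i i fgi) subrr fourierE oppr0.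
  rewrite mulfK ?fmorph_eq0 ?gt_eqF//.
  by apply: eq_circle_integral => t; rewrite wave0 mul1r.
rewrite sumr_const card_ord.
rewrite (eq_bigr (fun i : 'I_N => \sum_(j < N)
    fourier f (j%:Z - i%:Z) * fourier g (- (j%:Z - i%:Z)) * (moment_cross m i j)%:C)); last first.
  move=> i _; apply: eq_bigr => j _; rewrite /gauss_entry (gauss_moment_Arg i j fi) (gauss_moment_Arg j i gi) opprB.
  rewrite /moment_cross [(j + i)%N]addnC fmorph_div/= rmorphXn rmorphM/=.
  by field; rewrite !fmorph_eq0 !gt_eqF.
set I := circle_integral _ in fgs *.
have H := @cross_sum_frequencies m N (fun k : int => fourier f k * fourier g (- k)).
have := sums_toB (sums_toZ N%:R fgs) (sums_to_eventually (u := fun n =>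
   \sum_(0 <= l < n) fourier f (zfreq l) * fourier g (- zfreq l) *
     (N%:R - cov_weight m N `|zfreq l|)%:C) (n0 := N.*2) (fun n Nn => esym (H n Nn))).
rewrite mulr_natl; congr sums_to; apply/funext => n.
rewrite mulr_sumr -sumrB; apply: eq_bigr => l _.
by rewrite rmorphB rmorph_nat; ring.
Qed.

End fixed_size.

End exact_covariance.

(** * Logarithmic asymptotics *)

Section covariance_error.
Context {R : realType}.
Local Notation mu := (@lebesgue_measure R).
Implicit Types (f g : R -> R[i]) (G : int -> R).

Lemma esum_bounded_sums G (e : nat -> int) : injective e -> (forall k, 0 <= G k) ->
  (\esum_(k in [set: int]) (G k)%:E < +oo)%E -> bounded_sums (fun l => G (e l)).
Proof.
move=> einj G0 Goo; split; first by move=> l; exact: G0.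
have S0 : (0 <= \esum_(k in [set: int]) (G k)%:E)%E.
  by apply: esum_ge0 => k _; rewrite lee_fin.
exists (fine (\esum_(k in [set: int]) (G k)%:E)%E) => n.
rewrite -lee_fin fineK; last by rewrite ge0_fin_numE.
apply: esum_ge; exists [set` map e (index_iota 0 n)].
  by split => //; exact: finite_seq.
rewrite -(@fsbig_seq _ _ _ _ (map e (index_iota 0 n)) (fun k => (G k)%:E)); last first.
  by rewrite map_inj_uniq// iota_uniq.
by rewrite big_map sumEFin.
Qed.

Lemma intr_absz (z : int) : `|z%:~R : R| = `|z|%N%:R.
Proof. by rewrite -intr_norm natr_absz. Qed.

Lemma sqr_intr_absz (z : int) : (z%:~R : R) ^+ 2 = `|z|%N%:R ^+ 2.
Proof. by rewrite -intr_absz real_normK ?num_real. Qed.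

(** The logarithm costs a power k^(delta / 2), which AM-GM charges entirely to D;
so one of the two functions suffices to carry the stronger condition. *)
Lemma log_absorb (delta D E : R) (k : nat) : 0 < delta -> 0 <= D -> 0 <= E ->
  D * E * (2 * (k%:R ^+ 2 * (1 + ln k%:R))) <=
  (1 + 2 / delta) * (k%:R `^ (2 + delta) * D ^+ 2 + k%:R ^+ 2 * E ^+ 2).
Proof.
move=> d0 D0 E0; have d2 : 0 <= 2 / delta by rewrite divr_ge0// ltW.
have rhs0 : 0 <= k%:R `^ (2 + delta) * D ^+ 2 + k%:R ^+ 2 * E ^+ 2.
  by rewrite addr_ge0// mulr_ge0 ?sqr_ge0 ?powR_ge0.
case: k rhs0 => [|k] rhs0.
  rewrite [leLHS](_ : _ = 0); last by rewrite expr0n/= mul0r !mulr0.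
  by apply: mulr_ge0 rhs0; rewrite addr_ge0.
set x : R := k.+1%:R in rhs0 *; have x1 : 1 <= x by rewrite ler1n.
have x0 : 0 < x by rewrite (lt_le_trans ltr01).
pose q := x `^ (delta / 2).
have q1 : 1 <= q.
  have d20 : 0 <= delta / 2 by rewrite divr_ge0// ltW.
  by have := ler_powR x1 d20; rewrite powRr0.
have lnx : ln x <= 2 / delta * q.
  have q0 : 0 < q by rewrite (lt_le_trans ltr01).
  have := ltW (ln_sublinear q0); rewrite /q ln_powR -/q => h.
  rewrite -[ln x](_ : 2 / delta * (delta / 2 * ln x) = _); last by field; rewrite gt_eqF.
  by rewrite ler_wpM2l.
have lq : 1 + ln x <= (1 + 2 / delta) * q by rewrite mulrDl mul1r lerD.
have q2 : x `^ (2 + delta) = x ^+ 2 * q ^+ 2.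
  rewrite powRD; last by rewrite (gt_eqF x0) implybT.
  by rewrite powR_mulrn ?(ltW x0)// -[q ^+ 2]powR_mulrn ?powR_ge0// /q -powRrM divfK.
rewrite q2; apply: (@le_trans _ _ (D * E * (2 * (x ^+ 2 * ((1 + 2 / delta) * q))))).
  by rewrite ler_wpM2l ?mulr_ge0// ler_wpM2l// ler_wpM2l ?sqr_ge0.
have : 0 <= (1 + 2 / delta) * (x ^+ 2 * (q * D - E) ^+ 2).
  by rewrite mulr_ge0 ?addr_ge0// mulr_ge0 ?sqr_ge0.
move=> h; rewrite -subr_ge0; apply: le_trans h _.
by rewrite le_eqVlt; apply/orP; left; apply/eqP; ring.
Qed.

Section fixed_functions.
Variables (f g : R -> R[i]).
Hypotheses (fS : square_summable_derivative f) (gS : square_summable_derivative g)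
  (gS' : bounded_sums (fun l => `|zfreq l|%N%:R ^+ 2 * normc (fourier g (- zfreq l)) ^+ 2)).

Let D l : R := normc (fourier f (zfreq l)).
Let E l : R := normc (fourier g (- zfreq l)).
Let k l : nat := `|zfreq l|%N.

Definition covariance_error (N : nat) : R :=
  normc (ginibre_cov (@linear_statistic R N f) (@linear_statistic R N g) -
         (ln N%:R / 4)%:C *
           circle_integral (fun t => weak_derivative f t * weak_derivative g t)).

Definition weight_error (N l : nat) : R :=
  `|cov_weight (radial_moment N) N `|zfreq l| - `|zfreq l|%N%:R ^+ 2 / 4 * ln N%:R|.

Lemma weight_error_log N l : (0 < N)%N ->
  weight_error N l <= 2 * ((k l)%:R ^+ 2 * (1 + ln (k l)%:R)).
Proof.
move=> N0; have cN : 0 < N%:R :> R by rewrite ltr0n.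
rewrite /weight_error -/(k l); have [->|k0] := posnP (k l).
  by rewrite (cov_weight0 (radial_moment_gt0 N0)) expr0n/= !mul0r subrr normr0 mulr0.
exact: (cov_weight_log cN (radial_moment_gt0 N0) (radial_moment_rec N0)
  (radial_moment_convex N0) k0 N0).
Qed.

Lemma weight_error_unif N l : (0 < N)%N ->
  weight_error N l <= 2 * ((k l)%:R ^+ 2 * (1 + ln N%:R)).
Proof.
move=> N0; have cN : 0 < N%:R :> R by rewrite ltr0n.
rewrite /weight_error -/(k l); have [->|k0] := posnP (k l).
  by rewrite (cov_weight0 (radial_moment_gt0 N0)) expr0n/= !mul0r subrr normr0 mulr0.
exact: (cov_weight_unif cN (radial_moment_gt0 N0) (radial_moment_rec N0)
  (radial_moment_convex N0) k0 N0).
Qed.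

(** The exact formula and Parseval's identity are both sums over frequencies, and
the error is the sum of their differences. *)
Lemma covariance_error_le N C : (0 < N)%N ->
  (exists n0, forall n, (n0 <= n)%N -> \sum_(0 <= l < n) D l * E l * weight_error N l <= C) ->
  covariance_error N <= C.
Proof.
move=> N0 [n0 H].
have := sums_toB (ginibre_cov_fourier N0 fS gS)
  (sums_toZ (ln N%:R / 4)%:C (weak_derivative_pairing fS gS)).
move=> /sums_to_normc_le; apply; exists n0 => n /H; apply: le_trans.
rewrite mulr_sumr -sumrB (le_trans (ler_normc_sum _ _ _))//.
rewrite le_eqVlt; apply/orP; left; apply/eqP; apply: eq_bigr => l _.
rewrite /D /E /weight_error -normc_real -!normcM; congr normc.
rewrite sqr_intr_absz; set x : R := _ ^+ 2; move: (cov_weight _ _ _) => c.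
have -> : (c - x / 4 * ln N%:R)%:C = c%:C - (ln N%:R / 4)%:C * x%:C.
  by rewrite -rmorphM -rmorphB; congr (_%:C); ring.
by ring.
Qed.

Let a l := (k l)%:R ^+ 2 * (D l ^+ 2 + E l ^+ 2).

Let a_bounded : bounded_sums a.
Proof.
have [f0 [C fC]] := fS.2; have [g0 [C' gC]] := gS'.
split; first by move=> l; rewrite mulr_ge0 ?addr_ge0 ?sqr_ge0.
exists (C + C') => n; apply: le_trans (lerD (fC n) (gC n)).
rewrite -big_split/= le_eqVlt; apply/orP; left; apply/eqP; apply: eq_bigr => l _.
by rewrite /a mulrDr sqr_intr_absz.
Qed.

Let weighted_product l x : 0 <= x ->
  D l * E l * (2 * ((k l)%:R ^+ 2 * x)) <= a l * x.
Proof.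
move=> x0; rewrite -subr_ge0.
rewrite (_ : _ - _ = (k l)%:R ^+ 2 * x * (D l - E l) ^+ 2); last by rewrite /a; ring.
by apply: mulr_ge0; [apply: mulr_ge0; [exact: sqr_ge0|]|exact: sqr_ge0].
Qed.

Let DE0 l : 0 <= D l * E l. Proof. by rewrite mulr_ge0 ?normc_ge0. Qed.

Let ln_nat_ge0 n : 0 <= ln n%:R :> R.
Proof. by case: n => [|n]; [rewrite ln0|rewrite ln_ge0// ler1n]. Qed.

Lemma ln_nat_large (M : R) : exists n0, (0 < n0)%N /\ forall n, (n0 <= n)%N -> M <= ln n%:R.
Proof.
exists (Num.truncn (expR M)).+1; split => // n nM.
have n0 : (0 < n)%N by exact: leq_trans nM.
rewrite -[M]expRK ler_ln ?posrE ?expR_gt0 ?ltr0n//.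
by rewrite (le_trans (ltW (truncnS_gt (expR M))))// ler_nat.
Qed.

(** Cut the frequencies at an index J chosen from e alone: beyond J the uniform
bound leaves a small multiple of ln N, and the finitely many terms before J have
errors bounded in N. *)
Theorem covariance_error_littleo : covariance_error =o_\oo (fun N : nat => ln N%:R : R).
Proof.
apply/eqoP => e e0.
have [J HJ] := bounded_sums_tail a_bounded (divr_gt0 e0 (ltr0n R 4)).
pose K := \sum_(0 <= l < J) a l * (1 + ln (k l)%:R).
have [n0 [n00 Hn0]] := ln_nat_large (Num.max 1 (2 * K / e)).
exists n0 => // N /= n0N; have N0 : (0 < N)%N by exact: leq_trans n0N.
have := Hn0 _ n0N; rewrite ge_max => /andP[ln1 lnK].
rewrite [leLHS]ger0_norm ?normc_ge0// [X in _ * X]ger0_norm//.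
apply: covariance_error_le => //; exists J => n Jn.
rewrite (big_cat_nat (leq0n J) Jn).
apply: (@le_trans _ _ (K + e / 4 * (1 + ln N%:R))).
  apply: lerD.
    apply: ler_sum => l _; apply: le_trans (weighted_product l _); last by rewrite addr_ge0.
    by rewrite ler_wpM2l// weight_error_log.
  apply: (@le_trans _ _ ((\sum_(J <= l < n) a l) * (1 + ln N%:R))).
    rewrite mulr_suml; apply: ler_sum => l _.
    apply: le_trans (weighted_product l _); last by rewrite addr_ge0.
    by rewrite ler_wpM2l// weight_error_unif.
  by rewrite ler_wpM2r ?addr_ge0// HJ.
have Ke : K <= e / 2 * ln N%:R.
  by move: lnK; rewrite ler_pdivrMr// => ?; lra.
have : e / 4 * (1 + ln N%:R) <= e / 4 * (2 * ln N%:R).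
  by rewrite ler_wpM2l ?divr_ge0 ?(ltW e0)//; lra.
by lra.
Qed.

(** Any summable majorant of the errors of the single frequencies that is
independent of N bounds the total. *)
Lemma covariance_error_bounded (w : nat -> R) (c : R) : 0 <= c -> bounded_sums w ->
  (forall l, D l * E l * (2 * ((k l)%:R ^+ 2 * (1 + ln (k l)%:R))) <= c * w l) ->
  covariance_error =O_\oo (fun _ : nat => 1 : R).
Proof.
move=> c0 [w0 [C wC]] DEw; apply/eqO_exP.
have C0 : 0 <= C by have := wC 0%N; rewrite big_geq.
exists (c * C + 1); first by rewrite ltr_wpDl// mulr_ge0.
exists 1%N => // N /= N0; rewrite normr1 mulr1 ger0_norm ?normc_ge0//.
apply: (@le_trans _ _ (c * C)); last by rewrite lerDl.
apply: covariance_error_le => //; exists 0%N => n _.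
apply: (@le_trans _ _ (c * \sum_(0 <= l < n) w l)); last by rewrite ler_wpM2l.
rewrite mulr_sumr; apply: ler_sum => l _; apply: le_trans (DEw l).
by rewrite ler_wpM2l// weight_error_log.
Qed.

Theorem covariance_error_bigO (delta : R) : 0 < delta ->
  bounded_sums (fun l => (k l)%:R `^ (2 + delta) * D l ^+ 2) \/
  bounded_sums (fun l => (k l)%:R `^ (2 + delta) * E l ^+ 2) ->
  covariance_error =O_\oo (fun _ : nat => 1 : R).
Proof.
move=> d0 H; have c0 : 0 <= 1 + 2 / delta by rewrite addr_ge0// divr_ge0// ltW.
have bD (u v : nat -> R) : bounded_sums u -> bounded_sums v -> bounded_sums (fun l => u l + v l).
  move=> [u0 [C uC]] [v0 [C' vC]]; split; first by move=> l; rewrite addr_ge0.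
  by exists (C + C') => n; rewrite big_split lerD.
have bf : bounded_sums (fun l => (k l)%:R ^+ 2 * D l ^+ 2).
  by apply: (bounded_sums_le _ fS.2) => l; rewrite -sqr_intr_absz mulr_ge0 ?sqr_ge0/=.
case: H => [/bD /(_ gS')|/bD /(_ bf)] /(covariance_error_bounded c0); apply => l.
  by apply: log_absorb; rewrite ?normc_ge0.
by rewrite [D l * _]mulrC; apply: log_absorb; rewrite ?normc_ge0.
Qed.

End fixed_functions.

End covariance_error.

Theorem theorem1p4 (R : realType) (f g : R -> R[i])
    (f_int : Cintegrable lebesgue_measure circle f)
    (g_int : Cintegrable lebesgue_measure circle g)
    (f_H1 : (\esum_(k in [set: int])
               (k%:~R ^+ 2 * normc (fourier f k) ^+ 2)%:E < +oo)%E)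
    (g_H1 : (\esum_(k in [set: int])
               (k%:~R ^+ 2 * normc (fourier g k) ^+ 2)%:E < +oo)%E) :
  let error (N : nat) : R :=
    normc (ginibre_cov (@linear_statistic R N f) (@linear_statistic R N g) -
           (ln N%:R / 4)%:C *
             circle_integral
               (fun t => weak_derivative f t * weak_derivative g t)) in
  error =o_\oo (fun N : nat => ln N%:R : R) /\
  ((exists2 delta : R, 0 < delta &
      (\esum_(k in [set: int])
         (`|k%:~R| `^ (2 + delta) * normc (fourier f k) ^+ 2)%:E < +oo)%E \/
      (\esum_(k in [set: int])
         (`|k%:~R| `^ (2 + delta) * normc (fourier g k) ^+ 2)%:E < +oo)%E) ->
   error =O_\oo (fun _ : nat => 1 : R)).
Proof.
have zinj : injective zfreq := can_inj zfreqK.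
have Nzinj : injective (fun l => - zfreq l) by move=> i j /oppr_inj /zinj.
have sq0 (h : R -> R[i]) k : 0 <= (k%:~R : R) ^+ 2 * normc (fourier h k) ^+ 2.
  by rewrite mulr_ge0// sqr_ge0.
have fS : square_summable_derivative f.
  by split; [exact: f_int|exact: esum_bounded_sums zinj (sq0 f) f_H1].
have gS : square_summable_derivative g.
  by split; [exact: g_int|exact: esum_bounded_sums zinj (sq0 g) g_H1].
have gS' : bounded_sums (fun l => `|zfreq l|%N%:R ^+ 2 * normc (fourier g (- zfreq l)) ^+ 2).
  have := esum_bounded_sums Nzinj (sq0 g) g_H1.
  by congr bounded_sums; apply/funext => l; rewrite sqr_intr_absz abszN.
split; first exact: covariance_error_littleo fS gS gS'.
move=> [delta d0 H]; apply: (covariance_error_bigO fS gS gS' d0).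
have p0 (h : R -> R[i]) k : 0 <= `|k%:~R : R| `^ (2 + delta) * normc (fourier h k) ^+ 2.
  by rewrite mulr_ge0 ?sqr_ge0 ?powR_ge0.
case: H => H; [left|right].
  have := esum_bounded_sums zinj (p0 f) H.
  by congr bounded_sums; apply/funext => l; rewrite intr_absz.
have := esum_bounded_sums Nzinj (p0 g) H.
by congr bounded_sums; apply/funext => l; rewrite intr_absz abszN.
Qed.
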